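(* Let $T\in(0,\infty)$, $\beta\in(0,1]$, $\alpha\in(0,\beta)$, $c,r\in[0,\infty)$, let $(\Omega,\mathcal F,\mathbb P)$ be a probability space, let $(E,\|\cdot\|_E)$ be a separable $\mathbb R$-Banach space with type $2$, let $X\colon[0,T]\times\Omega\to E$ be a stochastic process with continuous sample paths which satisfies for all $p\in[1,\infty)$, $\gamma\in[0,\beta)$ that $X\in\mathcal C^\gamma([0,T],\|\cdot\|_{\mathcal L^p(\mathbb P;\|\cdot\|_E)})$, for every $N\in\mathbb N$, $\ell\in\mathbb N_0$, $k\in\mathbb N$ let $Y^{N,\ell,k}\colon[0,T]\times\Omega\to E$ be a stochastic process which satisfies for all $n\in\{0,1,\dots,N-1\}$, $t\in[\frac{nT}N,\frac{(n+1)T}N]$, $p\in[1,\infty)$, $\rho\in[0,\beta)$ that $$Y^{N,\ell,k}_t=\bigl(n+1-\tfrac{tN}T\bigr)Y^{N,\ell,k}_{\frac{nT}N}+\bigl(\tfrac{tN}T-n\bigr)Y^{N,\ell,k}_{\frac{(n+1)T}N},$$ $$\sup_{M\in\mathbb N}\sup_{m\in\{0,1,\dots,M\}}\Bigl(M^\rho\bigl\|X_{\frac{mT}M}-Y^{M,0,1}_{\frac{mT}M}\bigr\|_{\mathcal L^p(\mathbb P;\|\cdot\|_E)}\Bigr)<\infty,$$ assume for every $N_1,N_2\in\mathbb N$ that $(Y^{N_1,\ell,k},Y^{N_2,\ell,k})$, $k\in\mathbb N$, $\ell\in\mathbb N_0$, are independent and identically distributed, and let $f\colon C([0,T],E)\to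 C([0,T],E)$ be a Borel measurable function (i.e., $\mathcal B(C([0,T],E))/\mathcal B(C([0,T],E))$-measurable) which satisfies for all $v,w\in\mathcal C^\alpha([0,T],\|\cdot\|_E)$ that $f(v),f(w)\in\mathcal C^\alpha([0,T],\|\cdot\|_E)$ and $$\|f(v)-f(w)\|_{\mathcal C^\alpha([0,T],\|\cdot\|_E)}\le c\bigl(1+\|v\|^r_{\mathcal C^\alpha([0,T],\|\cdot\|_E)}+\|w\|^r_{\mathcal C^\alpha([0,T],\|\cdot\|_E)}\bigr)\|v-w\|_{\mathcal C^\alpha([0,T],\|\cdot\|_E)}.$$ Then it holds that $\mathbb E[\|f(X)\|_{\mathcal C^\alpha([0,T],\|\cdot\|_E)}]<\infty$, it holds for all $p\in[1,\infty)$, $\rho\in[0,\beta-\alpha)$ that $$\sup_{N\in\mathbb N}\Bigl[N^\rho\Bigl(\mathbb E\bigl[\|f(X)-f(Y^{N,0,1})\|^p_{\mathcal C^\alpha([0,T],\|\cdot\|_E)}\bigr]\Bigr)^{1/p}\Bigr]<\infty,$$ and it holds for all $p\in[1,\infty)$, $\gamma\in[0,\alpha)$, $\rho\in[0,\beta-\alpha)$ that $$\sup_{L\in\mathbb N}\Biggl[2^{L\cdot\min\{\rho,\frac12\}}L^{-\mathbb 1_{\{1/2\}}(\rho)}\Biggl(\mathbb E\Biggl[\Bigl\|\mathbb E[f(X)]-\sum_{k=1}^{2^L}\tfrac{f(Y^{1,0,k})}{2^L}-\sum_{\ell=1}^L\sum_{k=1}^{2^{L-\ell}}\tfrac{f(Y^{2^\ell,\ell,k})-f(Y^{2^{(\ell-1)},\ell,k})}{2^{L-\ell}}\Bigr\|^p_{\mathcal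 C^\gamma([0,T],\|\cdot\|_E)}\Biggr]\Biggr)^{1/p}\Biggr]<\infty.$$
   Context: $\mathbb N=\{1,2,\dots\}$, $\mathbb N_0=\mathbb N\cup\{0\}$. $C([0,T],E)$ is the Banach space of continuous functions from $[0,T]$ to $E$ with the supremum norm; $\mathbb 1_{\{1/2\}}(\rho)$ equals $1$ if $\rho=\frac12$ and $0$ otherwise. For a strongly measurable $Z\colon\Omega\to E$, $\|Z\|_{\mathcal L^p(\mathbb P;\|\cdot\|_E)}=(\mathbb E[\|Z\|_E^p])^{1/p}\in[0,\infty]$. For a vector space $V$ with a seminorm $\|\cdot\|$ which may take the value $\infty$, $s\in[0,1]$ and $g\colon[0,T]\to V$: $\|g\|_{\mathcal C^s([0,T],\|\cdot\|)}=\sup_{t}\|g(t)\|+\sup_{t\ne u}\|g(t)-g(u)\|/|t-u|^s\in[0,\infty]$, and $\mathcal C^s([0,T],\|\cdot\|)$ is the set of continuous functions $g$ for which this is finite. $X\in\mathcal C^\gamma([0,T],\|\cdot\|_{\mathcal L^p(\mathbb P;\|\cdot\|_E)})$ refers to the function $t\mapsto X_t$. An $\mathbb R$-Banach space $E$ has type $q\in(0,\infty)$ if there is $K\in[0,\infty)$ such that for all $k\in\mathbb N$, all $x_1,\dots,x_k\in E$ and all independent random variables $r_1,\dots,r_k$ with $\mathbb P(r_j=1)=\mathbb P(r_j=-1)=\frac12$ it holds that $(\mathbb E[\|\sum_{j=1}^kr_jx_j\|_E^q])^{1/q}\le K(\sum_{j=1}^k\|x_j\|_E^q)^{1/q}$.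 *)

(* Defs.v *)
From HB Require Import structures.
From mathcomp Require Import all_boot all_order all_algebra.
From mathcomp Require Import all_classical all_reals all_analysis.

Set Implicit Arguments.
Unset Strict Implicit.
Unset Printing Implicit Defensive.

Import Order.TTheory GRing.Theory Num.Theory.
Import numFieldNormedType.Exports.

Local Open Scope classical_set_scope.
Local Open Scope ring_scope.

HB.mixin Record isCompactSpace K & Topological K := {
  compact_setT : compact [set: K] }.

#[short(type="compactType")]
HB.structure Definition CompactSpace :=
  {K of Topological K & isCompactSpace K}.

Section contfun.
Context {R : realType}.

Definition contfun_pred (K : topologicalType) (E : normedModType R) :
  {pred K -> E} := fun g => `[< continuous g >].

Record contfun (K : topologicalType) (E : normedModType R) := ContFun {
  contfun_fun :> K -> E;
  contfunP : contfun_fun \in @contfun_pred K E }.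

HB.instance Definition _ K E := [isSub for @contfun_fun K E].
HB.instance Definition _ K E := [Choice of contfun K E by <:].

Section submod.
Variables (K : topologicalType) (E : normedModType R).

Lemma contfun_submod_closed : submod_closed (@contfun_pred K E).
Proof.
split; first by apply/asboolP; exact: cst_continuous.
move=> a g h /asboolP cg /asboolP ch; apply/asboolP => t.
exact: (cvgD (cvgZ (cvg_cst a) (cg t)) (ch t)).
Qed.

HB.instance Definition _ :=
  GRing.isSubmodClosed.Build R (K -> E) (@contfun_pred K E) contfun_submod_closed.

End submod.

HB.instance Definition _ K E := [SubChoice_isSubLmodule of contfun K E by <:].

Lemma contfun_continuous (K : topologicalType) (E : normedModType R)
  (g : contfun K E) : continuous g.
Proof. exact/asboolP/contfunP. Qed.

Section norm.
Variables (K : compactType) (E : normedModType R).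
Implicit Types g h : contfun K E.

Definition contfun_norm g : R := sup (range (fun t => `|g t|)).

Lemma contfun_bounded g : has_ubound (range (fun t => `|g t|)).
Proof.
have [M [Mr gM]] := compact_bounded (continuous_compact
  (continuous_subspaceT (@contfun_continuous _ _ g)) (@compact_setT K)).
exists (M + 1) => _ [t _ <-].
by apply: gM; [rewrite ltrDl | exists t].
Qed.

Lemma contfun_norm_ub g t : `|g t| <= contfun_norm g.
Proof. by apply: ub_le_sup; [exact: contfun_bounded|exists t]. Qed.

Lemma contfun_norm_le g (M : R) : 0 <= M -> (forall t, `|g t| <= M) ->
  contfun_norm g <= M.
Proof.
move=> M0 gM; rewrite /contfun_norm.
have [->|/set0P ne] := eqVneq (range (fun t => `|g t|)) set0.
  by rewrite sup0.
by apply: ge_sup => // _ [t _ <-].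
Qed.

Lemma contfun_norm_ge0 g : 0 <= contfun_norm g.
Proof.
have [e0|/set0P[_ [t _ _]]] := eqVneq (range (fun t => `|g t|)) set0.
  by rewrite /contfun_norm e0 sup0.
exact: le_trans (contfun_norm_ub g t).
Qed.

Lemma contfun_normD g h :
  contfun_norm (g + h) <= contfun_norm g + contfun_norm h.
Proof.
apply: contfun_norm_le => [|t]; first by rewrite addr_ge0 ?contfun_norm_ge0.
by apply: (le_trans (ler_normD _ _)); rewrite lerD ?contfun_norm_ub.
Qed.

Lemma contfun_normZ (a : R) g : contfun_norm (a *: g) = `|a| * contfun_norm g.
Proof.
have le b f : contfun_norm (b *: f) <= `|b| * contfun_norm f.
  apply: contfun_norm_le => [|t]; first by rewrite mulr_ge0 ?contfun_norm_ge0.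
  by rewrite [X in `|X|](_ : _ = b *: f t)// normrZ ler_wpM2l ?contfun_norm_ub.
apply/eqP; rewrite eq_le le /=; have [->|a0] := eqVneq a 0.
  by rewrite normr0 mul0r contfun_norm_ge0.
rewrite -ler_pdivlMl ?normr_gt0// -normfV (le_trans _ (le _ _))//.
by rewrite scalerK.
Qed.

Lemma contfun_norm_eq0 g : contfun_norm g = 0 -> g = 0.
Proof.
move=> g0; apply/val_inj/funext => t; apply/eqP.
by rewrite -normr_le0 -g0 contfun_norm_ub.
Qed.

HB.instance Definition _ := Lmodule_isNormed.Build R (contfun K E)
  contfun_normD contfun_normZ contfun_norm_eq0.

Lemma contfun_normE g : `|g| = contfun_norm g. Proof. by []. Qed.

End norm.

Lemma contfun_complete (K : compactType) (E : completeNormedModType R)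
  (F : set_system (contfun K E)) : ProperFilter F -> cauchy F -> cvg F.
Proof.
move=> FF Fc.
have Fc' (e : R) : 0 < e ->
    \forall g & h \near F, forall t : K,
      `|(g : contfun K E) t - (h : contfun K E) t| < e.
  move=> e0; have /cauchy_ballP/(_ e e0) := Fc.
  rewrite !near_simpl => H.
  apply: filterS H => -[g h]; rewrite -ball_normE /= => gh t.
  exact: le_lt_trans (contfun_norm_ub (g - h) t) gh.
have cvt t : cvg ((fun g : contfun K E => g t) @ F).
  apply: cauchy_cvg; apply/cauchy_ballP => e e0.
  rewrite near_map2.
  have := Fc' e e0; apply: filterS => -[g h] /= /(_ t).
  by rewrite -ball_normE.
pose l t := lim ((fun g : contfun K E => g t) @ F).
have unif (e : R) : 0 < e ->
    \forall g \near F, forall t : K, `|l t - (g : contfun K E) t| <= e.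
  move=> e0; have e2 : 0 < e / 2 by rewrite divr_gt0.
  have := Fc' _ e2 => /(@nearP_dep _ _ F F) H.
  near=> g => t; near F => h.
  rewrite (splitr e) (le_trans (ler_distD (h t) _ _))// lerD//.
    near: h; move/cvgrPdist_le : (cvt t) => /(_ _ e2); exact.
  rewrite distrC ltW//; move: (t); near: h; near: g; exact: H.
have lc : continuous l.
  move=> t; apply/cvgrPdist_le => e e0.
  have e3 : 0 < e / 3 by rewrite divr_gt0.
  near F => g.
  have gl : forall s, `|l s - g s| <= e / 3 by near: g; exact: unif.
  near=> s.
  have -> : l t - l s = (l t - g t) + (g t - g s) + (g s - l s).
    by rewrite !subrKA.
  rewrite (_ : e = e / 3 + e / 3 + e / 3); last first.
    by rewrite -mulr2n -mulrSr -[RHS]mulr_natr divfK.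
  rewrite (le_trans (ler_normD _ _))// lerD//; last by rewrite distrC.
  rewrite (le_trans (ler_normD _ _))// lerD//.
  near: s; have /cvgrPdist_le := @contfun_continuous _ _ g t.
  exact.
have lP : `[< continuous l >] by exact/asboolP.
apply/cvg_ex; exists (ContFun lP); apply/cvgrPdist_le => e e0.
have := unif _ e0; apply: filterS => g gl.
by rewrite contfun_normE; apply: contfun_norm_le => //; exact: ltW.
Unshelve. all: by end_near. Qed.

HB.instance Definition _ (K : compactType) (E : completeNormedModType R) :=
  Uniform_isComplete.Build (contfun K E) (@contfun_complete K E).

End contfun.

Definition timeI (R : realType) (T : R) : Type := set_type `[0, T].

Section timeI.
Context {R : realType}.
Implicit Type T : R.

HB.instance Definition _ T :=
  Topological.copy (timeI T) (set_type `[0, T]%classic).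

Definition time_val T (t : timeI T) : R := set_val t.
Coercion time_val : timeI >-> Real.sort.

Lemma time_valP T (t : timeI T) : 0 <= (t : R) <= T.
Proof. by case: t => x /= xP; move: (set_mem xP); rewrite /= in_itv. Qed.

Lemma timeI_compact T : compact [set: timeI T].
Proof.
move=> F FF _; pose v := @time_val T.
have vF : (v @ F) `[0, T]%classic.
  apply: (@filterS _ F _ setT) filterT => t _ /=.
  by rewrite in_itv/=; exact: time_valP.
have [x [x0T xF]] := @segment_compact R 0 T (v @ F) _ vF.
exists (exist _ x (mem_set x0T) : timeI T); split => // A B FA.
rewrite nbhsE => -[_ [[U oU <-] Ux] UB].
have vA : (v @ F) (v @` A) by apply: (@filterS _ F _ A) FA => t At; exists t.
have [_ [[t At <-] Ut]] := xF _ _ vA (open_nbhs_nbhs (conj oU Ux)).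
by exists t; split => //; exact: UB.
Qed.

HB.instance Definition _ T := isCompactSpace.Build (timeI T) (@timeI_compact T).

Lemma grid_subproof T (T0 : 0 < T) N (n : 'I_N.+1) :
  n%:R * T / N%:R \in `[0, T]%classic.
Proof.
rewrite inE /= in_itv /= divr_ge0 ?mulr_ge0 ?(ltW T0)//=.
case: N n => [|N] n; first by rewrite invr0 mulr0 ltW.
by rewrite ler_pdivrMr ?ltr0n// mulrC ler_pM2l// ler_nat -ltnS.
Qed.

(** The point nT/N of [0,T]. *)
Definition grid T (T0 : 0 < T) N (n : 'I_N.+1) : timeI T :=
  exist _ (n%:R * T / N%:R) (grid_subproof T0 n).

(** The path [g] as an element of C([0,T],E); the value 0 is only used when [g]
    is not continuous. *)
Definition cpath T (E : normedModType R) (g : timeI T -> E) :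
  contfun (timeI T) E := insubd 0 g.

End timeI.

(** For 0 < T both suprema in [holder_norm] range over nonempty sets, so the value
    [ereal_sup set0 = -oo] plays no role. *)
Section holder.
Context {R : realType} {T : R} {V : zmodType}.
Local Open Scope ereal_scope.

Definition holder_norm (nrm : V -> \bar R) (s : R) (g : timeI T -> V) : \bar R :=
  ereal_sup (range (fun t => nrm (g t))) +
  ereal_sup [set nrm (g tu.1 - g tu.2)%R *
                 ((`|time_val tu.1 - time_val tu.2| `^ s)^-1)%R%:E |
             tu in [set tu : timeI T * timeI T | tu.1 != tu.2]].

Definition holder_space (nrm : V -> \bar R) (s : R) : set (timeI T -> V) :=
  [set g : timeI T -> V |
    (forall t : timeI T, nrm (g u - g t)%R @[u --> t] --> 0) /\
    holder_norm nrm s g < +oo].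

End holder.

Definition enorm (R : realType) (E : normedModType R) (x : E) : \bar R :=
  `|x|%:E.

Section probability_notions.
Context d (Omega : measurableType d) (R : realType) (P : probability Omega R).

Definition Lp_norm (E : normedModType R) (p : R) (Z : Omega -> E) : \bar R :=
  Lnorm P p%:E (fun omega => enorm (Z omega)).

Definition independent_on d' (S : measurableType d') (I : choiceType)
    (D : set I) (Z : I -> Omega -> S) : Prop :=
  forall (J : seq I) (B : I -> set S), uniq J -> [set` J] `<=` D ->
    (forall i, measurable (B i)) ->
    P (\bigcap_(i in [set` J]) (Z i @^-1` B i)) =
    (\prod_(i <- J) P (Z i @^-1` B i))%E.

Definition identically_distributed_on d' (S : measurableType d') (I : Type)
    (D : set I) (Z : I -> Omega -> S) : Prop :=
  forall i j, D i -> D j -> forall B : set S, measurable B ->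
    P (Z i @^-1` B) = P (Z j @^-1` B).

Section bochner.
Variable V : normedModType R.
Implicit Types (g s : Omega -> V) (v : V).

Definition simple_map s : Prop :=
  finite_set (range s) /\ forall v, measurable (s @^-1` [set v]).

Definition simple_integral s : V :=
  \sum_(v \in range s) fine (P (s @^-1` [set v])) *: v.

Definition strongly_measurable g : Prop :=
  exists2 s_ : nat -> Omega -> V, (forall n, simple_map (s_ n)) &
    forall omega, s_ n omega @[n --> \oo] --> g omega.

Definition is_bochner_integral g v : Prop :=
  strongly_measurable g /\
  exists s_ : nat -> Omega -> V,
    [/\ forall n, simple_map (s_ n),
        (\int[P]_omega (enorm (g omega - s_ n omega)%R))%E
          @[n --> \oo] --> 0%E &
        simple_integral (s_ n) @[n --> \oo] --> v].

(** The Bochner integral of [g], with value 0 if [g] is not Bochner integrable. *)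
Definition bochner_integral g : V := xget 0 [set v | is_bochner_integral g v].

End bochner.
End probability_notions.

Notation borel S := (g_sigma_algebraType (@open S)).

(** [pathspace I E] is [I -> E] with the product of the Borel sigma-algebras; a
    process is treated as a random element of it. *)
Definition cylinder (I : Type) (E : ptopologicalType) : set (set (I -> E)) :=
  [set A | exists (t : I) (B : set (borel E)),
    measurable B /\ A = [set x | B (x t)]].

Notation pathspace I E := (g_sigma_algebraType (@cylinder I E)).

Section processes.
Context d (Omega : measurableType d) (R : realType) (T : R)
  (E : normedModType R).

Definition stochastic_process (Z : timeI T -> Omega -> E) : Prop :=
  forall t, measurable_fun setT (Z t : Omega -> borel E).

Definition path_pair (Z1 Z2 : timeI T -> Omega -> E) (omega : Omega) :
  (pathspace (timeI T) E * pathspace (timeI T) E)%type :=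
  (Z1 ^~ omega, Z2 ^~ omega).

End processes.

Definition separable (S : topologicalType) : Prop :=
  exists2 A : set S, countable A & dense A.

(** The Rademacher family may live on any probability space. *)
Definition has_type (R : realType) (E : normedModType R) (q : R) : Prop :=
  exists2 K : R, 0 <= K &
    forall (d : measure_display) (Omega : measurableType d)
      (P : probability Omega R) (k : nat) (x : 'I_k -> E)
      (r : 'I_k -> {RV P >-> R}),
      (0 < k)%N ->
      (forall j, P (r j @^-1` [set 1]) = (2^-1)%:E /\
                 P (r j @^-1` [set -1]) = (2^-1)%:E) ->
      independent_on P [set: 'I_k] (fun j => r j : Omega -> R) ->
      (Lp_norm P q (fun omega => (\sum_(j < k) r j omega *: x j)%R) <=
       (K * (\sum_(j < k) `|x j| `^ q) `^ q^-1)%:E)%E.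

(* Main.v *)
(** Moments of Hoelder norms are controlled by a Kolmogorov-Chentsov chaining along
    dyadic times, from moments of increments. The rates at the grid points, the
    regularity of X in L^p and the linearity of Y^N on the cells bound the increments
    of N^rho (X - Y^N) uniformly in N; this bounds the moments of its Hoelder norm,
    and the local Lipschitz estimate carries the bound over to N^rho (f(X) - f(Y^N)).

    The error of the multilevel estimator is a bias plus, for each level, a sum of
    independent centred terms. Point evaluations and Hoelder quotients of these
    sums are sums of independent centred elements of E, for which type 2 yields the
    n^(1/2) growth in every L^q: symmetrization reduces to Rademacher sums, and their
    moments follow from their second moment by a subgaussian bounded-difference
    estimate. Adding up the levels is a geometric sum, with one extra factor L
    when rho = 1/2. The chaining argument, which needs gamma < alpha, turns the
    resulting bound on alpha-Hoelder quotients into one on the gamma-Hoelder norm. *)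
Require Import Defs.
From HB Require Import structures.
From mathcomp Require Import all_boot all_order all_algebra.
From mathcomp Require Import all_classical all_reals all_analysis.
From mathcomp Require Import measurable_realfun.
From mathcomp Require Import ring lra.

Set Implicit Arguments.
Unset Strict Implicit.
Unset Printing Implicit Defensive.

Import Order.TTheory GRing.Theory Num.Theory.
Import numFieldNormedType.Exports.

Local Open Scope classical_set_scope.
Local Open Scope ring_scope.

(** * Moments and upper integrals *)

(** Moments are handled through [all_moments]: bounds of every integer order, uniform over an
    arbitrary index. This class is closed under sums, products and powers, so the polynomially
    growing Lipschitz constant is absorbed without tracking exponents, and uniformity in N, in the
    level or in a pair of times is a choice of index set.

    Mean zero is encoded by the convexity inequality [centered], which survives restriction to
    independent events. Hence adding an independent centred summand cannot decrease a moment, and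
    splitting a sum along a fixed sign vector compares it with the signed sum on the same
    probability space. Averaging over all sign vectors yields Rademacher sums. The conditioning
    behind this uses a countable partition of E, which separability provides.

    Independence is given for pairs of processes in a product path space, whose sigma-algebra sees
    only evaluations. As Y is piecewise linear, f(Y) is a function of finitely many grid values and
    therefore measurable there. *)

Section powers.
Context {R : realType}.
Implicit Types x y : R.

(** A convex function lies above its tangent at y. In the induction the new gap is (n+1) y^n
    (x-y)^2. *)
Lemma exprn_tangent x y n : 0 <= x -> 0 <= y ->
  y ^+ n.+1 + n.+1%:R * y ^+ n * (x - y) <= x ^+ n.+1.
Proof.
move=> x0 y0; elim: n => [|n IH]; first by rewrite !expr1 expr0; lra.
rewrite [leRHS]exprS; apply: le_trans (ler_wpM2l x0 IH).
rewrite -subr_ge0 (_ : _ - _ = n.+1%:R * (y ^+ n * (x - y) ^+ 2)).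
  by apply: mulr_ge0 => //; apply: mulr_ge0; [exact: exprn_ge0|exact: sqr_ge0].
by rewrite !exprS -[n.+2]addn1 natrD; ring.
Qed.

(** The tangent inequality at the weighted mean y is averaged. With total weight W below 1 the
    missing mass leaves n y^(n+1) (1-W), which has the right sign. *)
Lemma exprn_jensen (I : Type) (s : seq I) (w z : I -> R) n :
  (forall i, 0 <= w i) -> (forall i, 0 <= z i) -> \sum_(i <- s) w i <= 1 ->
  (\sum_(i <- s) w i * z i) ^+ n.+1 <= \sum_(i <- s) w i * z i ^+ n.+1.
Proof.
move=> w0 z0; set W := \sum_(i <- s) w i => W1.
set y := \sum_(i <- s) w i * z i.
have y0 : 0 <= y by apply: sumr_ge0 => i _; exact: mulr_ge0.
have : \sum_(i <- s) w i * (y ^+ n.+1 + n.+1%:R * y ^+ n * (z i - y)) <=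
       \sum_(i <- s) w i * z i ^+ n.+1.
  by apply: ler_sum => i _; exact: ler_wpM2l (exprn_tangent _ _ _).
apply: le_trans.
have -> : \sum_(i <- s) w i * (y ^+ n.+1 + n.+1%:R * y ^+ n * (z i - y)) =
    W * y ^+ n.+1 + n.+1%:R * y ^+ n * (y - W * y).
  rewrite /W {4}/y !big_distrl/= -sumrB big_distrr/= -big_split/=.
  by apply: eq_bigr => i _; ring.
rewrite -subr_ge0 (_ : _ - _ = n%:R * (y ^+ n.+1 * (1 - W))).
  by apply: mulr_ge0 => //; rewrite mulr_ge0 ?exprn_ge0// subr_ge0.
by rewrite !exprS -[n.+1]addn1 natrD; ring.
Qed.

Lemma ler_exprnD x y n : 0 <= x -> 0 <= y ->
  (x + y) ^+ n <= 2 ^+ n * (x ^+ n + y ^+ n).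
Proof.
move=> x0 y0; have [xy|/ltW yx] := lerP x y.
  have : (x + y) ^+ n <= (2 * y) ^+ n by rewrite lerXn2r ?nnegrE ?addr_ge0//; lra.
  move/le_trans; apply; rewrite exprMn ler_wpM2l ?exprn_ge0//.
  by rewrite lerDr exprn_ge0.
have : (x + y) ^+ n <= (2 * x) ^+ n by rewrite lerXn2r ?nnegrE ?addr_ge0//; lra.
move/le_trans; apply; rewrite exprMn ler_wpM2l ?exprn_ge0//.
by rewrite lerDl exprn_ge0.
Qed.

Lemma ler_exprn1D x m n : 0 <= x -> (m <= n)%N -> x ^+ m <= 1 + x ^+ n.
Proof.
move=> x0 mn; have [x1|/ltW x1] := lerP x 1.
  by rewrite (le_trans (exprn_ile1 _ x0 x1))// lerDl exprn_ge0.
by rewrite (le_trans (ler_weXn2l x1 mn))// lerDr.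
Qed.

End powers.

Section upper_expectation.
Context d (Omega : measurableType d) (R : realType) (P : probability Omega R).
Implicit Types (F G : Omega -> \bar R) (C : R).
Local Open Scope ereal_scope.

(** A bound on the upper integral of [F]. It is used for Hoelder norms of random
    paths, suprema over uncountably many times whose measurability is not at hand. *)
Definition ub_mean F C : Prop := exists G : Omega -> \bar R,
  [/\ measurable_fun setT G, forall w, 0 <= G w, forall w, F w <= G w &
      \int[P]_w G w <= C%:E].

(** The integral of a nonnegative function is a supremum over simple functions below it, hence
    monotone even where [F] is not measurable. This leads back from upper integrals to the integrals
    of the theorem. *)
Lemma integral_le_ub_mean F C : (forall w, 0 <= F w) -> ub_mean F C ->
  \int[P]_w F w <= C%:E.
Proof.
move=> F0 [G [mG G0 FG GC]]; apply: le_trans GC.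
rewrite !ge0_integralTE//; apply: le_ereal_sup => _ [h /= hF <-].
by exists h => // x; exact: le_trans (FG x).
Qed.

Lemma ub_mean_integral F C : measurable_fun setT F -> (forall w, 0 <= F w) ->
  \int[P]_w F w <= C%:E -> ub_mean F C.
Proof. by move=> mF F0 FC; exists F. Qed.

Lemma ub_mean_ge0 F C : ub_mean F C -> (0 <= C)%R.
Proof.
case=> G [_ G0 _ GC]; rewrite -lee_fin; apply: le_trans GC.
exact: integral_ge0.
Qed.

Lemma ub_mean_le F G C C' : (forall w, F w <= G w) -> (C' <= C)%R ->
  ub_mean G C' -> ub_mean F C.
Proof.
move=> FG CC [H [mH H0 GH HC]]; exists H; split => // [w|].
  exact: le_trans (GH w).
by rewrite (le_trans HC) ?lee_fin.
Qed.

(** The majorant is reset to [+oo] on the null set, so that the domination holds everywhere and the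
    integral is unchanged. *)
Lemma ub_mean_ae F G C : {ae P, forall w, F w <= G w} ->
  ub_mean G C -> ub_mean F C.
Proof.
move=> [N [mN N0 FGN]] [H [mH H0 GH HC]].
pose K w : \bar R := if w \in N then +oo else H w.
have mK : measurable_fun setT K.
  apply: measurable_fun_ifT => //; apply: (measurable_fun_bool true).
  by rewrite setTI (_ : _ @^-1` _ = N)//; apply/seteqP; split => w /=; [move/set_mem | move/mem_set].
have K0 w : 0 <= K w by rewrite /K; case: ifP.
exists K; split => // [w|].
  rewrite /K; case: ifPn => [_|]; first exact: leey.
  rewrite notin_setE => wN; apply: le_trans (GH w).
  by apply: contrapT => nle; apply: wN; apply: FGN.
suff -> : \int[P]_w K w = \int[P]_w H w by [].
apply: ge0_ae_eq_integral => //; exists N; split => // w /= /not_implyP[_].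
rewrite /K; case: ifPn => [/[1!inE]//|]; by [].
Qed.

Lemma ub_meanD F G C C' : ub_mean F C -> ub_mean G C' ->
  ub_mean (fun w => F w + G w) (C + C').
Proof.
move=> [F' [mF F0 FF FC]] [G' [mG G0 GG GC]].
exists (fun w => F' w + G' w); split.
- exact: emeasurable_funD.
- by move=> w; rewrite adde_ge0.
- by move=> w; rewrite leeD.
- by rewrite ge0_integralD// EFinD leeD.
Qed.

Lemma ub_meanZ F C (k : R) : (0 <= k)%R -> ub_mean F C ->
  ub_mean (fun w => k%:E * F w) (k * C).
Proof.
move=> k0 [F' [mF F0 FF FC]]; exists (fun w => k%:E * F' w); split.
- exact: measurable_funeM.
- by move=> w; rewrite mule_ge0// lee_fin.
- by move=> w; rewrite lee_wpmul2l// lee_fin.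
- by rewrite ge0_integralZl// ?lee_fin// EFinM lee_wpmul2l// lee_fin.
Qed.

Lemma ub_mean_cst C : (0 <= C)%R -> ub_mean (fun=> C%:E) C.
Proof.
move=> C0; exists (cst C%:E); split => //.
by rewrite integral_cst// [X in _ * X](@probability_setT _ _ _ P) mule1.
Qed.

Lemma ub_mean_sum (I : Type) (s : seq I) (F : I -> Omega -> \bar R) (C : I -> R) :
  (forall i, ub_mean (F i) (C i)) ->
  ub_mean (fun w => \sum_(i <- s) F i w) (\sum_(i <- s) C i)%R.
Proof.
move=> FC; elim: s => [|i s IH].
  by rewrite big_nil; under eq_fun do rewrite big_nil; exact: ub_mean_cst.
rewrite big_cons; under eq_fun do rewrite big_cons; exact: ub_meanD.
Qed.

(** The series dominates the supremum and can be integrated term by term; this sums the dyadic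
    levels of the chaining. *)
Lemma ub_mean_nneseries (F : nat -> Omega -> \bar R) (C : nat -> R) (S : R) :
  (forall n, ub_mean (F n) (C n)) ->
  (forall n, (\sum_(0 <= k < n) C k <= S)%R) ->
  ub_mean (fun w => ereal_sup (range (fun n => F n w))) S.
Proof.
move=> /choice[G] GP CS.
exists (fun w => \sum_(n <oo) G n w); split.
- apply: ge0_emeasurable_sum => [k w _ _|k _]; by case: (GP k).
- by move=> w; apply: nneseries_ge0 => n _ _; case: (GP n).
- move=> w; apply: ge_ereal_sup => _ [n _ <-].
  have [_ G0 + _] := GP n; move/(_ w)/le_trans; apply.
  rewrite (le_trans _ (nneseries_lim_ge n.+1 _))//; last first.
    by move=> k _ _; case: (GP k).
  by rewrite big_nat_recr//= leeDr// sume_ge0// => i _; case: (GP i).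
- rewrite integral_nneseries//; [|by move=> n; case: (GP n)..|]; last first.
    by move=> n w _; case: (GP n).
  apply: lime_le.
    by apply: is_cvg_nneseries => n _ _; apply: integral_ge0 => w _; case: (GP n).
  near=> n; rewrite (@le_trans _ _ (\sum_(0 <= k < n) (C k)%:E))//.
    by apply: lee_sum => k _; case: (GP k).
  by rewrite sumEFin lee_fin.
Unshelve. all: by end_near. Qed.

Lemma ub_mean_ae_lty F C : ub_mean F C -> {ae P, forall w, F w < +oo}.
Proof.
move=> [G [mG G0 FG GC]].
have iG : P.-integrable setT G.
  apply/integrableP; split => //.
  under eq_integral => w _ do rewrite gee0_abs//.
  by rewrite (le_lt_trans GC)// ltry.
have := integrable_ae measurableT iG.
apply: filterS => w /(_ I) Gw; rewrite (le_lt_trans (FG w))//.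
by rewrite -ge0_fin_numE.
Qed.

End upper_expectation.

Lemma powR_le_exprn (R : realType) (x p : R) n : 0 <= x -> 0 <= p -> p <= n%:R ->
  x `^ p <= 1 + x ^+ n.
Proof.
move=> x0 p0 pn; have [x1|/ltW x1] := lerP x 1.
  rewrite (@le_trans _ _ 1)//; last by rewrite lerDl exprn_ge0.
  have p1 : 1 `^ p = 1 :> R by rewrite powR1.
  by rewrite -[leRHS]p1 ge0_ler_powR ?nnegrE.
rewrite (le_trans (ler_powR x1 pn))// powR_mulrn// lerDr.
by [].
Qed.

Lemma exists_nat_ge (R : realType) (x : R) : exists n : nat, x <= n%:R.
Proof.
exists (Num.truncn `|x|).+1; apply: le_trans (ler_norm x) _.
by apply/ltW; exact: truncnS_gt.
Qed.

(** * Families with uniformly bounded moments of all orders *)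

Section all_moments.
Context d (Omega : measurableType d) (R : realType) (P : probability Omega R).

Definition all_moments (I : Type) (h : I -> Omega -> R) : Prop :=
  (forall i w, 0 <= h i w) /\
  forall q : nat, exists C, forall i, ub_mean P (fun w => (h i w ^+ q)%:E) C.

Lemma all_moments_eventually (I : Type) (h : I -> Omega -> R) n :
  (forall i w, 0 <= h i w) ->
  (forall q : nat, (n <= q)%N ->
    exists C, forall i, ub_mean P (fun w => (h i w ^+ q)%:E) C) ->
  all_moments h.
Proof.
move=> h0 hq; split => // q.
have [C CP] := hq _ (leq_addr q n).
exists (1 + C) => i.
apply: ub_mean_le (lexx _) (ub_meanD (ub_mean_cst P ler01) (CP i)) => w.
by rewrite -EFinD lee_fin ler_exprn1D// leq_addl.
Qed.

Lemma all_moments_ae (I : Type) (h g : I -> Omega -> R) :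
  (forall i w, 0 <= h i w) -> (forall i, {ae P, forall w, h i w <= g i w}) ->
  all_moments g -> all_moments h.
Proof.
move=> h0 hg [g0 gq]; split => // q; have [C CP] := gq q; exists C => i.
apply: ub_mean_ae (CP i); apply: filterS (hg i) => w hw.
by rewrite lee_fin lerXn2r// nnegrE.
Qed.

Lemma all_moments_le (I : Type) (h g : I -> Omega -> R) :
  (forall i w, 0 <= h i w) -> (forall i w, h i w <= g i w) ->
  all_moments g -> all_moments h.
Proof. by move=> h0 hg; apply: all_moments_ae => // i; exact: aeW. Qed.

Lemma all_moments_comp (I J : Type) (h : I -> Omega -> R) (u : J -> I) :
  all_moments h -> all_moments (fun j => h (u j)).
Proof. by move=> [h0 hq]; split => // q; have [C CP] := hq q; exists C. Qed.

Lemma all_moments_cst (I : Type) (c : I -> R) (C : R) :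
  (forall i, 0 <= c i <= C) -> all_moments (fun i _ => c i).
Proof.
move=> cC; split => [i w|q]; first by case/andP: (cC i).
exists (C ^+ q) => i; have /andP[ci0 ciC] := cC i.
apply: ub_mean_le (ub_mean_cst P (exprn_ge0 q ci0)) => //.
by rewrite lerXn2r// nnegrE (le_trans ci0).
Qed.

Lemma all_momentsD (I : Type) (h g : I -> Omega -> R) :
  all_moments h -> all_moments g -> all_moments (fun i w => h i w + g i w).
Proof.
move=> [h0 hq] [g0 gq]; split => [i w|q]; first exact: addr_ge0.
have [C CP] := hq q; have [C' CP'] := gq q.
exists (2 ^+ q * (C + C')) => i.
have := ub_meanZ (exprn_ge0 q (ler0n R 2)) (ub_meanD (CP i) (CP' i)).
by apply: ub_mean_le => // w; rewrite -EFinD -EFinM lee_fin ler_exprnD.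
Qed.

Lemma all_momentsM (I : Type) (h g : I -> Omega -> R) :
  all_moments h -> all_moments g -> all_moments (fun i w => h i w * g i w).
Proof.
move=> [h0 hq] [g0 gq]; split => [i w|q]; first exact: mulr_ge0.
have [C CP] := hq (q * 2)%N; have [C' CP'] := gq (q * 2)%N.
exists (C + C') => i; apply: ub_mean_le (ub_meanD (CP i) (CP' i)) => // w.
rewrite -EFinD lee_fin exprMn !exprM.
have := sqr_ge0 (h i w ^+ q - g i w ^+ q); rewrite sqrrB mulr2n.
by have := mulr_ge0 (exprn_ge0 q (h0 i w)) (exprn_ge0 q (g0 i w)); lra.
Qed.

Lemma all_momentsZ (I : Type) (k : R) (h : I -> Omega -> R) : 0 <= k ->
  all_moments h -> all_moments (fun i w => k * h i w).
Proof.
move=> k0; apply: all_momentsM; apply: (@all_moments_cst _ _ k) => i.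
by rewrite k0 lexx.
Qed.

Lemma all_moments_powR (I : Type) (r : R) (h : I -> Omega -> R) : 0 <= r ->
  all_moments h -> all_moments (fun i w => h i w `^ r).
Proof.
move=> r0 [h0 hq]; have [n rn] := exists_nat_ge r.
apply: (@all_moments_le _ _ (fun i w => 1 + h i w ^+ n)) => [i w|i w|].
- exact: powR_ge0.
- exact: powR_le_exprn.
apply: all_momentsD.
  by apply: (@all_moments_cst _ _ 1) => i; rewrite ler01 lexx.
split => [i w|q]; first exact: exprn_ge0.
have [C CP] := hq (n * q)%N; exists C => i.
by apply: ub_mean_le (CP i) => // w; rewrite exprM.
Qed.

(** By Jensen's inequality the bound is independent of the number of summands; this is what permits
    a sum over all levels, whose number grows with L. *)
Lemma all_moments_convex (I K : Type) (s : I -> seq K) (a : I -> K -> R)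
    (h : I * K -> Omega -> R) :
  (forall i k, 0 <= a i k) -> (forall i, \sum_(k <- s i) a i k <= 1) ->
  all_moments h ->
  all_moments (fun i w => \sum_(k <- s i) a i k * h (i, k) w).
Proof.
move=> a0 a1 [h0 hq].
apply: (@all_moments_eventually _ _ 1) => [i w|[//|q] _].
  by apply: sumr_ge0 => k _; exact: mulr_ge0.
have [C CP] := hq q.+1; exists (`|C|) => i.
have hC k : ub_mean P (fun w => (a i k)%:E * (h (i, k) w ^+ q.+1)%:E)%E
    (a i k * `|C|).
  apply: ub_meanZ => //; exact: ub_mean_le (ler_norm C) (CP _).
apply: ub_mean_le (ub_mean_sum (s i) hC) => [w|].
  under [leRHS]eq_bigr do rewrite -EFinM.
  by rewrite sumEFin lee_fin; exact: exprn_jensen.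
by rewrite -big_distrl/= ler_piMl.
Qed.

(** Entry point for the assumptions, which are stated as weighted L^p norms. Orders q+1 suffice by
    [all_moments_eventually]. *)
Lemma all_moments_Lnorm (I : Type) (h : I -> Omega -> R) (c : I -> R) :
  (forall i, measurable_fun setT (h i)) -> (forall i w, 0 <= h i w) ->
  (forall i, 0 <= c i) ->
  (forall q : nat, exists C, forall i,
    ((c i)%:E * Lnorm P q.+1%:R%:E (EFin \o h i) <= C%:E)%E) ->
  all_moments (fun i w => c i * h i w).
Proof.
move=> mh h0 c0 hC; apply: (@all_moments_eventually _ _ 1) => [i w|[//|q] _].
  exact: mulr_ge0.
have [C CP] := hC q; exists (`|C| `^ q.+1%:R) => i.
have [->|ci] := eqVneq (c i) 0.
  apply: ub_mean_le (ub_mean_cst P (lexx 0)) => [w|]; last exact: powR_ge0.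
  by rewrite mul0r expr0n.
have {}ci : 0 < c i by rewrite lt0r ci c0.
apply: ub_mean_integral.
- apply/measurable_EFinP; apply: measurable_funX.
  by apply: measurable_funM => //; exact: measurable_cst.
- by move=> w; rewrite lee_fin exprn_ge0// mulr_ge0.
have q0 : q.+1%:R != 0 :> R by [].
have -> : (\int[P]_w ((c i * h i w) ^+ q.+1)%:E =
    (c i ^+ q.+1)%:E * \int[P]_w (`|(EFin \o h i) w| `^ q.+1%:R))%E.
  have mG : measurable_fun setT (fun w => `|(EFin \o h i) w| `^ q.+1%:R)%E.
    have -> : (fun w => `|(EFin \o h i) w| `^ q.+1%:R)%E =
        (fun w => (h i w ^+ q.+1)%:E).
      by apply/funext => w; rewrite /= ger0_norm// powR_mulrn.
    by apply/measurable_EFinP; exact: measurable_funX.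
  rewrite -ge0_integralZl//; do ?[by move=> w _; exact: poweR_ge0 |
    by rewrite lee_fin exprn_ge0].
  by apply: eq_integral => w _; rewrite /= ger0_norm// powR_mulrn// exprMn.
rewrite -poweR_Lnorm// -powR_mulrn// -!poweR_EFin -poweRM ?Lnorm_ge0//.
have CP' : ((c i)%:E * Lnorm P q.+1%:R%:E (EFin \o h i) <= `|C|%:E)%E.
  by rewrite (le_trans (CP i))// lee_fin ler_norm.
have L0 : (0 <= (c i)%:E * Lnorm P q.+1%:R%:E (EFin \o h i))%E.
  by apply: mule_ge0; [rewrite lee_fin|exact: Lnorm_ge0].
apply: gt0_ler_poweR => //; rewrite in_itv/= leey andbT//.
by rewrite lee_fin.
Qed.

(** The way back to the L^p norms of the conclusion: [F] may be infinite or not measurable, and a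
    real order p is dominated by an integer n, whence the constant 1 + C. *)
Lemma Lnorm_all_moments (I : Type) (h : I -> Omega -> R) (c : I -> R)
    (F : I -> Omega -> \bar R) (p : R) : 0 < p -> (forall i, 0 < c i) ->
  (forall i w, (0 <= F i w)%E) ->
  (forall i, {ae P, forall w, ((c i)%:E * F i w <= (h i w)%:E)%E}) ->
  all_moments h ->
  exists C : R, forall i, ((c i)%:E * Lnorm P p%:E (F i) <= C%:E)%E.
Proof.
move=> p0 c0 F0 Fh [h0 hq]; have [n pn] := exists_nat_ge p.
have [C CP] := hq n; exists ((1 + C) `^ p^-1) => i.
have ci0 : 0 < (c i)^-1 by rewrite invr_gt0.
have C10 : 0 <= 1 + C.
  exact: ub_mean_ge0 (ub_meanD (ub_mean_cst P ler01) (CP i)).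
have FC : ub_mean P (fun w => `|F i w| `^ p)%E ((c i)^-1 `^ p * (1 + C)).
  have := ub_meanZ (powR_ge0 (c i)^-1 p) (ub_meanD (ub_mean_cst P ler01) (CP i)).
  apply: ub_mean_ae; apply: filterS (Fh i) => w Fhw; rewrite gee0_abs//.
  apply: (@le_trans _ _ (((c i)^-1 * h i w)%:E `^ p)%E).
    rewrite gt0_ler_poweR ?(ltW p0)//.
    - by rewrite in_itv/= leey F0.
    - by rewrite in_itv/= leey lee_fin mulr_ge0// ltW.
    - by rewrite EFinM lee_pdivlMl.
  rewrite poweR_EFin powRM ?(ltW ci0)// -EFinD -EFinM lee_fin ler_wpM2l ?powR_ge0//.
  by rewrite powR_le_exprn// ltW.
have le_int := integral_le_ub_mean (fun w => poweR_ge0 _ _) FC.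
rewrite muleC -lee_pdivlMr// muleC -EFinM unlock.
have -> : (c i)^-1 * (1 + C) `^ p^-1 = ((c i)^-1 `^ p * (1 + C)) `^ p^-1.
  by rewrite powRM ?powR_ge0// -powRrM mulfV ?gt_eqF// powRr1// ltW.
rewrite -poweR_EFin gt0_ler_poweR ?invr_ge0 ?(ltW p0)// in_itv/= leey andbT.
- by apply: integral_ge0 => w _; exact: poweR_ge0.
- by rewrite lee_fin (ub_mean_ge0 FC).
Qed.

End all_moments.

(** * Borel and strong measurability *)

Section borel_measurability.
Context {R : realType}.

Lemma continuous_borel_measurable (V W : normedModType R) (f : V -> W) :
  continuous f -> measurable_fun setT (f : borel V -> borel W).
Proof.
move=> /continuousP cf.
apply: (@measurability _ _ _ (borel W) _ _ (@open W)) => // _ [B oB <-].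
by rewrite setTI; apply: sub_sigma_algebra; exact: cf.
Qed.

Lemma continuous_borel_measurable_real (V : normedModType R) (f : V -> R) :
  continuous f -> measurable_fun setT (f : borel V -> R).
Proof.
move=> /continuousP cf.
apply: (measurability _ (RGenOpens.measurableE R)) => _ [_ [a [b ->]] <-].
by rewrite setTI; apply: sub_sigma_algebra; exact: cf (interval_open _ _).
Qed.

Context d (Omega : measurableType d) (V : normedModType R).
Implicit Types g h : Omega -> V.

Lemma borel_measurable_norm g :
  measurable_fun setT (g : Omega -> borel V) ->
  measurable_fun setT (fun w => `|g w|).
Proof.
move=> mg; apply: (measurableT_comp _ mg).
by apply: continuous_borel_measurable_real; exact: norm_continuous.
Qed.

(** A limit lies in an open set U exactly when, for some m, the sequence eventually stays in [U_ m],
    the points with a ball of radius above 1/(m+1) inside U. The margin keeps the limit from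
    reaching the boundary. *)
Lemma borel_measurable_cvg (g_ : nat -> Omega -> V) g :
  (forall n, measurable_fun setT (g_ n : Omega -> borel V)) ->
  (forall w, g_ n w @[n --> \oo] --> g w) ->
  measurable_fun setT (g : Omega -> borel V).
Proof.
move=> mg gg; apply: (@measurability _ _ _ (borel V) _ _ (@open V)) => // _ [U oU <-].
pose U_ (m : nat) := [set x : V | exists2 e : R, m.+1%:R^-1 < e & ball x e `<=` U].
have oU_ m : open (U_ m).
  rewrite openE => x [e me eU]; apply/nbhs_ballP.
  exists ((e - m.+1%:R^-1) / 2) => /= [|y xy]; first by rewrite divr_gt0// subr_gt0.
  exists (e - (e - m.+1%:R^-1) / 2); first by move: me; set a := m.+1%:R^-1; lra.
  move=> z yz; apply: eU; rewrite -ball_normE /=.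
  have -> : x - z = (x - y) + (y - z) by rewrite addrA subrK.
  move: xy yz; rewrite -!ball_normE/= => xy yz.
  apply: le_lt_trans (ler_normD _ _) _.
  by rewrite -[ltRHS](subrKC ((e - m.+1%:R^-1) / 2)) ltrD.
rewrite setTI.
have -> : g @^-1` U = \bigcup_m \bigcup_N \bigcap_(n in [set n | (N <= n)%N])
    (g_ n @^-1` U_ m).
  apply/seteqP; split => [w /= Ugw|w [m _ [N _ gU]] /=].
    have /nbhs_ballP[e e0 eU] : nbhs (g w) U by exact: open_nbhs_nbhs.
    have [m] := exists_nat_ge (2 / e)^-1^-1; rewrite invrK => me.
    have me' : m.+1%:R^-1 < e / 2.
      rewrite -ltf_pV2 ?posrE ?divr_gt0// ?invr_gt0// invrK invfM invrK mulrC.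
      by rewrite (le_lt_trans me)// ltr_nat.
    have /cvgrPdist_lt/(_ _ (divr_gt0 e0 (ltr0n R 2)))[N _ gN] := gg w.
    exists m => //; exists N => // n /= /gN gn; exists (e / 2) => // y.
    rewrite -ball_normE/= => ny; apply: eU; rewrite -ball_normE/=.
    have -> : g w - y = (g w - g_ n w) + (g_ n w - y) by rewrite addrA subrK.
    by rewrite (le_lt_trans (ler_normD _ _))// [ltRHS]splitr ltrD.
  have m0 : 0 < m.+1%:R^-1 :> R by rewrite invr_gt0.
  have /cvgrPdist_lt/(_ _ m0)[N' _ gN] := gg w.
  have [e me eU] := gU _ (leq_maxl N N').
  apply: eU; rewrite -ball_normE/= distrC (lt_trans _ me)//.
  exact: (gN _ (leq_maxr N N')).
apply: bigcup_measurable => m _; apply: bigcup_measurable => N _.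
apply: bigcap_measurable => [|n _]; first by exists N => /=.
rewrite -[X in measurable X]setTI; apply: mg => //.
exact: sub_sigma_algebra.
Qed.

Lemma simple_map_preimage (S : choiceType) (s : Omega -> S) (B : set S) :
  finite_set (range s) -> (forall v, measurable (s @^-1` [set v])) ->
  measurable (s @^-1` B).
Proof.
move=> fs ms.
have -> : s @^-1` B = \bigcup_(v in range s `&` B) (s @^-1` [set v]).
  apply/seteqP; split => [w Bw|w [v [_ Bv]] /= ->//].
  by exists (s w) => //; split => //; exists w.
apply: fin_bigcup_measurable => //; exact: finite_setIl.
Qed.

Lemma simple_map_measurable (s : Omega -> V) : simple_map s ->
  measurable_fun setT (s : Omega -> borel V).
Proof. by move=> [fs ms] _ B _; rewrite setTI; exact: simple_map_preimage. Qed.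

Lemma strongly_measurable_borel g : strongly_measurable g ->
  measurable_fun setT (g : Omega -> borel V).
Proof.
move=> [s_ s_P sg]; apply: borel_measurable_cvg sg => n.
exact: simple_map_measurable.
Qed.

(** Two simple maps become functions of one simple map, which provides the common partition for sums
    and differences. *)
Lemma simple_map_pair (S S' : choiceType) (s : Omega -> S) (s' : Omega -> S') :
  finite_set (range s) -> (forall v, measurable (s @^-1` [set v])) ->
  finite_set (range s') -> (forall v, measurable (s' @^-1` [set v])) ->
  finite_set (range (fun w => (s w, s' w))) /\
  (forall v, measurable ((fun w => (s w, s' w)) @^-1` [set v])).
Proof.
move=> fs ms fs' ms'; split.
  apply: (sub_finite_set _ (finite_setX fs fs')) => _ [w _ <-].
  by split; exists w.
move=> [v v']; have -> : (fun w => (s w, s' w)) @^-1` [set (v, v')] =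
    s @^-1` [set v] `&` s' @^-1` [set v'].
  by apply/seteqP; split => w /= [-> ->].
exact: measurableI.
Qed.

Lemma simple_map_comp (S : choiceType) (W : normedModType R) (s : Omega -> S)
    (f : S -> W) :
  finite_set (range s) -> (forall v, measurable (s @^-1` [set v])) ->
  simple_map (f \o s).
Proof.
move=> fs ms; split; last by move=> v; exact: (@simple_map_preimage _ s (f @^-1` [set v])).
by rewrite -(image_comp s f); exact: finite_image.
Qed.

Lemma simple_mapD (s s' : Omega -> V) : simple_map s -> simple_map s' ->
  simple_map (fun w => s w + s' w).
Proof.
move=> [fs ms] [fs' ms']; have [f m] := simple_map_pair fs ms fs' ms'.
exact: (@simple_map_comp _ _ _ (fun x => x.1 + x.2) f m).
Qed.

Lemma simple_mapN (s : Omega -> V) : simple_map s ->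
  simple_map (fun w => - s w).
Proof. by move=> [fs ms]; exact: (@simple_map_comp _ _ _ (fun x => - x) fs ms). Qed.

Lemma strongly_measurableD g h : strongly_measurable g ->
  strongly_measurable h -> strongly_measurable (fun w => g w + h w).
Proof.
move=> [s sP sg] [s' s'P sh]; exists (fun n w => s n w + s' n w) => [n|w].
  exact: simple_mapD.
exact: cvgD.
Qed.

End borel_measurability.

(** * Simple approximation in separable spaces *)

Section separable_target.
Context {R : realType} (V : normedModType R).

Lemma separable_dense_seq : separable V -> exists e : nat -> V,
  e 0%N = 0 /\ forall v (eps : R), 0 < eps -> exists n, `|v - e n| < eps.
Proof.
move=> [A /countable_injP[f finj] dA].
(* Index 0 is reserved for the vector 0; an index m+1 whose m codes no point of the dense set also
   gives 0. *)
pose e (n : nat) := if n is m.+1 then xget 0 [set a | A a /\ f a = m] else 0.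
exists e; split=> // v eps eps0.
have [||a [va Aa]] := dA (ball v eps); first by exists v; exact: ballxx.
  exact: ball_open.
exists (f a).+1; rewrite /e; case: xgetP => [y _ [Ay fy]|/(_ a)]; last by case.
have -> : y = a by apply: finj; rewrite ?inE.
by move: va; rewrite -ball_normE.
Qed.

Context d (Omega : measurableType d).
Implicit Types g h : Omega -> V.

(** The approximants select the nearest among finitely many points of a dense
    sequence starting at 0, whence the bound by [`|g w|]. *)
Lemma borel_simple_approx g : separable V ->
  measurable_fun setT (g : Omega -> borel V) ->
  exists s_ : nat -> Omega -> V, [/\ forall n, simple_map (s_ n),
    forall w, s_ n w @[n --> \oo] --> g w &
    forall n w, `|g w - s_ n w| <= `|g w|].
Proof.
move=> /separable_dense_seq[e [e0 eP]] mg.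
pose fix s_ (n : nat) (w : Omega) {struct n} : V := if n is m.+1 then
  (if `|g w - e m.+1| < `|g w - s_ m w| then e m.+1 else s_ m w) else 0.
have mdist v : measurable_fun setT (fun w => `|g w - v|).
  have md : measurable_fun setT ((fun x => `|x - v|) : borel V -> R).
    apply: continuous_borel_measurable_real => x.
    by apply: cvg_norm; apply: cvgB => //; exact: cvg_cst.
  exact: (measurableT_comp md mg).
have ms n : measurable_fun setT (fun w => `|g w - s_ n w|) /\ simple_map (s_ n).
  elim: n => [|n [IH [fs ms]]].
    split; first exact: mdist.
    apply: (@simple_map_comp _ _ _ _ _ (fun=> tt) (fun=> 0)) => // [|v].
    - exact: finite_finset.
    - have -> : (fun=> tt) @^-1` [set v] = [set: Omega].
        by apply/seteqP; split => w //=; case: v.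
      exact: measurableT.
  have mlt : measurable_fun setT
      (fun w => `|g w - e n.+1| < `|g w - s_ n w|) by exact: measurable_fun_ltr.
  split.
    have -> : (fun w => `|g w - s_ n.+1 w|) =
        (fun w => Num.min `|g w - e n.+1| `|g w - s_ n w|).
      by apply/funext => w /=; rewrite minEle; case: ltgtP => // ->; rewrite ?lexx.
    exact: measurable_minr.
  have [f m] := @simple_map_pair _ Omega _ _
    (fun w => `|g w - e n.+1| < `|g w - s_ n w|) (s_ n)
    finite_finset (fun b => let: H := mlt measurableT [set b] I in
       eq_ind _ _ H _ (setTI _)) fs ms.
  exact: (@simple_map_comp _ _ _ _ _ _ (fun x => if x.1 then e n.+1 else x.2) f m).
(* The nth approximant is at least as close to [g w] as any of the first n+1 points of the sequence;
   k = 0 gives the bound by the norm of [g w]. *)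
have sle n w k : (k <= n)%N -> `|g w - s_ n w| <= `|g w - e k|.
  elim: n => [|n IH]; first by rewrite leqn0 => /eqP -> /=; rewrite e0.
  rewrite leq_eqVlt => /predU1P[->|/IH kn] /=; case: ltP => // /ltW lt.
  exact: le_trans lt kn.
exists s_; split => [n|w|n w]; first by case: (ms n).
  apply/cvgrPdist_lt => eps eps0; have [n vn] := eP (g w) eps eps0.
  by exists n => // m /= /(sle _ w) /le_lt_trans; apply.
by rewrite (le_trans (sle n w _ (leq0n n)))// e0 subr0.
Qed.

Hypothesis sepV : separable V.

Lemma borel_strongly_measurable g :
  measurable_fun setT (g : Omega -> borel V) -> strongly_measurable g.
Proof. by case/(borel_simple_approx sepV) => s_ [sP sg _]; exists s_. Qed.

(** Addition is continuous on the product, but the Borel sets of a product may exceed the product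
    sigma-algebra. Simple approximants, which can be added, bypass the product. *)
Lemma borel_measurableD g h : measurable_fun setT (g : Omega -> borel V) ->
  measurable_fun setT (h : Omega -> borel V) ->
  measurable_fun setT ((fun w => g w + h w) : Omega -> borel V).
Proof.
move=> /borel_strongly_measurable mg /borel_strongly_measurable mh.
by apply: strongly_measurable_borel; exact: strongly_measurableD.
Qed.

Lemma borel_measurableZ g (a : R) : measurable_fun setT (g : Omega -> borel V) ->
  measurable_fun setT ((fun w => a *: g w) : Omega -> borel V).
Proof.
move=> mg; have ms : measurable_fun setT (( *:%R a) : borel V -> borel V).
  by apply: continuous_borel_measurable; exact: scaler_continuous.
exact: (measurableT_comp ms mg).
Qed.

Lemma borel_measurableB g h : measurable_fun setT (g : Omega -> borel V) ->
  measurable_fun setT (h : Omega -> borel V) ->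
  measurable_fun setT ((fun w => g w - h w) : Omega -> borel V).
Proof.
move=> mg /(@borel_measurableZ _ (-1)) mh; have := borel_measurableD mg mh.
by under [X in measurable_fun _ X -> _]eq_fun do rewrite scaleN1r.
Qed.

Lemma borel_measurable_cst (v : V) :
  measurable_fun setT ((fun=> v) : Omega -> borel V).
Proof. exact: measurable_cst. Qed.

Lemma borel_measurable_sum (I : Type) (s : seq I) (g : I -> Omega -> V) :
  (forall i, measurable_fun setT (g i : Omega -> borel V)) ->
  measurable_fun setT ((fun w => \sum_(i <- s) g i w) : Omega -> borel V).
Proof.
move=> mg; elim: s => [|i s IH].
  by under eq_fun do rewrite big_nil; exact: borel_measurable_cst.
by under eq_fun do rewrite big_cons; exact: borel_measurableD.
Qed.

End separable_target.

(** * Continuous paths and piecewise linear interpolation *)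

Section time_topology.
Context {R : realType} {T : R}.

Lemma time_val_continuous : continuous (@time_val R T).
Proof. exact: initial_continuous. Qed.

Lemma timeI_nbhs (x : timeI T) (U : set (timeI T)) : nbhs x U ->
  exists2 e : R, 0 < e & forall y : timeI T, `|time_val x - time_val y| < e -> U y.
Proof.
rewrite nbhsE => -[_ [[W oW <-] Wx] WU].
have /nbhs_ballP[e /= e0 eW] := open_nbhs_nbhs (conj oW Wx).
by exists e => // y xy; apply: WU; apply: eW; rewrite -ball_normE.
Qed.

Lemma nbhs_timeI (x : timeI T) (e : R) : 0 < e ->
  \forall y \near x, `|time_val x - time_val y| < e.
Proof. by move=> e0; have /cvgrPdist_lt := @time_val_continuous x; exact. Qed.

Context (E : normedModType R).

(** Heine-Cantor theorem, with compactness used as a near-covering property: the filter of small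
    positive [dl] is shared by all points, and half the local radius leaves room for a second
    time. *)
Lemma contfun_uniform_continuous (v : contfun (timeI T) E) (e : R) : 0 < e ->
  exists2 dl : R, 0 < dl &
    forall s t : timeI T, `|time_val s - time_val t| < dl -> `|v s - v t| < e.
Proof.
move=> e0; have e2 : 0 < e / 2 by rewrite divr_gt0.
pose Q (dl : R) (t : timeI T) := forall s : timeI T, `|time_val s - time_val t| < dl ->
  `|v s - v t| < e.
have : \forall dl \near (0 : R)^'+, [set: timeI T] `<=` Q dl.
  apply: (compact_near_coveringP _).1; first exact: compact_setT.
  move=> x _; have /cvgrPdist_lt/(_ _ e2) := @contfun_continuous _ _ _ v x.
  move=> /timeI_nbhs[a a0 xa]; have a2 : 0 < a / 2 by rewrite divr_gt0.
  exists ([set y : timeI T | `|time_val x - time_val y| < a / 2], [set dl | dl < a / 2]).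
    by split => /=; [exact: nbhs_timeI|exact: nbhs_right_lt].
  move=> [t dl] /= [xt dla] s st.
  have -> : v s - v t = (v x - v t) - (v x - v s).
    by rewrite opprB [RHS]addrC addrA subrK.
  rewrite (le_lt_trans (ler_normB _ _))// [ltRHS]splitr ltrD//; apply: xa.
    by rewrite (lt_trans xt)// ltr_pdivrMr// mulr_natr mulr2n ltrDl.
  have -> : time_val x - time_val s =
      (time_val x - time_val t) - (time_val s - time_val t) by ring.
  by rewrite (le_lt_trans (ler_normB _ _))// [ltRHS]splitr ltrD// (lt_trans st).
move=> H; have [dl /= [dl0 Qdl]] := filter_ex (filterI (nbhs_right_gt 0) H).
by exists dl => // s t; exact: (Qdl t I s).
Unshelve. all: by end_near. Qed.

Lemma cpathE (g : timeI T -> E) : continuous g -> cpath g = g :> (_ -> _).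
Proof.
move=> cg; have gP : g \in @contfun_pred R (timeI T) E by exact/asboolP.
by rewrite /cpath; apply: (@insubdK _ _ (contfun (timeI T) E)).
Qed.

End time_topology.

Section interpolation.
Context {R : realType} {T : R} (T0 : 0 < T).

(** The tent function at nT/N, zero outside the adjacent cells. These tents make the interpolant
    continuous by construction and linear in its nodal values. *)
Definition hat (N n : nat) (t : timeI T) : R :=
  Num.max 0 (1 - `|time_val t * N%:R / T - n%:R|).

Lemma hat_continuous N n : continuous (hat N n).
Proof.
move=> t; have ct : time_val s @[s --> t] --> time_val t.
  exact: time_val_continuous.
apply: (@continuous_max R (timeI T) (cst 0)
  (fun s => 1 - `|time_val s * N%:R / T - n%:R|) t).
  exact: cst_continuous.
have cx : time_val s * N%:R / T @[s --> t] --> time_val t * N%:R / T.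
  exact: (cvgM (cvgM ct (cvg_cst _)) (cvg_cst _)).
suff : 1 - `|time_val s * N%:R / T - n%:R| @[s --> t] -->
       (1 - `|time_val t * N%:R / T - n%:R|) by [].
have cn : `|time_val s * N%:R / T - n%:R| @[s --> t] -->
    `|time_val t * N%:R / T - n%:R|.
  exact: cvg_norm (cvgB cx (cvg_cst (n%:R : R))).
exact: (cvgB (@cvg_cst _ (1 : R) (timeI T) (nbhs t) _) cn).
Qed.

Lemma grid_cell N (t : timeI T) : (0 < N)%N ->
  exists n : 'I_N, n%:R * T / N%:R <= time_val t <= n.+1%:R * T / N%:R.
Proof.
move=> N0; have N0' : 0 < N%:R :> R by rewrite ltr0n.
have /andP[t0 tT] := time_valP t.
pose x := time_val t * N%:R / T.
have x0 : 0 <= x by apply: divr_ge0 (ltW T0); exact: mulr_ge0.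
have tE : time_val t = x * T / N%:R by rewrite /x; field; rewrite !gt_eqF.
have main (n : nat) : n%:R <= x <= n.+1%:R ->
    n%:R * T / N%:R <= time_val t <= n.+1%:R * T / N%:R.
  by rewrite tE !ler_pM2r ?invr_gt0.
have [xN|Nx] := ltP x N%:R.
  have nN : (Num.truncn x < N)%N.
    by rewrite -(ltr_nat R) (le_lt_trans _ xN)// truncn_le.
  exists (Ordinal nN); apply: main => /=; rewrite truncn_le x0 /=.
  by apply: ltW; exact: truncnS_gt.
(* Only t = T remains; it belongs to the last cell. *)
have pN : (N.-1 < N)%N by rewrite prednK.
exists (Ordinal pN); apply: main => /=; rewrite prednK//; apply/andP; split.
  by rewrite (le_trans _ Nx)// ler_nat leq_pred.
by rewrite /x ler_pdivrMr// mulrC ler_wpM2l// ltW.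
Qed.

Context (E : normedModType R).

Definition interp N (y : 'I_N.+1 -> E) (t : timeI T) : E :=
  \sum_(i < N.+1) hat N i t *: y i.

(** At most two tents are nonzero on a cell. This identifies the tent expansion with the cellwise
    formula assumed for Y. *)
Lemma interp_cell N (y : 'I_N.+1 -> E) (n : 'I_N) (t : timeI T) :
  n%:R * T / N%:R <= time_val t <= n.+1%:R * T / N%:R ->
  interp y t = (n%:R + 1 - time_val t * N%:R / T) *: y (widen_ord (leqnSn N) n) +
               (time_val t * N%:R / T - n%:R) *: y (lift ord0 n).
Proof.
have N0 : (0 < N)%N by case: N n {y} => // -[].
have N0' : 0 < N%:R :> R by rewrite ltr0n.
set x := time_val t * N%:R / T => nt.
have /andP[nx xn] : n%:R <= x <= n%:R + 1.
  case/andP: nt; rewrite ler_pdivrMr// ler_pdivlMr// natr1 => a b.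
  by rewrite /x ler_pdivlMr// a ler_pdivrMr.
have near (i : 'I_N.+1) : hat N i t *: y i =
    (if i == widen_ord (leqnSn N) n then (n%:R + 1 - x) *: y i else
     if i == lift ord0 n then (x - n%:R) *: y i else 0).
  rewrite /hat -/x; case: eqP => [->/=|in1].
    by rewrite ger0_norm ?subr_ge0// max_r; [congr (_ *: _); ring|lra].
  case: eqP => [->/=|in2].
    rewrite /bump leq0n add1n -natr1 ler0_norm; last by lra.
    by rewrite max_r; [congr (_ *: _); ring|lra].
  rewrite max_l ?scale0r// subr_le0.
  have [ltin|] := ltnP i n.
    have : (i%:R + 1 <= n%:R :> R) by rewrite natr1 ler_nat.
    by move=> ?; rewrite ger0_norm; lra.
  rewrite leq_eqVlt => /predU1P[ni|]; first by case: in1; apply: val_inj.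
  rewrite leq_eqVlt => /predU1P[ni|ni].
    by case: in2; apply: val_inj; rewrite /= /bump leq0n add1n.
  have : (n%:R + 1 + 1 <= i%:R :> R) by rewrite !natr1 ler_nat.
  by move=> ?; rewrite ler0_norm; lra.
have neq : lift ord0 n != widen_ord (leqnSn N) n.
  by apply/eqP => /(congr1 val)/eqP /=; rewrite /bump leq0n add1n gtn_eqF.
rewrite /interp (eq_bigr _ (fun i _ => near i)).
rewrite (bigD1 (widen_ord (leqnSn N) n))//= eqxx; congr (_ + _).
rewrite (bigD1 (lift ord0 n))//= (negbTE neq) eqxx big1 ?addr0// => i.
by move=> /andP[/negbTE -> /negbTE ->].
Qed.

Lemma hat_scale_subproof N n (x : E) :
  (fun t => hat N n t *: x) \in @contfun_pred R (timeI T) E.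
Proof.
apply/asboolP => t; have ht := @hat_continuous N n t.
exact: (cvgZ ht (@cvg_cst _ x (timeI T) (nbhs t) _)).
Qed.

Definition hat_scale N n (x : E) : contfun (timeI T) E :=
  ContFun (hat_scale_subproof N n x).

(** Formed inside the path space as a finite sum, so that its measurability follows from the
    continuity of each nodal term. *)
Definition interp_path N (y : 'I_N.+1 -> E) : contfun (timeI T) E :=
  \sum_(i < N.+1) hat_scale N i (y i).

Lemma contfun_sumE (I : Type) (s : seq I) (g : I -> contfun (timeI T) E) t :
  (\sum_(i <- s) g i) t = \sum_(i <- s) g i t.
Proof. by elim: s => [|i s IH]; rewrite ?big_nil// !big_cons -IH. Qed.

Lemma interp_pathE N (y : 'I_N.+1 -> E) : interp_path y = interp y :> (_ -> _).
Proof. by apply/funext => t; rewrite contfun_sumE. Qed.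

Lemma interp_path_dist N (y : 'I_N.+1 -> E) (v : contfun (timeI T) E) (e : R) :
  (0 < N)%N ->
  (forall (i : 'I_N.+1) (t : timeI T), `|time_val t - time_val (grid T0 i)| <= T / N%:R ->
    `|v t - y i| <= e) ->
  `|v - interp_path y| <= e.
Proof.
move=> N0 ve.
have N0' : 0 < N%:R :> R by rewrite ltr0n.
have pt (t : timeI T) : `|v t - interp_path y t| <= e.
  have [n nt] := grid_cell t N0; rewrite interp_pathE (interp_cell _ nt).
  set a := n%:R + 1 - _; set b := _ - n%:R; set i := widen_ord _ _; set j := lift _ _.
  have ab : a + b = 1 by rewrite /a /b; ring.
  have nx : a = (n.+1%:R * T / N%:R - time_val t) * (N%:R / T).
    by rewrite /a -natr1; field; rewrite !gt_eqF.
  have xn : b = (time_val t - n%:R * T / N%:R) * (N%:R / T).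
    by rewrite /b; field; rewrite !gt_eqF.
  have a0 : 0 <= a.
    by rewrite nx mulr_ge0 ?divr_ge0 ?(ltW T0)// subr_ge0; case/andP: nt.
  have b0 : 0 <= b.
    by rewrite xn mulr_ge0 ?divr_ge0 ?(ltW T0)// subr_ge0; case/andP: nt.
  have gap : n.+1%:R * T / N%:R = n%:R * T / N%:R + T / N%:R.
    by rewrite -natr1; field; rewrite gt_eqF.
  have -> : v t - (a *: y i + b *: y j) = a *: (v t - y i) + b *: (v t - y j).
    by rewrite -{1}(scale1r (v t)) -ab scalerDl !scalerBr opprD addrACA.
  have -> : e = a * e + b * e by rewrite -mulrDl ab mul1r.
  apply: le_trans (ler_normD _ _) _; rewrite !normrZ !ger0_norm//.
  rewrite lerD// ler_wpM2l//; apply: ve.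
    have -> : time_val (grid T0 i) = n%:R * T / N%:R by [].
    rewrite ger0_norm; last by rewrite subr_ge0; case/andP: nt.
    by rewrite lerBlDl -gap; case/andP: nt.
  have -> : time_val (grid T0 j) = n.+1%:R * T / N%:R by [].
  rewrite ler0_norm; last first.
    by rewrite subr_le0; case/andP: nt.
  by rewrite opprB gap lerBlDr addrC lerD2l; case/andP: nt.
rewrite contfun_normE; apply: contfun_norm_le => //.
(* The bound on the supremum norm requires 0 <= e, which the pointwise estimate at time 0 yields. *)
have O0 : (0:R) \in `[0, T]%classic by rewrite inE/= in_itv/= lexx ltW.
by apply: le_trans (pt (exist _ 0 O0)).
Qed.

Lemma interp_path_cvg (v : contfun (timeI T) E) :
  interp_path (fun i : 'I_n.+2 => v (grid T0 i)) @[n --> \oo] --> v.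
Proof.
apply/cvgrPdist_le => e e0.
have [dl dl0 vdl] := contfun_uniform_continuous v e0.
have [m Tm] := exists_nat_ge (T / dl).
exists m => // n /= mn; apply: interp_path_dist => // i t ti.
apply/ltW/vdl; rewrite (le_lt_trans ti)// ltr_pdivrMr//.
move: Tm; rewrite ler_pdivrMr// mulrC => /le_lt_trans; apply.
by rewrite ltr_pM2l// ltr_nat.
Qed.

(** Interpolants with nodal values in a dense sequence of E form a countable dense set, coded by
    finite sequences of indices. *)
Lemma contfun_separable : separable E -> separable (contfun (timeI T) E).
Proof.
move=> /separable_dense_seq[x [_ xP]].
pose F (s : seq nat) := interp_path
  (fun i : 'I_(size s).-1.+1 => x (nth 0%N s i)).
exists (range F).
  apply: sub_countable (countableP [set: seq nat]); exact: card_image_le.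
move=> O [v Ov] oO; have /nbhs_ballP[e /= e0 eO] := open_nbhs_nbhs (conj oO Ov).
have e4 : 0 < e / 4 by rewrite divr_gt0.
have [dl dl0 vdl] := contfun_uniform_continuous v e4.
have [m Tm] := exists_nat_ge (T / dl).
have Tm' : T / m.+1%:R < dl.
  rewrite ltr_pdivrMr//; move: Tm; rewrite ler_pdivrMr// mulrC => /le_lt_trans.
  by apply; rewrite ltr_pM2l// ltr_nat.
have /choice[k kP] : forall i : 'I_m.+2, exists n, `|v (grid T0 i) - x n| < e / 4.
  by move=> i; exact: xP.
pose s := [seq k (inord i) | i <- iota 0 m.+2].
have ss : (size s).-1 = m.+1 by rewrite size_map size_iota.
exists (F s); split; last by exists s.
apply: eO; rewrite -ball_normE /= /F.
(* The number of nodes is generalized because it occurs in an ordinal type. One quarter of e pays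
   for the oscillation of v on a cell, another for the nodal values. *)
have : forall M (eM : M = m.+1), `|v - interp_path (fun i : 'I_M.+1 => x (nth 0%N s i))| < e.
  move=> _ ->; apply: (@le_lt_trans _ _ (e / 4 + e / 4)); last by lra.
  apply: interp_path_dist => // i t ti.
  have -> : nth 0%N s i = k i.
    by rewrite (nth_map 0%N) ?size_iota// nth_iota// add0n inord_val.
  have -> : v t - x (k i) = (v t - v (grid T0 i)) + (v (grid T0 i) - x (k i)).
    by rewrite addrA subrK.
  rewrite (le_trans (ler_normD _ _))// lerD// ltW//.
  by apply: vdl; exact: le_lt_trans ti Tm'.
exact.
Qed.

Hypothesis sepE : separable E.
Context d (Omega : measurableType d).

Lemma hat_scale_measurable N n (y : Omega -> E) :
  measurable_fun setT (y : Omega -> borel E) ->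
  measurable_fun setT
    ((fun w => hat_scale N n (y w)) : Omega -> borel (contfun (timeI T) E)).
Proof.
move=> my; have c : continuous (hat_scale N n).
  move=> x; apply/cvgrPdist_le => e e0.
  have /cvgrPdist_le/(_ _ e0) : id z @[z --> x] --> x by exact: cvg_id.
  apply: filterS => z xz; rewrite contfun_normE.
  apply: contfun_norm_le => [|t]; first exact: ltW.
  rewrite [X in `|X|](_ : _ = hat N n t *: (x - z)); last by rewrite scalerBr.
  rewrite normrZ (le_trans _ xz)// ler_piMl// ger0_norm; last first.
    by rewrite le_max lexx.
  by rewrite /hat ge_max ler01 gerBl normr_ge0.
exact: (measurableT_comp (continuous_borel_measurable c) my).
Qed.

Lemma interp_path_measurable N (y : Omega -> 'I_N.+1 -> E) :
  (forall i, measurable_fun setT ((fun w => y w i) : Omega -> borel E)) ->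
  measurable_fun setT
    ((fun w => interp_path (y w)) : Omega -> borel (contfun (timeI T) E)).
Proof.
move=> my; apply: borel_measurable_sum => [|i]; first exact: contfun_separable.
exact: hat_scale_measurable.
Qed.

(** The path is the uniform limit of its interpolants, and each of these depends measurably on
    finitely many values of the process. *)
Lemma process_path_measurable (X : timeI T -> Omega -> E) :
  stochastic_process X -> (forall w, continuous (fun t => X t w)) ->
  measurable_fun setT ((fun w => cpath (fun t => X t w)) :
    Omega -> borel (contfun (timeI T) E)).
Proof.
move=> mX cX; apply: (@borel_measurable_cvg _ _ _ _ (fun n w =>
  interp_path (fun i : 'I_n.+2 => X (grid T0 i) w))) => [n|w].
  by apply: interp_path_measurable => i; exact: mX.
have := @interp_path_cvg (cpath (fun t => X t w)).
by rewrite cpathE.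
Qed.

End interpolation.

(** * Dyadic chaining *)

Section holder_chaining.
Context {R : realType} {T : R} (T0 : 0 < T) (E : normedModType R).

(** Natural indices spare casts between levels. [inord] sends k > 2^n to index 0, so the formulas
    below assume k <= 2^n. *)
Definition dyadic (n k : nat) : timeI T := grid T0 (inord k : 'I_(2 ^ n).+1).

Lemma dyadicE n k : (k <= 2 ^ n)%N ->
  time_val (dyadic n k) = k%:R * T / 2 ^+ n.
Proof.
move=> kn; rewrite -natrX.
have -> : time_val (dyadic n k) =
    (inord k : 'I_(2 ^ n).+1)%:R * T / (2 ^ n)%N%:R by [].
by rewrite inordK.
Qed.

Lemma timeI_eq (s t : timeI T) : time_val s = time_val t -> s = t.
Proof. exact: val_inj. Qed.

Definition dfloor (n : nat) (t : timeI T) : nat :=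
  Num.truncn (time_val t * 2 ^+ n / T).

Lemma dfloorP n (t : timeI T) :
  (dfloor n t)%:R <= time_val t * 2 ^+ n / T < (dfloor n t).+1%:R.
Proof.
have /andP[t0 _] := time_valP t.
rewrite truncn_le truncnS_gt andbT.
by apply: divr_ge0 (ltW T0); rewrite mulr_ge0// exprn_ge0.
Qed.

Lemma dfloor_le n (t : timeI T) : (dfloor n t <= 2 ^ n)%N.
Proof.
have /andP[H _] := dfloorP n t; have /andP[_ tT] := time_valP t.
rewrite -(ler_nat R) (le_trans H)// natrX ler_pdivrMr// mulrC.
by rewrite ler_wpM2l// exprn_ge0.
Qed.

Lemma dfloorS n (t : timeI T) :
  dfloor n.+1 t = (dfloor n t * 2)%N \/ dfloor n.+1 t = (dfloor n t * 2).+1.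
Proof.
have /andP[a b] := dfloorP n t; have /andP[a' b'] := dfloorP n.+1 t.
have e : time_val t * 2 ^+ n.+1 / T = 2 * (time_val t * 2 ^+ n / T).
  by rewrite exprS; field; rewrite gt_eqF.
rewrite e in a' b'.
have : (dfloor n.+1 t < (dfloor n t).+1 * 2)%N.
  by rewrite -(ltr_nat R) natrM; lra.
have : (dfloor n t * 2 < (dfloor n.+1 t).+1)%N.
  by rewrite -(ltr_nat R) natrM; lra.
rewrite ltnS mulSn add2n !ltnS leq_eqVlt => /predU1P[-> _|H]; first by left.
by rewrite leq_eqVlt => /predU1P[->|]; [right|rewrite ltnS leqNgt H].
Qed.

Lemma dyadic_double n k : (k <= 2 ^ n)%N -> dyadic n.+1 (k * 2) = dyadic n k.
Proof.
move=> kn; apply: timeI_eq; rewrite !dyadicE//; last first.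
  by rewrite expnSr leq_mul2r kn orbT.
by rewrite natrM exprS; field; rewrite expf_neq0.
Qed.

Lemma dyadic_floor_dist n (t : timeI T) :
  `|time_val t - time_val (dyadic n (dfloor n t))| <= T / 2 ^+ n.
Proof.
have n0 : 0 < 2 ^+ n :> R by rewrite exprn_gt0.
rewrite dyadicE; last exact: dfloor_le.
have /andP[a b] := dfloorP n t.
have -> : time_val t - (dfloor n t)%:R * T / 2 ^+ n =
   (time_val t * 2 ^+ n / T - (dfloor n t)%:R) * (T / 2 ^+ n).
  by field; rewrite !gt_eqF.
rewrite normrM [X in _ * X]ger0_norm ?divr_ge0 ?(ltW n0) ?(ltW T0)//.
rewrite ler_piMl ?divr_ge0 ?(ltW n0) ?(ltW T0)// ger0_norm ?subr_ge0//.
by move: b; rewrite -natr1; lra.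
Qed.

Section chaining.
Variables (v : contfun (timeI T) E) (M theta : R).
Hypotheses (M0 : 0 <= M) (theta0 : 0 < theta) (theta1 : theta < 1).
Hypothesis vM : forall n k, (k < 2 ^ n)%N ->
  `|v (dyadic n k.+1) - v (dyadic n k)| <= M * theta ^+ n.

(** Passing from level m to m+1 moves the dyadic floor by at most one interval of length T/2^(m+1).
    Each such step is charged M theta^m, and these charges telescope to the closed form. *)
Lemma chain_dyadic n j (t : timeI T) :
  `|v (dyadic (n + j) (dfloor (n + j) t)) - v (dyadic n (dfloor n t))| <=
  M * (theta ^+ n - theta ^+ (n + j)) / (1 - theta).
Proof.
have th : 0 < 1 - theta by rewrite subr_gt0.
elim: j => [|j IH]; first by rewrite addn0 !subrr normr0 mulr0 mul0r.
rewrite addnS; set m := (n + j)%N in IH *; set y := v (dyadic n _) in IH *.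
have step : `|v (dyadic m.+1 (dfloor m.+1 t)) - v (dyadic m (dfloor m t))| <=
    M * theta ^+ m.
  have := dfloor_le m.+1 t; have := dfloor_le m t => mt.
  have [->|->] := dfloorS m t; rewrite -(dyadic_double mt).
    by rewrite subrr normr0 mulr_ge0// exprn_ge0// ltW.
  move=> lt; apply: (le_trans (vM lt)).
  by rewrite exprS ler_wpM2l// ler_piMl ?(ltW theta1)// exprn_ge0// ltW.
have -> : v (dyadic m.+1 (dfloor m.+1 t)) - y =
  (v (dyadic m.+1 (dfloor m.+1 t)) - v (dyadic m (dfloor m t))) +
  (v (dyadic m (dfloor m t)) - y) by rewrite addrA subrK.
apply: le_trans (ler_normD _ _) _; apply: le_trans (lerD step IH) _.
rewrite le_eqVlt; apply/orP; left; apply/eqP; rewrite exprS; field.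
by rewrite gt_eqF.
Qed.

(** The dyadic floors converge to t, so uniform continuity allows letting j tend to infinity in
    [chain_dyadic]. *)
Lemma chain_limit n (t : timeI T) :
  `|v t - v (dyadic n (dfloor n t))| <= M * theta ^+ n / (1 - theta).
Proof.
have th : 0 < 1 - theta by rewrite subr_gt0.
apply/ler_addgt0Pr => e e0.
have [dl dl0 vdl] := contfun_uniform_continuous v e0.
have [j Tj] := exists_nat_ge (T / dl).
have jn : T / 2 ^+ (n + j) < dl.
  rewrite ltr_pdivrMr ?exprn_gt0//; move: Tj; rewrite ler_pdivrMr// mulrC.
  move=> /le_lt_trans; apply; rewrite ltr_pM2l// -natrX ltr_nat.
  exact: leq_ltn_trans (leq_addl n j) (ltn_expl _ (ltnSn 1)).
have := vdl _ _ (le_lt_trans (dyadic_floor_dist (n + j) t) jn) => d1.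
have -> : v t - v (dyadic n (dfloor n t)) =
  (v t - v (dyadic (n + j) (dfloor (n + j) t))) +
  (v (dyadic (n + j) (dfloor (n + j) t)) - v (dyadic n (dfloor n t))).
  by rewrite addrA subrK.
rewrite [leRHS]addrC (le_trans (ler_normD _ _))// lerD//; first exact: ltW.
apply: le_trans (chain_dyadic n j t) _.
rewrite ler_wpM2r ?invr_ge0 ?(ltW th)// ler_wpM2l// gerBl.
by rewrite exprn_ge0// ltW.
Qed.

(** The floors of s and t at level n coincide or are neighbours, which costs one increment; the two
    tails from the floors to s and t give the term 2 / (1 - theta). *)
Lemma chain_close n (s t : timeI T) : time_val s <= time_val t ->
  time_val t - time_val s <= T / 2 ^+ n ->
  `|v t - v s| <= M * theta ^+ n * (1 + 2 / (1 - theta)).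
Proof.
move=> st tsn; have th : 0 < 1 - theta by rewrite subr_gt0.
have n0 : 0 < 2 ^+ n :> R by rewrite exprn_gt0.
have mid : `|v (dyadic n (dfloor n t)) - v (dyadic n (dfloor n s))| <=
    M * theta ^+ n.
  have /andP[a b] := dfloorP n s; have /andP[a' b'] := dfloorP n t.
  have d1 : time_val t * 2 ^+ n / T <= time_val s * 2 ^+ n / T + 1.
    rewrite -subr_ge0 (_ : _ - _ =
      (T / 2 ^+ n - (time_val t - time_val s)) * (2 ^+ n / T)).
      by rewrite mulr_ge0 ?subr_ge0// divr_ge0 ?(ltW n0) ?(ltW T0).
    by field; rewrite !gt_eqF.
  have d2 : time_val s * 2 ^+ n / T <= time_val t * 2 ^+ n / T.
    by rewrite ler_pM2r ?invr_gt0// ler_pM2r.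
  have : (dfloor n s < (dfloor n t).+1)%N by rewrite -(ltr_nat R); lra.
  have : (dfloor n t < (dfloor n s).+2)%N.
    by rewrite -(ltr_nat R) -natr1; lra.
  rewrite !ltnS leq_eqVlt => /predU1P[ets _|].
    by rewrite ets; apply: vM; rewrite -ets dfloor_le.
  rewrite ltnS => ts st'; have -> : dfloor n t = dfloor n s.
    by apply/eqP; rewrite eqn_leq ts.
  by rewrite subrr normr0 mulr_ge0// exprn_ge0// ltW.
have := chain_limit n t; have := chain_limit n s; rewrite distrC => s1 t1.
have -> : v t - v s = (v t - v (dyadic n (dfloor n t))) +
   ((v (dyadic n (dfloor n t)) - v (dyadic n (dfloor n s))) +
    (v (dyadic n (dfloor n s)) - v s)) by rewrite !addrA !subrK.
apply: le_trans (ler_normD _ _) _; apply: le_trans (lerD t1 (ler_normD _ _)) _.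
apply: le_trans (lerD (lexx _) (lerD mid s1)) _.
by rewrite le_eqVlt; apply/orP; left; apply/eqP; field; rewrite gt_eqF.
Qed.

End chaining.

Lemma dyadic_scale (x : R) : 0 < x <= 1 ->
  exists n : nat, (2 ^+ n.+1)^-1 < x <= (2 ^+ n)^-1.
Proof.
move=> /andP[x0 x1].
have ex : exists n, (2 ^+ n.+1)^-1 < x.
  have [n xn] := exists_nat_ge x^-1; exists n.
  rewrite invf_plt ?posrE ?exprn_gt0// (le_lt_trans xn)// -natrX ltr_nat.
  by rewrite (leq_trans (ltn_expl n (ltnSn 1)))// leq_exp2l.
exists (ex_minn ex); case: ex_minnP => -[nx _|n nx min]; first by rewrite nx expr0 invr1.
rewrite nx/= leNgt; apply/negP => /min.
by rewrite ltnn.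
Qed.

(** Dyadic increments of order gam' give global gam'-Hoelder continuity, and on a bounded interval
    the weaker exponent gam costs only a power of T. *)
Lemma holder_norm_chain (gam gam' : R) : 0 <= gam -> gam <= gam' -> 0 < gam' ->
  exists2 C : R, 0 < C & forall (v : contfun (timeI T) E) (M : R), 0 <= M ->
   (forall n k, (k < 2 ^ n)%N ->
     `|v (dyadic n k.+1) - v (dyadic n k)| <= M * (2 `^ (- gam')) ^+ n) ->
   (holder_norm (@enorm R E) gam v <= (`|v (dyadic 0 0)| + C * M)%:E)%E.
Proof.
move=> gam0 gg' gam'0; set theta := 2 `^ (- gam').
have theta0 : 0 < theta by exact: powR_gt0.
have theta1 : theta < 1.
  rewrite /theta powRN invf_lt1 ?powR_gt0//.
  have p1 : 1 `^ gam' = 1 :> R by rewrite powR1.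
  by rewrite -[ltLHS]p1 gt0_ltr_powR// ?nnegrE// ltr1n.
have th : 0 < 1 - theta by rewrite subr_gt0.
set K := 1 + 2 / (1 - theta).
have K0 : 0 < K by rewrite addr_gt0// divr_gt0.
(* The dyadic scale n matching t - s satisfies 2^(-n) < 2 (t-s) / T; this is the source of 2/T. *)
set L := (2 / T) `^ gam' * K.
have L0 : 0 < L by rewrite mulr_gt0// powR_gt0// divr_gt0.
(* The first term bounds the oscillation around the value at time 0, the second the gam-seminorm. *)
exists (T `^ gam' * L + T `^ (gam' - gam) * L).
  by rewrite addr_gt0// mulr_gt0// powR_gt0.
move=> v M M0 vM.
have incr (s t : timeI T) :
    `|v t - v s| <= L * M * `|time_val t - time_val s| `^ gam'.
  wlog st : s t / time_val s <= time_val t.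
    move=> H; have [st|/ltW ts] := leP (time_val s) (time_val t); first exact: H.
    by rewrite distrC [X in X `^ _]distrC; exact: H.
  move: st; rewrite le_eqVlt => /predU1P[/timeI_eq ->|st].
    by rewrite subrr normr0 !mulr_ge0 ?powR_ge0// ltW.
  rewrite [X in X `^ _]gtr0_norm ?subr_gt0//.
  have ts0 : 0 < time_val t - time_val s by rewrite subr_gt0.
  have [|n /andP[nx xn]] := @dyadic_scale ((time_val t - time_val s) / T).
    rewrite divr_gt0//= ler_pdivrMr// mul1r.
    have /andP[s0 _] := time_valP s; have /andP[_ tT] := time_valP t.
    by rewrite (le_trans _ tT)// gerBl.
  have c : time_val t - time_val s <= T / 2 ^+ n.
    by rewrite mulrC -ler_pdivrMr.
  apply: le_trans (chain_close M0 theta0 theta1 vM (ltW st) c) _; rewrite -/K.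
  have -> : L * M * (time_val t - time_val s) `^ gam' =
      M * (2 * ((time_val t - time_val s) / T)) `^ gam' * K.
    rewrite /L (_ : 2 * (_ / _) = (2 / T) * (time_val t - time_val s)).
      by rewrite (@powRM _ (2 / T)) ?divr_ge0 ?(ltW T0) ?(ltW ts0)//; ring.
    by field; rewrite gt_eqF.
  rewrite ler_wpM2r ?(ltW K0)// ler_wpM2l//.
  have -> : theta ^+ n = ((2 ^+ n)^-1) `^ gam'.
    rewrite -powR_mulrn ?powR_ge0// -powRrM mulNr mulrC -mulNr powRrM.
    by rewrite powRN powR_mulrn.
  rewrite ge0_ler_powR ?nnegrE ?(ltW gam'0)//.
  - by rewrite mulr_ge0// divr_ge0 ?(ltW T0) ?(ltW ts0).
  - by move: nx; rewrite exprS invfM; lra.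
have dT (s t : timeI T) : `|time_val t - time_val s| <= T.
  have /andP[s0 sT] := time_valP s; have /andP[t0 tT] := time_valP t.
  by rewrite ler_norml; apply/andP; split; lra.
rewrite mulrDl addrA EFinD /holder_norm leeD//.
  apply: ge_ereal_sup => _ [t _ <-]; rewrite lee_fin.
  have -> : v t = v (dyadic 0 0) + (v t - v (dyadic 0 0)) by rewrite subrKC.
  rewrite (le_trans (ler_normD _ _))// lerD2l (le_trans (incr _ _))//.
  have -> : T `^ gam' * L * M = L * M * T `^ gam' by ring.
  apply: ler_wpM2l; first by rewrite mulr_ge0// ltW.
  by rewrite ge0_ler_powR ?nnegrE ?(ltW gam'0) ?(ltW T0)//.
apply: ge_ereal_sup => _ [[t s] /= ts <-].
rewrite lee_fin; have ts0 : 0 < `|time_val t - time_val s|.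
  by rewrite normr_gt0 subr_eq0; apply: contra ts => /eqP/timeI_eq ->.
rewrite ler_pdivrMr ?powR_gt0// (le_trans (incr _ _))//.
have -> : `|time_val t - time_val s| `^ gam' =
  `|time_val t - time_val s| `^ (gam' - gam) * `|time_val t - time_val s| `^ gam.
  by rewrite -powRD ?subrK// gt_eqF// implybT.
rewrite mulrA ler_wpM2r ?powR_ge0//.
have -> : T `^ (gam' - gam) * L * M = L * M * T `^ (gam' - gam) by ring.
apply: ler_wpM2l; first by rewrite mulr_ge0// ltW.
by rewrite ge0_ler_powR ?nnegrE ?subr_ge0 ?(ltW T0)//.
Qed.

End holder_chaining.

Lemma geometric_sum_le (R : realType) (k : R) n : 0 <= k -> k < 1 ->
  \sum_(0 <= i < n) k ^+ i <= (1 - k)^-1.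
Proof.
move=> k0 k1; have d0 : 0 < 1 - k by rewrite subr_gt0.
suff -> : \sum_(0 <= i < n) k ^+ i = (1 - k ^+ n) / (1 - k).
  by rewrite ler_piMl ?invr_ge0 ?(ltW d0)// gerBl exprn_ge0.
elim: n => [|n IH]; first by rewrite big_geq// expr0 subrr mul0r.
by rewrite big_nat_recr//= IH exprS; field; rewrite gt_eqF.
Qed.

Lemma expr_small (R : realType) (k e : R) : 0 <= k -> k < 1 -> 0 < e ->
  exists n0 : nat, forall n, (n0 <= n)%N -> k ^+ n < e.
Proof.
move=> k0 k1 e0; have : `|k| < 1 by rewrite ger0_norm.
move=> /cvg_expr/cvgrPdist_lt/(_ _ e0)[n0 _ H]; exists n0 => n /H /=.
by rewrite sub0r normrN ger0_norm// exprn_ge0.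
Qed.

Lemma nneg_root (R : realType) (x : R) q : 0 <= x ->
  exists2 y : R, 0 <= y & y ^+ q.+1 = x.
Proof.
move=> x0; exists (x `^ q.+1%:R^-1); first exact: powR_ge0.
by rewrite -powR_mulrn ?powR_ge0// -powRrM mulVf// powRr1.
Qed.

Lemma holder_seminorm_ge0 (R : realType) (T : R) (T0 : 0 < T) (V : zmodType)
    (nrm : V -> \bar R) (s : R) (g : timeI T -> V) :
  (forall x, 0 <= nrm x)%E ->
  (0 <= ereal_sup [set nrm (g tu.1 - g tu.2)%R *
                 ((`|time_val tu.1 - time_val tu.2| `^ s)^-1)%R%:E |
             tu in [set tu : timeI T * timeI T | tu.1 != tu.2]])%E.
Proof.
move=> nrm0; have d01 : dyadic T0 0 0 != dyadic T0 0 1.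
  apply/eqP => /(congr1 (@time_val R T)); rewrite !dyadicE// expr0 !divr1 mul0r mul1r.
  by move=> T0'; move: T0; rewrite -T0' ltxx.
apply: (@le_trans _ _ (nrm (g (dyadic T0 0 0) - g (dyadic T0 0 1))%R *
   (`|time_val (dyadic T0 0 0) - time_val (dyadic T0 0 1)| `^ s)^-1%R%:E)%E).
  by rewrite mule_ge0// lee_fin invr_ge0 powR_ge0.
by apply: ereal_sup_ubound; exists (dyadic T0 0 0, dyadic T0 0 1).
Qed.

Lemma le_holder_norm (R : realType) (T : R) (T0 : 0 < T) (V : zmodType)
    (nrm : V -> \bar R) (s : R) (g : timeI T -> V) (t : timeI T) :
  (forall x, 0 <= nrm x)%E -> (nrm (g t) <= holder_norm nrm s g)%E.
Proof.
move=> nrm0.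
rewrite /holder_norm; apply: (@le_trans _ _ (ereal_sup (range (fun t => nrm (g t))))).
  by apply: ereal_sup_ubound; exists t.
by rewrite leeDl//; exact: (holder_seminorm_ge0 T0 s g nrm0).
Qed.

Lemma holder_norm_ge0 (R : realType) (T : R) (T0 : 0 < T) (E : normedModType R)
  (s : R) (v : timeI T -> E) : (0 <= holder_norm (@enorm R E) s v)%E.
Proof.
have norm_ge0 x : (0 <= @enorm R E x)%E by rewrite lee_fin.
exact: le_trans (norm_ge0 (v (dyadic T0 0 0))) (le_holder_norm T0 _ _ _ norm_ge0).
Qed.

(** * Kolmogorov-Chentsov estimate for moments of Hoelder norms *)

Section kolmogorov.
Context {R : realType} {T : R} (T0 : 0 < T) (E : normedModType R).
Context d (Omega : measurableType d) (P : probability Omega R).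
Variables (I : Type) (Z : I -> Omega -> contfun (timeI T) E) (gam a : R).
Hypotheses (gam0 : 0 <= gam) (gama : gam < a).
Hypothesis Z0 : all_moments P (fun i w => `|Z i w (dyadic T0 0 0)|).
Hypothesis Zincr : all_moments P
  (fun (x : I * (timeI T * timeI T)) w => `|Z x.1 w x.2.1 - Z x.1 w x.2.2| /
     `|time_val x.2.1 - time_val x.2.2| `^ a).

Let hnorm i w := holder_norm (@enorm R E) gam (Z i w).

(** [fine] turns an infinite norm into 0, so a moment bound alone would hide explosion. The majorant
    [H] controls the moment and is infinite wherever the norm is; its finite mean therefore also
    yields almost sure finiteness. *)
Lemma kolmogorov_bound : exists n0 : nat, forall q, (n0 <= q)%N ->
  exists C, forall i, exists H : Omega -> \bar R, ub_mean P H C /\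
   forall w, (((fine (hnorm i w)) ^+ q)%:E <= H w)%E /\
     (H w < +oo -> hnorm i w < +oo)%E.
Proof.
(* The chain runs at order b: b > 0 makes it contract, and the gap a - b pays for the 2^n increments
   of level n. *)
pose b := (gam + a) / 2.
have gb : gam < b by rewrite /b ltr_pdivlMr// mulr_natr mulr2n ltrD2l.
have ba : b < a by rewrite /b ltr_pdivrMr// mulr_natr mulr2n ltrD2r.
have b0 : 0 < b by exact: le_lt_trans gb.
have [C' C'0 chain] := holder_norm_chain T0 E gam0 (ltW gb) b0.
set theta := 2 `^ (- b) in chain.
have theta0 : 0 < theta by exact: powR_gt0.
pose rho : R := 2 `^ (- (a - b)).
have rho0 : 0 < rho by exact: powR_gt0.
have rho1 : rho < 1.
  rewrite /rho powRN invf_lt1 ?powR_gt0//.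
  have p1 : 1 `^ (a - b) = 1 :> R by rewrite powR1.
  by rewrite -[ltLHS]p1 gt0_ltr_powR ?subr_gt0// ?nnegrE// ltr1n.
(* For these orders rho^q < 1/2, which makes the ratio k = 2 rho^q of the level bounds smaller than
   1. *)
have [n0 n0P] := expr_small (ltW rho0) rho1 (divr_gt0 (@ltr01 R) (ltr0n R 2)).
exists n0.+1 => -[//|q] n0q.
have [_ /(_ q.+1)[C CP]] := Zincr; have [_ /(_ q.+1)[K KP]] := Z0.
pose k := 2 * rho ^+ q.+1.
have k0 : 0 <= k by rewrite mulr_ge0// exprn_ge0// ltW.
have k1 : k < 1 by have := n0P q.+1 (ltnW n0q); rewrite /k; lra.
pose S := `|C| * (T `^ a) ^+ q.+1 / (1 - k).
pose A : R := 2 ^+ q.+1; pose B : R := A * C' ^+ q.+1.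
have A0 : 0 < A by rewrite exprn_gt0.
have B0 : 0 < B by rewrite mulr_gt0// exprn_gt0.
exists (A * K + B * S) => i.
pose Dl n j w := `|Z i w (dyadic T0 n j.+1) - Z i w (dyadic T0 n j)|.
(* The maximum over the increments of level n is replaced by the sum of their powers, whose mean is
   controlled. *)
pose F n w := (\sum_(j < 2 ^ n) ((Dl n j w / theta ^+ n) ^+ q.+1)%:E)%E.
pose G w := ereal_sup (range (fun n => F n w)).
have FC n : ub_mean P (F n) (`|C| * (T `^ a) ^+ q.+1 * k ^+ n).
  have term (j : 'I_(2 ^ n)) : ub_mean P
      (fun w => ((Dl n j w / theta ^+ n) ^+ q.+1)%:E)
      ((T `^ a * rho ^+ n) ^+ q.+1 * `|C|).
    have h0 : 0 <= (T `^ a * rho ^+ n) ^+ q.+1.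
      by rewrite exprn_ge0// mulr_ge0 ?powR_ge0// exprn_ge0// ltW.
    have hC := ub_mean_le (fun w => lexx _) (ler_norm C)
      (CP (i, (dyadic T0 n j.+1, dyadic T0 n j))).
    apply: ub_mean_le (ub_meanZ h0 hC) => // w /=.
    rewrite -EFinM -exprMn lee_fin /Dl.
    have -> : `|time_val (dyadic T0 n j.+1) - time_val (dyadic T0 n j)| =
        T / 2 ^+ n.
      rewrite !dyadicE ?ltn_ord// 1?ltnW ?ltn_ord//.
      rewrite -natr1 (_ : _ - _ = T / 2 ^+ n).
        by rewrite ger0_norm// divr_ge0 ?(ltW T0)// exprn_ge0.
      by field; rewrite expf_neq0.
    have -> : (T / 2 ^+ n) `^ a = T `^ a * rho ^+ n * theta ^+ n.
      rewrite powRM ?(ltW T0) ?invr_ge0 ?exprn_ge0// -mulrA -exprMn.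
      rewrite /rho /theta -powRD ?implybT//; last by rewrite pnatr_eq0 implybT.
      rewrite (_ : - (a - b) - b = - a); last by ring.
      congr (_ * _); rewrite -[RHS]powR_mulrn ?powR_ge0// -powRrM mulNr mulrC.
      by rewrite -mulNr powRrM powRN powR_mulrn.
    rewrite le_eqVlt; apply/orP; left; apply/eqP; congr (_ ^+ _).
    by field; rewrite !gt_eqF ?exprn_gt0 ?powR_gt0.
  apply: ub_mean_le (ub_mean_sum (index_enum 'I_(2 ^ n)) term) => //.
  rewrite big_const_ord iter_addr_0 -mulr_natl natrX /k exprMn [_ * `|C|]mulrC.
  rewrite mulrCA -mulrA ler_wpM2l// exprMn mulrCA ler_wpM2l ?exprn_ge0 ?powR_ge0//.
  by rewrite -!exprM mulnC.
have GS : ub_mean P G S.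
  apply: (ub_mean_nneseries FC) => n; rewrite -big_distrr/= ler_wpM2l//.
    by rewrite mulr_ge0// exprn_ge0// powR_ge0.
  exact: geometric_sum_le.
exists (fun w => A%:E * (`|Z i w (dyadic T0 0 0)| ^+ q.+1)%:E + B%:E * G w)%E.
split.
  by apply: ub_meanD; apply: ub_meanZ; rewrite ?(ltW A0) ?(ltW B0).
move=> w; have t0 n j : 0 <= (Dl n j w / theta ^+ n) ^+ q.+1.
  by rewrite exprn_ge0// /Dl divr_ge0// exprn_ge0// ltW.
have F0 n : (0 <= F n w)%E by apply: sume_ge0 => j _; rewrite lee_fin t0.
have G0 : (0 <= G w)%E.
  by apply: le_trans (F0 0%N) _; apply: ereal_sup_ubound; exists 0%N.
have [Gy|] := eqVneq (G w) +oo%E.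
  rewrite Gy gt0_muley ?lte_fin// -EFinM addey//.
  by split; [exact: leey | rewrite ltxx].
rewrite -ltey => Gfin; have /fineK GE : G w \is a fin_num by rewrite ge0_fin_numE.
(* Every normalized increment has its power among the terms of some [F n w], so this root is an
   admissible constant for the chain. *)
have [M M0 MG] := @nneg_root R (fine (G w)) q (fine_ge0 G0).
have hb : (hnorm i w <= (`|Z i w (dyadic T0 0 0)| + C' * M)%:E)%E.
  apply: chain => // n j jn; rewrite -ler_pdivrMr ?exprn_gt0//.
  rewrite -(@ler_pXn2r _ q.+1) ?nnegrE ?divr_ge0 ?exprn_ge0 ?(ltW theta0)//.
  rewrite MG -lee_fin GE; apply: (@le_trans _ _ (F n w)); last first.
    by apply: ereal_sup_ubound; exists n.
  rewrite /F (bigD1 (Ordinal jn))//= leeDl// sume_ge0// => l _.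
  by rewrite lee_fin t0.
have hfin : (hnorm i w < +oo)%E by rewrite (le_lt_trans hb)// ltry.
split=> [|//]; rewrite -GE -!EFinM -EFinD lee_fin -MG /B -mulrA -mulrDr -exprMn.
have hge : (0 <= hnorm i w)%E by exact: holder_norm_ge0.
apply: le_trans (ler_exprnD _ _ _); last 2 first.
- exact: normr_ge0.
- by rewrite mulr_ge0// ltW.
rewrite lerXn2r ?nnegrE ?fine_ge0 ?addr_ge0 ?mulr_ge0 ?(ltW C'0)//.
by rewrite -lee_fin fineK// ge0_fin_numE.
Qed.

Lemma kolmogorov : all_moments P (fun i w => fine (hnorm i w)) /\
  forall i, {ae P, forall w, (hnorm i w < +oo)%E}.
Proof.
have [n0 n0P] := kolmogorov_bound; split.
  apply: (@all_moments_eventually _ _ _ _ _ _ n0) => [i w|q /n0P[C CP]].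
    by apply: fine_ge0; exact: holder_norm_ge0.
  exists C => i; have [H [HC Hw]] := CP i.
  by apply: ub_mean_le HC => // w; case: (Hw w).
move=> i; have [C /(_ i)[H [HC Hw]]] := n0P n0 (leqnn _).
by apply: filterS (ub_mean_ae_lty HC) => w; case: (Hw w).
Qed.

End kolmogorov.

(** * Moments of independent sums in spaces of type 2 *)

Section rademacher_mean.
Context {R : realType} {E : normedModType R}.
Implicit Types (F : E -> R) (s : seq E) (u x : E).

(** The mean of [F (u + \sum_i e_i x_i)] over all sign vectors [e]. *)
Fixpoint rad F s u : R :=
  if s is x :: s' then (rad F s' (u + x) + rad F s' (u - x)) / 2 else F u.

Lemma rad_le F G s u : (forall x, F x <= G x) -> rad F s u <= rad G s u.
Proof.
move=> FG; elim: s u => [//|x s IH] u /=.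
by have := IH (u + x); have := IH (u - x); lra.
Qed.

Lemma rad_ge0 F s u : (forall x, 0 <= F x) -> 0 <= rad F s u.
Proof.
move=> F0; elim: s u => [|x s IH] u /=; first exact: F0.
by rewrite divr_ge0// addr_ge0.
Qed.

Lemma rad_affine F s u (a b : R) :
  rad (fun x => a + b * F x) s u = a + b * rad F s u.
Proof. by elim: s u => [//|x s IH] u /=; rewrite !IH; field. Qed.

Lemma rad_scale F (c k : R) s u : (forall x, F (c *: x) = k * F x) ->
  rad F [seq c *: x | x <- s] (c *: u) = k * rad F s u.
Proof.
move=> Fc; elim: s u => [//|x s IH] u /=.
by rewrite -scalerDr -scalerBr !IH; field.
Qed.

Lemma rad_norm_lip s u u' : rad (fun x => `|x|) s u <= rad (fun x => `|x|) s u' + `|u - u'|.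
Proof.
elim: s u u' => [|x s IH] u u' /=.
  by rewrite -lerBlDl (le_trans _ (ler_dist_dist _ _))// ler_norm.
have := IH (u + x) (u' + x); have := IH (u - x) (u' - x).
rewrite (_ : u + x - (u' + x) = u - u'); last by rewrite opprD addrACA subrr addr0.
rewrite (_ : u - x - (u' - x) = u - u'); last first.
  by rewrite opprD addrACA subrr addr0.
lra.
Qed.

Lemma inv_le_expR (t : R) : 0 <= t <= 2^-1 -> (1 - t)^-1 <= expR (2 * t).
Proof.
move=> /andP[t0 t1]; have h : 0 < 1 - t by lra.
rewrite invf_ple ?posrE ?expR_gt0// -expRN.
have : (expR (2 * t))^-1 <= (1 + 2 * t)^-1.
  by rewrite lef_pV2 ?posrE ?expR_gt0 ?expR_ge1Dx//; lra.
rewrite -expRN => /le_trans; apply.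
rewrite invf_ple ?posrE//; last lra.
by rewrite -div1r ler_pdivrMr//; nra.
Qed.

(** For y^2 <= 1/2, averaging e^y <= 1/(1-y) and e^(-y) <= 1/(1+y) gives 1/(1-y^2) <= e^(2 y^2).
    Otherwise y <= 2 y^2 for y >= 0, and the larger exponential suffices. *)
Lemma cosh_le (y : R) : (expR y + expR (- y)) / 2 <= expR (2 * y ^+ 2).
Proof.
wlog y0 : y / 0 <= y.
  move=> H; have [y0|/ltW y0] := leP 0 y; first exact: H.
  by have := H (- y); rewrite oppr_ge0 opprK sqrrN addrC; exact.
have [y2|y2] := leP (y ^+ 2) 2^-1; last first.
  have : expR (- y) <= expR y by rewrite ler_expR; lra.
  have : expR y <= expR (2 * y ^+ 2) by rewrite ler_expR; nra.
  lra.
apply: le_trans (inv_le_expR _); last by rewrite sqr_ge0.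
have y1 : y < 1 by nra.
have h1 : expR y <= (1 - y)^-1.
  have := expR_ge1Dx (- y); rewrite expRN => h.
  by rewrite -[leLHS]invrK lef_pV2 ?posrE ?invr_gt0 ?expR_gt0//; lra.
have h2 : expR (- y) <= (1 + y)^-1.
  by rewrite expRN lef_pV2 ?posrE ?expR_gt0 ?expR_ge1Dx//; lra.
have -> : (1 - y ^+ 2)^-1 = ((1 - y)^-1 + (1 + y)^-1) / 2.
  by field; apply/and3P; split; apply/eqP; nra.
by rewrite ler_pM2r ?invr_gt0// lerD.
Qed.

Lemma expR_mean_le (a b c : R) : `|a - b| <= 2 * c ->
  (expR a + expR b) / 2 <= expR ((a + b) / 2 + 2 * c ^+ 2).
Proof.
move=> abc; pose y := (a - b) / 2; pose m := (a + b) / 2.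
have {1}-> : a = m + y by rewrite /m /y; field.
have {1}-> : b = m - y by rewrite /m /y; field.
rewrite -/m.
rewrite !expRD -mulrDr -mulrA ler_wpM2l ?expR_ge0// (le_trans (cosh_le y))//.
rewrite ler_expR ler_wpM2l// -[leLHS]real_normK ?num_real//.
rewrite lerXn2r ?nnegrE//; first by move: abc; rewrite ler_norml; lra.
rewrite /y normrM [X in _ * X]ger0_norm ?invr_ge0//; lra.
Qed.

(** Bounded differences: flipping the sign of x changes the mean norm over the remaining signs by at
    most 2|x|, and each sign then contributes 2|x|^2 to the exponent. *)
Lemma rad_expR s u :
  rad (fun x => expR `|x|) s u <=
  expR (rad (fun x => `|x|) s u + 2 * \sum_(x <- s) `|x| ^+ 2).
Proof.
elim: s u => [|x s IH] u; first by rewrite /= big_nil mulr0 addr0.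
rewrite big_cons /=; set S := \sum_(j <- s) _ in IH *.
set a := rad (fun x => `|x|) s (u + x); set b := rad (fun x => `|x|) s (u - x).
have := IH (u + x); have := IH (u - x); rewrite -/a -/b => hb ha.
have abx : `|(a + 2 * S) - (b + 2 * S)| <= 2 * `|x|.
  have -> : a + 2 * S - (b + 2 * S) = a - b by ring.
  rewrite ler_norml lerBlDl lerNl opprB.
  have -> : 2 * `|x| = `|x + x| by rewrite -mulr2n normrMn mulr_natl.
  have d1 := rad_norm_lip s (u + x) (u - x).
  have d2 := rad_norm_lip s (u - x) (u + x).
  have e1 : u + x - (u - x) = x + x by rewrite opprB addrC addrA subrK.
  have e2 : u - x - (u + x) = - (x + x) by rewrite opprD addrACA subrr add0r opprD.
  rewrite e1 in d1; rewrite e2 normrN in d2.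
  by rewrite lerBlDl d1 d2.
have := expR_mean_le abx; rewrite (_ : (a + 2 * S + (b + 2 * S)) / 2 +
    2 * `|x| ^+ 2 = (a + b) / 2 + 2 * (`|x| ^+ 2 + S)); last by field.
by apply: le_trans; lra.
Qed.

(** Powers are below factorial times exponential. In the exponent, the mean norm is at most 1 + L
    and the quadratic sum contributes at most 2, whence L + 3. *)
Lemma rad_exprn s (q : nat) (L : R) :
  rad (fun x => `|x| ^+ 2) s 0 <= L -> \sum_(x <- s) `|x| ^+ 2 <= 1 ->
  rad (fun x => `|x| ^+ q.+1) s 0 <= q.+1`!%:R * expR (L + 3).
Proof.
move=> sL s1.
have fact0 : 0 < q.+1`!%:R :> R by rewrite ltr0n fact_gt0.
(* The summand 0 gives the integrand the form required by [rad_affine]. *)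
apply: (@le_trans _ _ (rad (fun x => 0 + q.+1`!%:R * expR `|x|) s 0)).
  apply: rad_le => x; rewrite add0r mulrC -ler_pdivrMr//.
  by apply: le_trans (expR_ge1Dxn q (normr_ge0 x)); rewrite lerDr.
rewrite rad_affine add0r ler_wpM2l ?(ltW fact0)//.
apply: le_trans (rad_expR s 0) _; rewrite ler_expR.
have : rad (fun x => `|x|) s 0 <= rad (fun x => 1 + 1 * `|x| ^+ 2) s 0.
  by apply: rad_le => x; have := sqr_ge0 (`|x| - 1); nra.
by rewrite rad_affine; lra.
Qed.

(** Both sides are homogeneous of degree 2(m+1), so the vectors may be rescaled to have quadratic
    sum 1, where [rad_exprn] gives an absolute constant. *)
Lemma rad_moment (K : R) (m : nat) :
  (forall s, rad (fun x => `|x| ^+ 2) s 0 <= K * \sum_(x <- s) `|x| ^+ 2) ->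
  exists2 C : R, 0 <= C & forall s,
    rad (fun x => `|x| ^+ (m.+1 * 2)) s 0 <= C * (\sum_(x <- s) `|x| ^+ 2) ^+ m.+1.
Proof.
move=> hK; exists ((m.+1 * 2)`!%:R * expR (`|K| + 3)).
  by rewrite mulr_ge0// expR_ge0.
move=> s; set S := \sum_(x <- s) _.
have S0 : 0 <= S by apply: sumr_ge0 => x _; exact: sqr_ge0.
have [Se|Sn] := eqVneq S 0.
  suff -> : rad (fun x => `|x| ^+ (m.+1 * 2)) s 0 = 0 by rewrite Se expr0n mulr0.
  have : all (fun x => x == 0) s.
    move: Se => /eqP; rewrite /S psumr_eq0; last by move=> x _; exact: sqr_ge0.
    by apply: sub_all => x /=; rewrite expf_eq0/= normr_eq0.
  elim: (s) => [|x t IH] /=; first by rewrite normr0 expr0n.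
  by move=> /andP[/eqP -> /IH]; rewrite addr0 subr0 => ->; rewrite addr0 mul0r.
have Sp : 0 < S by rewrite lt0r Sn.
pose c := Num.sqrt S; have c0 : 0 < c by rewrite sqrtr_gt0.
have cS : c ^+ 2 = S by rewrite sqr_sqrtr.
pose t := [seq c^-1 *: x | x <- s].
have tS : \sum_(x <- t) `|x| ^+ 2 = 1.
  rewrite /t big_map; under eq_bigr do rewrite normrZ exprMn.
  by rewrite -big_distrr/= -/S real_normK ?num_real// exprVn cS mulVf.
have := @rad_exprn t (m.+1 * 2).-1 `|K|; rewrite prednK ?muln_gt0// tS.
have h2 : rad (fun x => `|x| ^+ 2) t 0 <= `|K|.
  by rewrite (le_trans (hK t))// tS mulr1 ler_norm.
move=> /(_ h2 (lexx _)).
have hom x : `|c^-1 *: x| ^+ (m.+1 * 2) = (S ^+ m.+1)^-1 * `|x| ^+ (m.+1 * 2).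
  rewrite normrZ exprMn; congr (_ * _).
  by rewrite gtr0_norm ?invr_gt0// exprVn mulnC exprM cS.
have := @rad_scale _ c^-1 _ s 0 hom; rewrite scaler0 => ->.
by rewrite mulrC ler_pdivrMr ?exprn_gt0.
Qed.

End rademacher_mean.

(** * A concrete probability space of independent fair signs *)

Section sign_space.
Context {R : realType}.

(** The first [k] binary digits of a uniform integer below [2 ^ k] are independent
    fair signs. *)
Definition sgn_digit (j n : nat) : R := if odd (n %/ 2 ^ j) then 1 else -1.

Lemma sgn_digit_measurable j : measurable_fun setT (sgn_digit j).
Proof. by []. Qed.

HB.instance Definition _ j :=
  isMeasurableFun.Build _ _ _ _ (sgn_digit j) (sgn_digit_measurable j).

Definition digit_mean (k : nat) (g : nat -> R) : R :=
  (2 ^+ k)^-1 * \sum_(n < 2 ^ k) g n.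

Lemma sum_double (m : nat) (g : nat -> R) :
  \sum_(n < m * 2) g n = \sum_(n < m) (g (n * 2)%N + g (n * 2).+1).
Proof.
elim: m => [|m IH]; first by rewrite mul0n !big_ord0.
by rewrite mulSn add2n !big_ord_recr/= IH addrA.
Qed.

(** Splitting integers by parity exposes their lowest digit; this matches the recursion of [rad]. *)
Lemma digit_meanS k g : digit_mean k.+1 g =
  (digit_mean k (fun n => g (n * 2).+1) + digit_mean k (fun n => g (n * 2)%N)) / 2.
Proof.
rewrite /digit_mean expnSr sum_double big_split/= exprS; field.
by rewrite expf_neq0.
Qed.

Lemma sgn_digit0 n : sgn_digit 0 (n * 2) = -1 /\ sgn_digit 0 (n * 2).+1 = 1.
Proof. by rewrite /sgn_digit expn0 !divn1 /= oddM andbF. Qed.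

Lemma sgn_digitS j n : sgn_digit j.+1 (n * 2) = sgn_digit j n /\
  sgn_digit j.+1 (n * 2).+1 = sgn_digit j n.
Proof.
rewrite /sgn_digit expnS !divnMA mulnK//; split=> //.
by rewrite -addn1 divnMDl// addn0.
Qed.

Lemma digit_mean_rad (E : normedModType R) (F : E -> R) (s : seq E) (u : E) :
  digit_mean (size s) (fun n => F (u + \sum_(j < size s) sgn_digit j n *: s`_j)) =
  rad F s u.
Proof.
elim: s u => [|x s IH] u.
  by rewrite /digit_mean/= big_ord_recl !big_ord0 addr0 expr0 invr1 mul1r !addr0.
rewrite /= digit_meanS -!IH; congr ((_ + _) / 2); congr (digit_mean _ _);
  apply/funext => n; rewrite big_ord_recl/= addrA.
  rewrite (sgn_digit0 n).2 scale1r; congr (F (_ + _)).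
  by apply: eq_bigr => j _; rewrite (sgn_digitS j n).2.
rewrite (sgn_digit0 n).1 scaleN1r; congr (F (_ + _)).
by apply: eq_bigr => j _; rewrite (sgn_digitS j n).1.
Qed.

Lemma digit_mean_prod k (phi : nat -> R -> R) :
  digit_mean k (fun n => \prod_(j < k) phi j (sgn_digit j n)) =
  \prod_(j < k) ((phi j 1 + phi j (-1)) / 2).
Proof.
elim: k phi => [|k IH] phi.
  by rewrite /digit_mean big_ord_recl !big_ord0 expr0 invr1 mul1r addr0.
have H b (c : R) : (forall n, sgn_digit 0 (b + n * 2) = c) ->
    (forall j n, sgn_digit j.+1 (b + n * 2) = sgn_digit j n) ->
    digit_mean k (fun n => \prod_(j < k.+1) phi j (sgn_digit j (b + n * 2))) =
    phi 0%N c * \prod_(j < k) ((phi j.+1 1 + phi j.+1 (-1)) / 2).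
  move=> H0 HS; rewrite -(IH (fun j => phi j.+1)) /digit_mean mulrCA [in RHS]big_distrr/=.
  congr (_ * _); apply: eq_bigr => n _; rewrite big_ord_recl H0; congr (_ * _).
  by apply: eq_bigr => j _; rewrite HS.
rewrite digit_meanS (H 1%N 1) => [|n|j n].
- rewrite (H 0%N (-1)) => [|n|j n]; first by rewrite [RHS]big_ord_recl/=; ring.
    exact: (sgn_digit0 n).1.
  exact: (sgn_digitS j n).1.
- exact: (sgn_digit0 n).2.
- exact: (sgn_digitS j n).2.
Qed.

(** Uniform law on the integers below 2^k. It is carried by [nat], where every set is measurable. *)
Definition digit_measure (k : nat) : set nat -> \bar R :=
  mscale ((2 ^+ k)^-1)%:nng (msum (fun n => dirac n) (2 ^ k)).

HB.instance Definition _ k := Measure.on (digit_measure k).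

Lemma integral_digit_measure k (g : nat -> R) : (forall n, 0 <= g n) ->
  (\int[digit_measure k]_n (g n)%:E = (digit_mean k g)%:E)%E.
Proof.
move=> g0; rewrite /digit_measure ge0_integral_mscale//=; last first.
  by move=> n _; rewrite lee_fin.
rewrite ge0_integral_measure_sum//=; last by move=> n _; rewrite lee_fin.
rewrite /digit_mean EFinM -sumEFin; congr (_ * _)%E; apply: eq_bigr => n _.
by rewrite integral_dirac//= diracE in_setT mul1e.
Qed.

Lemma digit_measureE k (A : set nat) :
  digit_measure k A = (digit_mean k (\1_A))%:E.
Proof.
by rewrite -integral_digit_measure// integral_indic// setIT.
Qed.

Lemma digit_measureT k : digit_measure k setT = 1%E.
Proof.
rewrite digit_measureE /digit_mean; congr EFin.
under eq_bigr do rewrite indicT.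
by rewrite sumr_const card_ord natrX mulVf// expf_neq0.
Qed.

HB.instance Definition _ k :=
  Measure_isProbability.Build _ _ _ (digit_measure k) (digit_measureT k).

Lemma digit_measure_prod k (J : seq 'I_k) (B : 'I_k -> set R) : uniq J ->
  digit_measure k (\bigcap_(i in [set` J]) (sgn_digit i @^-1` B i)) =
  (\prod_(i <- J) ((\1_(B i) (1 : R) + \1_(B i) (-1 : R)) / 2))%:E.
Proof.
move=> uJ; rewrite digit_measureE; congr EFin.
(* The indicator of the event becomes a product over all digits, with factor 1 for those outside
   J. *)
pose phi (j : nat) (x : R) : R :=
  if insub j is Some i then (if i \in J then \1_(B i) x else 1) else 1.
have phiE (i : 'I_k) x : phi i x = if i \in J then \1_(B i) x else 1.
  by rewrite /phi valK.
have -> : \1_(\bigcap_(i in [set` J]) (sgn_digit i @^-1` B i)) =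
    (fun n => \prod_(j < k) phi j (sgn_digit j n)).
  apply/funext => n; rewrite indicE; case: (boolP (n \in _)) => [|].
    rewrite inE => nB; rewrite big1// => i _; rewrite phiE; case: ifP => // iJ.
    by rewrite indicE mem_set//; exact: nB.
  rewrite notin_setE => nB; have [i iJ nBi] : exists2 i, i \in J &
      ~ B i (sgn_digit i n).
    apply: contrapT => H; apply: nB => i /= iJ; apply: contrapT => nBi.
    by apply: H; exists i.
  by rewrite (bigD1 i)//= phiE iJ indicE memNset// mul0r.
rewrite digit_mean_prod [RHS]big_uniq//= [RHS]big_mkcond/=.
by apply: eq_bigr => i _; rewrite !phiE; case: ifP => // _; field.
Qed.

(** Type 2 is instantiated on the space of binary digits, where the expectation is exactly [rad].
    Squaring the inequality turns K into K^2. *)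
Lemma type2_rad (E : normedModType R) : has_type E 2 ->
  exists2 K : R, 0 <= K & forall s : seq E,
    rad (fun x => `|x| ^+ 2) s 0 <= K * \sum_(x <- s) `|x| ^+ 2.
Proof.
move=> [K K0 HK]; exists (K ^+ 2); first exact: sqr_ge0.
move=> s; have [->|s0] := eqVneq s [::].
  by rewrite /= normr0 expr0n big_nil mulr0.
pose k := size s; have k0 : (0 < k)%N by rewrite lt0n size_eq0.
have pre i (B : set R) : digit_measure k (sgn_digit (i : 'I_k) @^-1` B) =
    ((\1_B (1 : R) + \1_B (-1 : R)) / 2)%:E.
  have := @digit_measure_prod k [:: i] (fun=> B) isT.
  rewrite big_seq1 => <-; congr (digit_measure k _).
  apply/seteqP; split => n /=; first by move=> nB j; rewrite /= inE => /eqP ->.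
  by move=> /(_ i); rewrite /= inE eqxx; exact.
have n11 : (1 : R) != -1 by rewrite gt_eqF// (@lt_trans _ _ 0)// ltrN10.
have half (j : 'I_k) : digit_measure k (sgn_digit j @^-1` [set 1]) = (2^-1)%:E /\
    digit_measure k (sgn_digit j @^-1` [set -1]) = (2^-1)%:E.
  rewrite !pre !indicE; split; congr EFin.
    rewrite mem_set// memNset ?addr0 ?mul1r//= => e.
    by move: n11; rewrite e eqxx.
  rewrite memNset ?mem_set ?add0r ?mul1r//= => e.
  by move: n11; rewrite -e eqxx.
have indep : independent_on (digit_measure k) [set: 'I_k]
    (fun j => sgn_digit j : nat -> R).
  move=> J B uJ _ mB; rewrite [LHS](@digit_measure_prod k J B uJ) -prodEFin.
  by apply: eq_bigr => j _; rewrite [RHS](pre j (B j)).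
have := HK _ _ (digit_measure k) k (fun j => s`_j) (fun j => sgn_digit j) k0 half indep.
move=> LK; rewrite (big_nth 0) big_mkord -/k.
set S := \sum_(i < k) _ in LK *.
set Q := \sum_(i < k) `|s`_i| ^+ 2.
have SQ : S = Q by apply: eq_bigr => j _; rewrite powR_mulrn.
have Q0 : 0 <= Q by apply: sumr_ge0 => j _; exact: sqr_ge0.
rewrite -digit_mean_rad -/k -lee_fin.
rewrite -integral_digit_measure; last by move=> n; exact: sqr_ge0.
rewrite /Lp_norm in LK.
have L0 := Lnorm_ge0 (digit_measure k) 2%:E (fun n => enorm (\sum_(j < k) sgn_digit j n *: s`_j)).
have := @gt0_ler_poweR R 2 (ler0n R 2) _ _ _ _ LK.
rewrite poweR_Lnorm// !in_itv/= !leey !andbT => /(_ L0 (le_trans L0 LK)).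
congr (_ <= _)%E.
  apply: eq_integral => n _; rewrite /= normr_id powR_mulrn// add0r.
  by [].
rewrite SQ; congr EFin; rewrite powR_mulrn; last by rewrite mulr_ge0// powR_ge0.
by rewrite exprMn -[X in _ * X]powR_mulrn ?powR_ge0// -powRrM mulVf// powRr1.
Qed.

End sign_space.

(** * Independent events, centred variables and a Jensen inequality *)

Section independent_event.
Context d (Omega : measurableType d) (R : realType) (P : probability Omega R).
Local Open Scope ereal_scope.

Lemma integral_mrestr (F : set Omega) (mF : measurable F) (f : Omega -> \bar R) :
  measurable_fun setT f -> (forall w, 0 <= f w) ->
  \int[P]_(w in F) f w = \int[mrestr P mF]_w f w.
Proof.
move=> mf f0; have mFC := measurableC mF.
have mfF : measurable_fun setT (f \_ F).
  by apply/(measurable_restrictT _ _).1 => //; exact: measurable_funTS.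
have fF0 w : 0 <= (f \_ F) w by apply: erestrict_ge0.
rewrite integral_mkcond.
rewrite (eq_measure_integral (measure_add (mrestr P mF) (mrestr P mFC))); last first.
  move=> A mA _; rewrite [RHS](measure_addE (mrestr P mF) (mrestr P mFC) A) /mrestr.
  have := measureU P (measurableI _ _ mA mF) (measurableI _ _ mA mFC).
  by rewrite -setIUr setUv setIT setIACA setICr setI0; exact.
rewrite ge0_integral_measure_add// [X in _ + X](_ : _ = 0) ?adde0.
  apply: ge0_ae_eq_integral => //; exists (~` F); split => //.
    by rewrite /= /mrestr setICl measure0.
  move=> w /= /not_implyP[_]; apply: contra_not => Fw.
  by rewrite patchE mem_set.
transitivity (\int[mrestr P mFC]_(w in setT) (cst 0 : Omega -> \bar R) w).
  apply: ge0_ae_eq_integral => //; exists F; split => //.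
    by rewrite /= /mrestr setICr measure0.
  move=> w /= /not_implyP[_]; apply: contra_notP => Fw.
  by rewrite patchE memNset.
by rewrite integral0.
Qed.

(** Under P restricted to F, the law of V is P(F) times its law under P, and integrals only see the
    law. *)
Lemma integral_independent_event d' (S : measurableType d') (V : Omega -> S)
    (F : set Omega) (phi : S -> \bar R) :
  measurable F -> measurable_fun setT V -> measurable_fun setT phi ->
  (forall x, 0 <= phi x) ->
  (forall B, measurable B -> P (F `&` V @^-1` B) = P F * P (V @^-1` B)) ->
  \int[P]_(w in F) phi (V w) = P F * \int[P]_w phi (V w).
Proof.
move=> mF mV mphi phi0 FV.
rewrite (integral_mrestr mF)//; last exact: measurableT_comp.
have PF : P F \is a fin_num by exact: fin_num_measure.
have p0 : (0 <= fine (P F))%R by exact: fine_ge0.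
rewrite -(@ge0_integral_pushforward _ _ _ _ _ V mV (mrestr P mF) setT phi)//.
rewrite -(@ge0_integral_pushforward _ _ _ _ _ V mV P setT phi)//.
rewrite (eq_measure_integral (mscale (NngNum p0) (pushforward P V))).
  by rewrite ge0_integral_mscale//= fineK.
move=> A mA _; rewrite /= /pushforward /mrestr /mscale/= setIC FV// fineK//.
Qed.

End independent_event.

Section centered.
Context d (Omega : measurableType d) (R : realType) (P : probability Omega R).
Context (E : normedModType R).

(** For a Bochner integrable [V], this holds when the mean of [V] is 0. *)
Definition centered (V : Omega -> E) : Prop :=
  forall u : E, (`|u|%:E <= \int[P]_w `|u + V w|%:E)%E.

(** The tangent of t^(q+1) at |u| is integrated and [centered] bounds its linear part. The negative
    term of the tangent is moved to the other side, so that all integrands stay nonnegative even if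
    the integral is infinite. *)
Lemma centered_pow (V : Omega -> E) q (u : E) :
  measurable_fun setT (V : Omega -> borel E) -> centered V ->
  ((`|u| ^+ q.+1)%:E <= \int[P]_w (`|u + V w| ^+ q.+1)%:E)%E.
Proof.
move=> mV cV; set y := `|u|.
have mn : measurable_fun setT (fun w => `|u + V w|).
  have c : continuous (fun x : E => `|u + x|).
    move=> x; apply: cvg_norm; apply: cvgD; first exact: cvg_cst.
    exact: cvg_id.
  exact: (measurableT_comp (continuous_borel_measurable_real c) mV).
have y0 : 0 <= y by exact: normr_ge0.
have a0 : 0 <= q.+1%:R * y ^+ q by rewrite mulr_ge0// exprn_ge0.
have tan : (\int[P]_w ((y ^+ q.+1)%:E + (q.+1%:R * y ^+ q)%:E * `|u + V w|%:E) <=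
    \int[P]_w ((`|u + V w| ^+ q.+1)%:E + (q.+1%:R * y ^+ q * y)%:E))%E.
  apply: ge0_le_integral => //.
  - by move=> w _; rewrite -EFinM -EFinD lee_fin addr_ge0 ?mulr_ge0 ?exprn_ge0.
  - apply: emeasurable_funD; first exact: measurable_cst.
    by apply: measurable_funeM; exact/measurable_EFinP.
  - apply: emeasurable_funD; last exact: measurable_cst.
    by apply/measurable_EFinP; exact: measurable_funX.
  - move=> w _; rewrite -EFinM -!EFinD lee_fin.
    by have := exprn_tangent q (normr_ge0 (u + V w)) (normr_ge0 u); rewrite -/y; nra.
have ma : measurable_fun setT (fun w => (q.+1%:R * y ^+ q)%:E * `|u + V w|%:E)%E.
  by apply: measurable_funeM; exact/measurable_EFinP.
have mb : measurable_fun setT (fun w => (`|u + V w| ^+ q.+1)%:E).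
  by apply/measurable_EFinP; exact: measurable_funX.
have e1 : (\int[P]_w ((y ^+ q.+1)%:E + (q.+1%:R * y ^+ q)%:E * `|u + V w|%:E) =
    (y ^+ q.+1)%:E + (q.+1%:R * y ^+ q)%:E * \int[P]_w `|u + V w|%:E)%E.
  rewrite ge0_integralD//.
  - rewrite integral_cst// [X in (_ * X + _)%E](@probability_setT _ _ _ P) mule1.
    by rewrite ge0_integralZl ?lee_fin//; exact/measurable_EFinP.
  - by move=> w _; rewrite lee_fin exprn_ge0.
  - by move=> w _; rewrite -EFinM lee_fin mulr_ge0.
have e2 : (\int[P]_w ((`|u + V w| ^+ q.+1)%:E + (q.+1%:R * y ^+ q * y)%:E) =
    \int[P]_w (`|u + V w| ^+ q.+1)%:E + (q.+1%:R * y ^+ q * y)%:E)%E.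
  rewrite ge0_integralD//.
  - by rewrite integral_cst// [X in (_ + _ * X)%E](@probability_setT _ _ _ P) mule1.
  - by move=> w _; rewrite lee_fin mulr_ge0.
rewrite e1 e2 in tan.
rewrite -(@leeD2rE _ (q.+1%:R * y ^+ q * y)%:E)//; apply: le_trans tan.
by rewrite leeD2l// EFinM lee_wpmul2l ?lee_fin//; exact: cV.
Qed.

End centered.

(** Balls around a dense sequence are made disjoint; [N] is the index of the cell and [e] its
    centre. Countably many cells allow conditioning by mere summation. *)
Lemma borel_discretization (R : realType) (E : normedModType R) (eps : R) :
  separable E -> 0 < eps ->
  exists (N : E -> nat) (e : nat -> E),
    (forall n, measurable ([set x | N x = n] : set (borel E))) /\
    forall x, `|x - e (N x)| < eps.
Proof.
move=> /separable_dense_seq[e [_ eP]] eps0.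
pose B n : set (borel E) := [set x : E | `|x - e n| < eps].
have mB n : measurable (B n).
  apply: sub_sigma_algebra.
  have -> : B n = ball (e n) eps.
    by apply/seteqP; split => x; rewrite -ball_normE /B /= distrC.
  exact: ball_open.
have /choice[N NP] : forall x, exists n, seqDU B n x.
  move=> x; have [n xn] := eP x eps eps0.
  have : (\bigcup_k B k) x by exists n.
  by rewrite seqDU_bigcup_eq => -[k _ xk]; exists k.
exists N, e; split => [n|x]; last by case: (NP x).
have -> : [set x | N x = n] = seqDU B n.
  apply/seteqP; split => [x /= <- //|x Bx /=].
  by have := @trivIset_seqDU _ B (N x) n I I; apply; exists x; split.
apply: measurableD => //; apply: bigsetU_measurable => k _; exact: mB.
Qed.

Section jensen.
Context d (Omega : measurableType d) (R : realType) (P : probability Omega R).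
Context (E : normedModType R) (sepE : separable E).
Context (I : choiceType) (D : set I) (xi : I -> Omega -> E).
Hypothesis mxi : forall i, D i -> measurable_fun setT (xi i : Omega -> borel E).
Hypothesis ixi : independent_on P D (fun i => (xi i : Omega -> borel E)).
Hypothesis cxi : forall i, D i -> centered P (xi i).

Lemma measurable_translate_norm_pow (u : E) q :
  measurable_fun setT ((fun x => (`|u + x| ^+ q)%:E) : borel E -> \bar R).
Proof.
apply/measurable_EFinP; apply: measurable_funX.
apply: continuous_borel_measurable_real => x.
by apply: cvg_norm; apply: cvgD; [exact: cvg_cst | exact: cvg_id].
Qed.

Let cyl (J : seq I) (B : I -> set E) : set Omega :=
  \bigcap_(i in [set` J]) (xi i @^-1` B i).

Lemma cyl_measurable (J : seq I) (B : I -> set E) : [set` J] `<=` D ->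
  (forall i, measurable (B i : set (borel E))) -> measurable (cyl J B).
Proof.
move=> JD mB; apply: fin_bigcap_measurable => [|i Ji]; first exact: finite_seq.
by rewrite -[X in measurable X]setTI; apply: mxi (JD _ Ji) measurableT _ (mB i).
Qed.

Lemma cyl_indep (j : I) (J : seq I) (B : I -> set E) (C : set E) :
  uniq (j :: J) -> [set` j :: J] `<=` D ->
  (forall i, measurable (B i : set (borel E))) ->
  measurable (C : set (borel E)) ->
  P (cyl J B `&` xi j @^-1` C) = (P (cyl J B) * P (xi j @^-1` C))%E.
Proof.
move=> uJ JD mB mC; have /andP[jJ uJ'] := uJ.
pose B' i := if i == j then C else B i.
have BB' i : i \in J -> B' i = B i.
  by move=> iJ; rewrite /B'; case: eqP => // ij; move: jJ; rewrite -ij iJ.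
have JD' : [set` J] `<=` D by move=> i iJ; apply: JD; rewrite /= inE iJ orbT.
have := ixi uJ JD (B := B').
have := ixi uJ' JD' mB.
have -> : \bigcap_(i in [set` j :: J]) (xi i @^-1` B' i) =
    cyl J B `&` xi j @^-1` C.
  apply/seteqP; split => [w H|w [H1 H2]].
    split => [i iJ|].
      by have := H i; rewrite /= inE iJ orbT BB'//; apply.
    by have := H j; rewrite /= inE eqxx /B' eqxx; apply.
  move=> i /=; rewrite inE => /predU1P[->|iJ]; first by rewrite /B' eqxx.
  by rewrite BB'//; exact: H1.
rewrite -/(cyl J B) => -> ->; last by move=> i; rewrite /B'; case: ifP.
rewrite big_cons muleC {2}/B' eqxx; congr (_ * _)%E.
by apply: eq_big_seq => i iJ; rewrite BB'.
Qed.

(** Induction on the discretized summands: the event is split by the cell of [xi i], on which the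
    term of i is a constant absorbed into u, and i joins the conditioning indices. In the end only
    the centred [xi j] is random, independent of the event. *)
Lemma discretized_jensen (N : E -> nat) (e : nat -> E) q (j : I) (A J : seq I)
    (B : I -> set E) (u : E) :
  (forall n, measurable ([set x | N x = n] : set (borel E))) ->
  uniq (j :: A ++ J) -> [set` j :: A ++ J] `<=` D ->
  (forall i, measurable (B i : set (borel E))) ->
  (\int[P]_(w in cyl J B) (`|u + \sum_(i <- A) e (N (xi i w))| ^+ q.+1)%:E <=
   \int[P]_(w in cyl J B)
     (`|u + \sum_(i <- A) e (N (xi i w)) + xi j w| ^+ q.+1)%:E)%E.
Proof.
move=> mN; elim: A J B u => [|i A IH] J B u uJ JD mB.
  have Dj : D j by apply: JD; rewrite /= inE eqxx.
  have JD' : [set` J] `<=` D by move=> k kJ; apply: JD; rewrite /= inE kJ orbT.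
  under eq_integral do rewrite big_nil addr0.
  under [leRHS]eq_integral do rewrite big_nil addr0.
  have mF := cyl_measurable JD' mB.
  rewrite (@integral_independent_event _ _ _ P _ (borel E) (xi j) (cyl J B)
    (fun x => (`|u + x| ^+ q.+1)%:E))//.
  - rewrite integral_cst// muleC lee_wpmul2l//.
    exact: centered_pow (mxi Dj) (cxi Dj).
  - exact: mxi.
  - exact: measurable_translate_norm_pow.
  - by move=> C mC; exact: cyl_indep.
have iD : D i by apply: JD; rewrite /= !inE eqxx orbT.
have uJ2 : uniq (j :: A ++ i :: J).
  have pe : perm_eq (j :: A ++ i :: J) (j :: (i :: A) ++ J).
    by rewrite perm_cons -[i :: J]cat1s perm_catCA.
  by rewrite (perm_uniq pe).
have JD2 : [set` j :: A ++ i :: J] `<=` D.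
  move=> k; rewrite /= inE mem_cat inE => kin; apply: JD => /=.
  by rewrite !inE mem_cat; case/or4P: kin => ->; rewrite ?orbT.
pose B_ m k := if k == i then [set x | N x = m] else B k.
have iJ : i \notin J.
  move: uJ => /= /andP[_ /andP[]]; rewrite mem_cat negb_or => /andP[].
  by [].
have mB_ m k : measurable (B_ m k : set (borel E)) by rewrite /B_; case: ifP.
have cylE m : cyl (i :: J) (B_ m) = cyl J B `&` xi i @^-1` [set x | N x = m].
  apply/seteqP; split => w.
    move=> H; split => [k kJ|].
      have := H k; rewrite /= inE kJ orbT /B_; case: eqP => [ki|_]; last exact.
      by move: iJ; rewrite -ki kJ.
    by have := H i; rewrite /= inE eqxx /B_ eqxx; apply.
  move=> [H1 H2] k; rewrite /= inE /B_ => /predU1P[->|kJ]; first by rewrite eqxx.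
  by case: eqP => [->//|_]; exact: H1.
have JDi : [set` i :: J] `<=` D.
  move=> k; rewrite /= inE => kin; apply: JD2; rewrite /= !inE mem_cat inE.
  by rewrite kin !orbT.
have cup : cyl J B = \bigcup_m cyl (i :: J) (B_ m).
  apply/seteqP; split => [w Hw|w [m _]]; last by rewrite cylE => -[].
  by exists (N (xi i w)) => //; rewrite cylE.
have mS (V : Omega -> E) : measurable_fun setT (V : Omega -> borel E) ->
    measurable_fun setT (fun w => (`|u + V w| ^+ q.+1)%:E).
  by move=> mV; exact: (measurableT_comp (measurable_translate_norm_pow u _) mV).
have meN k : D k -> measurable_fun setT ((fun w => e (N (xi k w))) : Omega -> borel E).
  move=> Dk; apply: (measurableT_comp (f := fun x : borel E => (e (N x) : borel E)) _ (mxi Dk)).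
  move=> _ C mC; rewrite setTI (_ : _ @^-1` _ =
    \bigcup_(m in [set m | C (e m)]) [set x | N x = m]).
    exact: bigcup_measurable.
  apply/seteqP; split => x /=; first by move=> Cx; exists (N x).
  by move=> [m Cm /= ->].
have mA : measurable_fun setT
    ((fun w => \sum_(k <- i :: A) e (N (xi k w))) : Omega -> borel E).
  have AD : {subset i :: A <= [pred k | `[< D k >]]}.
    move=> k kA; apply/asboolP; apply: JD; rewrite /= inE -cat_cons mem_cat.
    by rewrite kA orbT.
  elim: (i :: A) AD => [|k s IHs] sD.
    by under eq_fun do rewrite big_nil; exact: measurable_cst.
  under eq_fun do rewrite big_cons; apply: borel_measurableD => //.
    by apply: meN; apply/asboolP; apply: sD; rewrite inE eqxx.
  by apply: IHs => l ls; apply: sD; rewrite inE ls orbT.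
have Dj : D j by apply: JD; rewrite /= inE eqxx.
have mAj := borel_measurableD sepE mA (mxi Dj).
have tri : trivIset setT (fun m => cyl (i :: J) (B_ m)).
  move=> m m' _ _ [w []]; rewrite !cylE => -[_ /= <-] [_ /= <-].
  by [].
have mcyl m : measurable (cyl (i :: J) (B_ m)) by exact: cyl_measurable.
have mcup := bigcup_measurable (fun m (_ : setT m) => mcyl m).
have mSj : measurable_fun setT (fun w =>
    (`|u + \sum_(k <- i :: A) e (N (xi k w)) + xi j w| ^+ q.+1)%:E).
  by under eq_fun do rewrite -addrA; exact: mS mAj.
rewrite cup !ge0_integral_bigcup//; last 2 first.
- exact: measurable_funTS mSj.
- exact: measurable_funTS (mS _ mA).
apply: lee_nneseries => [m _ _|m _].
  by apply: integral_ge0 => w _; rewrite lee_fin exprn_ge0.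
have := IH (i :: J) (B_ m) (u + e m) uJ2 JD2 (mB_ m).
congr (_ <= _)%E; apply: eq_integral => w; rewrite inE cylE => -[_ /= Nm];
  by rewrite big_cons Nm addrA.
Qed.

End jensen.

(** Convexity applied to g + eta = (1-eta) g + eta (g+1): the perturbation costs only a factor and a
    constant that vanish with eta. *)
Lemma integral_pow_perturb d (Omega : measurableType d) (R : realType)
    (P : probability Omega R) (f g : Omega -> R) (eta : R) q :
  measurable_fun setT f -> measurable_fun setT g ->
  (forall w, 0 <= f w) -> (forall w, 0 <= g w) ->
  0 <= eta -> eta <= 1 -> (forall w, f w <= g w + eta) ->
  (\int[P]_w (f w ^+ q.+1)%:E <=
   (1 + eta * 2 ^+ q.+1)%:E * \int[P]_w (g w ^+ q.+1)%:E +
   (eta * 2 ^+ q.+1)%:E)%E.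
Proof.
move=> mf mg f0 g0 eta0 eta1 fg.
have c0 : 0 <= eta * 2 ^+ q.+1 by rewrite mulr_ge0// exprn_ge0.
have mgq : measurable_fun setT (fun w => (g w ^+ q.+1)%:E).
  by apply/measurable_EFinP; exact: measurable_funX.
have gq0 w : 0 <= g w ^+ q.+1 by exact: exprn_ge0.
apply: (@le_trans _ _ (\int[P]_w ((1 + eta * 2 ^+ q.+1)%:E * (g w ^+ q.+1)%:E +
    (eta * 2 ^+ q.+1)%:E)))%E.
  apply: ge0_le_integral => //.
  - by move=> w _; rewrite lee_fin exprn_ge0.
  - by apply/measurable_EFinP; exact: measurable_funX.
  - by apply: emeasurable_funD; [exact: measurable_funeM|exact: measurable_cst].
  - move=> w _; rewrite -EFinM -EFinD lee_fin.
    have h1 : f w ^+ q.+1 <= (g w + eta) ^+ q.+1.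
      by rewrite lerXn2r ?nnegrE ?addr_ge0.
    have h2 : (g w + eta) ^+ q.+1 <=
        (1 - eta) * g w ^+ q.+1 + eta * (g w + 1) ^+ q.+1.
      have := @exprn_jensen R bool [:: true; false]
        (fun b => if b then 1 - eta else eta) (fun b => if b then g w else g w + 1) q.
      rewrite !big_cons !big_nil !addr0.
      rewrite (_ : (1 - eta) * g w + eta * (g w + 1) = g w + eta); last by ring.
      apply; last by lra.
      - by case; rewrite ?subr_ge0.
      - by case; rewrite // addr_ge0.
    have h3 : (g w + 1) ^+ q.+1 <= 2 ^+ q.+1 * (g w ^+ q.+1 + 1 ^+ q.+1).
      exact: ler_exprnD.
    rewrite expr1n in h3.
    have h4 := ler_wpM2l eta0 h3.
    by have := mulr_ge0 eta0 (gq0 w); nra.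
rewrite ge0_integralD//.
- rewrite integral_cst// [X in (_ + _ * X)%E](@probability_setT _ _ _ P) mule1.
  rewrite ge0_integralZl//; first by move=> w _; rewrite lee_fin.
  by rewrite lee_fin addr_ge0.
- by move=> w _; rewrite -EFinM lee_fin mulr_ge0 ?addr_ge0.
- exact: measurable_funeM.
Qed.

(** The shape of two perturbations applied one after the other; for finite y the total excess is at
    most c (3y+3). *)
Lemma lee_addgt0_mul (R : realType) (x y : \bar R) :
  (0 <= x)%E -> (0 <= y)%E ->
  (forall c : R, 0 < c -> c <= 1 ->
    (x <= (1 + c)%:E * ((1 + c)%:E * y + c%:E) + c%:E)%E) -> (x <= y)%E.
Proof.
move=> x0 y0 H; have [->|] := eqVneq y +oo%E; first exact: leey.
rewrite -ltey => yfin; have /fineK <- : y \is a fin_num by rewrite ge0_fin_numE.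
set b := fine y; have b0 : 0 <= b by exact: fine_ge0.
have yb : y = b%:E by rewrite /b fineK// ge0_fin_numE.
apply/lee_addgt0Pr => e e0.
have k0 : 0 < 3 * b + 3 by lra.
pose c := Num.min 1 (e / (3 * b + 3)).
have c0 : 0 < c by rewrite lt_min ltr01 divr_gt0.
have c1 : c <= 1 by rewrite ge_min lexx.
have ce : c * (3 * b + 3) <= e by rewrite -ler_pdivlMr// ge_min lexx orbT.
apply: le_trans (H c c0 c1) _.
rewrite yb -[leLHS]/(((1 + c) * ((1 + c) * b + c) + c)%:E) -EFinD lee_fin.
have h : c * c * b <= c * b by rewrite ler_wpM2r// ler_piMl// ltW.
have h' : c * c <= c by rewrite ler_piMl// ltW.
by nra.
Qed.

(** * Symmetrization and moments of sums in type 2 *)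

Section symmetrization.
Context d (Omega : measurableType d) (R : realType) (P : probability Omega R).
Context (E : normedModType R) (sepE : separable E).
Context (I : choiceType) (D : set I).

Definition indep_centered (xi : I -> Omega -> E) : Prop :=
  [/\ forall i, D i -> measurable_fun setT (xi i : Omega -> borel E),
      independent_on P D (fun i => (xi i : Omega -> borel E)) &
      forall i, D i -> centered P (xi i)].

Let sum_measurable xi (s : seq I) : indep_centered xi -> [set` s] `<=` D ->
  measurable_fun setT ((fun w => \sum_(i <- s) xi i w) : Omega -> borel E).
Proof.
move=> [mxi _ _]; elim: s => [|i s IH] sD.
  by under eq_fun do rewrite big_nil; exact: measurable_cst.
under eq_fun do rewrite big_cons; apply: borel_measurableD => //.
  by apply: mxi; apply: sD; rewrite /= inE eqxx.
by apply: IH => j js; apply: sD; rewrite /= inE js orbT.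
Qed.

Let norm_pow_measurable (V : Omega -> E) q :
  measurable_fun setT (V : Omega -> borel E) ->
  measurable_fun setT (fun w => (`|V w| ^+ q)%:E).
Proof.
move=> mV; apply/measurable_EFinP; apply: measurable_funX.
exact: borel_measurable_norm.
Qed.

(** The inequality is proved for discretized summands and transferred by two perturbations, from the
    sum to its discretization and back. *)
Lemma sum_jensen xi q (j : I) (s : seq I) : indep_centered xi ->
  uniq (j :: s) -> [set` j :: s] `<=` D ->
  (\int[P]_w (`|\sum_(i <- s) xi i w| ^+ q.+1)%:E <=
   \int[P]_w (`|\sum_(i <- s) xi i w + xi j w| ^+ q.+1)%:E)%E.
Proof.
move=> fam us sD; have [mxi ixi cxi] := fam.
have sD' : [set` s] `<=` D by move=> i si; apply: sD; rewrite /= inE si orbT.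
have Dj : D j by apply: sD; rewrite /= inE eqxx.
apply: lee_addgt0_mul => [||c c0 c1].
- by apply: integral_ge0 => w _; rewrite lee_fin exprn_ge0.
- by apply: integral_ge0 => w _; rewrite lee_fin exprn_ge0.
(* This choice turns the error factor eta 2^(q+1) of [integral_pow_perturb] into c; [eps]
   distributes eta over the summands. *)
pose eta := c / 2 ^+ q.+1.
have p0 : 0 < 2 ^+ q.+1 :> R by rewrite exprn_gt0.
have etac : eta * 2 ^+ q.+1 = c by rewrite /eta divfK// gt_eqF.
have eta0 : 0 < eta by rewrite divr_gt0.
have eta1 : eta <= 1.
  rewrite /eta ler_pdivrMr// mul1r (le_trans c1)//.
  by rewrite exprn_ege1// ler1n.
pose eps := eta / (size s).+1%:R.
have eps0 : 0 < eps by rewrite divr_gt0.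
have [N [e [mN Ne]]] := borel_discretization sepE eps0.
pose U w := \sum_(i <- s) xi i w.
pose Ud w := \sum_(i <- s) e (N (xi i w)).
have UUd w : `|U w - Ud w| <= eta.
  rewrite /U /Ud -sumrB (le_trans (ler_norm_sum _ _ _))//.
  apply: (@le_trans _ _ (\sum_(i <- s) eps)).
    by apply: ler_sum => i _; exact: ltW.
  rewrite big_const_seq count_predT iter_addr_0 -mulr_natr /eps -mulrA.
  by rewrite ler_piMr ?(ltW eta0)// mulrC ler_pdivrMr// mul1r ler_nat.
have mU : measurable_fun setT (U : Omega -> borel E) by exact: sum_measurable.
have mUj := borel_measurableD sepE mU (mxi _ Dj).
have mUd : measurable_fun setT (Ud : Omega -> borel E).
  rewrite /Ud; elim: (s) sD' => [|i t IH] tD.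
    by under eq_fun do rewrite big_nil; exact: measurable_cst.
  under eq_fun do rewrite big_cons; apply: borel_measurableD => //; last first.
    by apply: IH => k kt; apply: tD; rewrite /= inE kt orbT.
  have Di : D i by apply: tD; rewrite /= inE eqxx.
  apply: (measurableT_comp (f := fun x : borel E => (e (N x) : borel E)) _ (mxi _ Di)).
  move=> _ C mC; rewrite setTI (_ : _ @^-1` _ =
    \bigcup_(m in [set m | C (e m)]) [set x | N x = m]).
    exact: bigcup_measurable.
  apply/seteqP; split => x /=; first by move=> Cx; exists (N x).
  by move=> [m Cm /= ->].
have mUdj := borel_measurableD sepE mUd (mxi _ Dj).
have step1 : (\int[P]_w (`|U w| ^+ q.+1)%:E <=
    (1 + c)%:E * \int[P]_w (`|Ud w| ^+ q.+1)%:E + c%:E)%E.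
  have := @integral_pow_perturb _ Omega R P (fun w => `|U w|) (fun w => `|Ud w|) eta q.
  rewrite etac; apply => //; [exact: borel_measurable_norm..|exact: ltW|].
  by move=> w; rewrite -lerBlDl (le_trans _ (UUd w))// lerB_dist.
have step3 : (\int[P]_w (`|Ud w + xi j w| ^+ q.+1)%:E <=
    (1 + c)%:E * \int[P]_w (`|U w + xi j w| ^+ q.+1)%:E + c%:E)%E.
  have := @integral_pow_perturb _ Omega R P
    (fun w => `|Ud w + xi j w|) (fun w => `|U w + xi j w|) eta q.
  rewrite etac; apply => //; [exact: borel_measurable_norm..|exact: ltW|].
  move=> w; rewrite -lerBlDl (le_trans _ (UUd w))// [leRHS]distrC.
  by rewrite (le_trans (lerB_dist _ _))// opprD addrACA subrr addr0.
have step2 : (\int[P]_w (`|Ud w| ^+ q.+1)%:E <=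
    \int[P]_w (`|Ud w + xi j w| ^+ q.+1)%:E)%E.
  have := @discretized_jensen _ _ _ P _ sepE _ D xi mxi ixi cxi N e q j s [::]
    (fun=> setT) 0 mN; rewrite cats0 => /(_ us sD (fun _ => measurableT)).
  rewrite set_nil bigcap_set0.
  by under eq_integral do rewrite add0r; under [X in (_ <= X)%E]eq_integral do rewrite add0r.
have c10 : (0 <= (1 + c)%:E)%E by rewrite lee_fin addr_ge0// ltW.
apply: le_trans step1 _; rewrite leeD2r// lee_wpmul2l//.
exact: le_trans step2 step3.
Qed.

Lemma sum_jensen_cat xi q (s t : seq I) : indep_centered xi ->
  uniq (s ++ t) -> [set` s ++ t] `<=` D ->
  (\int[P]_w (`|\sum_(i <- s) xi i w| ^+ q.+1)%:E <=
   \int[P]_w (`|\sum_(i <- s ++ t) xi i w| ^+ q.+1)%:E)%E.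
Proof.
move=> fam; elim: t => [|j t IH] ust stD; first by rewrite cats0.
have pe : perm_eq (s ++ j :: t) (j :: s ++ t) by rewrite perm_sym -cat1s perm_catCA.
have ust' : uniq (j :: s ++ t) by rewrite -(perm_uniq pe).
have stD' : [set` j :: s ++ t] `<=` D.
  by move=> i /= ij; apply: stD; rewrite /= (perm_mem pe).
apply: le_trans (IH _ _) _; first by case/andP: ust'.
  by move=> i ist; apply: stD'; rewrite /= inE ist orbT.
apply: le_trans (sum_jensen q fam ust' stD') _.
rewrite le_eqVlt; apply/orP; left; apply/eqP; apply: eq_integral => w _.
by rewrite (perm_big _ pe)/= big_cons addrC.
Qed.

Lemma family_sign xi (e : I -> R) : (forall i, e i = 1 \/ e i = -1) ->
  indep_centered xi -> indep_centered (fun i w => e i *: xi i w).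
Proof.
move=> e1 [mxi ixi cxi]; split.
- by move=> i Di; apply: borel_measurableZ; exact: mxi.
- move=> J B uJ JD mB.
  have := ixi J (fun i => ( *:%R (e i)) @^-1` B i) uJ JD; apply => i.
  rewrite -[X in measurable X]setTI.
  have := @continuous_borel_measurable _ _ _ ( *:%R (e i) : E -> E)
    (@scaler_continuous _ _ (e i)) measurableT _ (mB i).
  exact.
- move=> i Di u; case: (e1 i) => ->.
    by under eq_integral do rewrite scale1r; exact: cxi.
  apply: le_trans (_ : (_ <= `|- u|%:E)%E) _; first by rewrite normrN.
  apply: le_trans (cxi i Di (- u)) _.
  rewrite le_eqVlt; apply/orP; left; apply/eqP; apply: eq_integral => w _.
  by rewrite scaleN1r -normrN opprD opprK.
Qed.

(** The sum equals the signed partial sum over the positive signs minus the one over the negative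
    signs, and each is dominated by the complete signed sum through [sum_jensen_cat]. Two terms and
    the factor 2^(q+1) give 2^(q+2). *)
Lemma sum_sign xi (e : I -> R) q (s : seq I) : (forall i, e i = 1 \/ e i = -1) ->
  indep_centered xi -> uniq s -> [set` s] `<=` D ->
  (\int[P]_w (`|\sum_(i <- s) xi i w| ^+ q.+1)%:E <=
   (2 ^+ q.+2)%:E *
   \int[P]_w (`|\sum_(i <- s) e i *: xi i w| ^+ q.+1)%:E)%E.
Proof.
move=> e1 fam us sD; have fam' := family_sign e1 fam.
pose A := [seq i <- s | e i == 1]; pose B := [seq i <- s | e i != 1].
have AB : perm_eq (A ++ B) s by exact: permEl (perm_filterC _ _).
have BA : perm_eq (B ++ A) s by rewrite perm_catC.
have sub t : perm_eq t s -> uniq t /\ [set` t] `<=` D.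
  by move=> ts; rewrite (perm_uniq ts); split => // i /=; rewrite (perm_mem ts) => /sD.
have [uAB ABD] := sub _ AB; have [uBA BAD] := sub _ BA.
have hA := sum_jensen_cat q fam' uAB ABD; have hB := sum_jensen_cat q fam' uBA BAD.
have eAB t t' : perm_eq t t' ->
    (\int[P]_w (`|\sum_(i <- t) e i *: xi i w| ^+ q.+1)%:E =
    \int[P]_w (`|\sum_(i <- t') e i *: xi i w| ^+ q.+1)%:E)%E.
  by move=> tt; apply: eq_integral => w _; rewrite (perm_big _ tt).
rewrite (eAB _ _ AB) in hA; rewrite (eAB _ _ BA) in hB.
pose sA w := \sum_(i <- A) e i *: xi i w; pose sB w := \sum_(i <- B) e i *: xi i w.
have sAD : [set` A] `<=` D by move=> i iA; apply: ABD; rewrite /= mem_cat iA.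
have sBD : [set` B] `<=` D by move=> i iB; apply: BAD; rewrite /= mem_cat iB.
have mA : measurable_fun setT (fun w => (`|sA w| ^+ q.+1)%:E).
  by apply: norm_pow_measurable; exact: sum_measurable.
have mB : measurable_fun setT (fun w => (`|sB w| ^+ q.+1)%:E).
  by apply: norm_pow_measurable; exact: sum_measurable.
have p0 : 0 <= 2 ^+ q.+1 :> R by exact: exprn_ge0.
have xiAB w : \sum_(i <- s) xi i w = sA w - sB w.
  rewrite -(perm_big _ AB)/= big_cat/= /sA /sB -sumrN /A /B !big_filter.
  congr (_ + _); apply: eq_bigr => i; first by move=> /eqP ei; rewrite ei scale1r.
  by case: (e1 i) => ei; rewrite ei ?eqxx// scaleN1r opprK.
apply: (@le_trans _ _ (\int[P]_w ((2 ^+ q.+1)%:E *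
    ((`|sA w| ^+ q.+1)%:E + (`|sB w| ^+ q.+1)%:E)))%E).
  apply: ge0_le_integral => //.
  - by apply: norm_pow_measurable; exact: sum_measurable.
  - by apply: measurable_funeM; exact: emeasurable_funD.
  - move=> w _; rewrite -EFinD -EFinM lee_fin xiAB.
    apply: le_trans (ler_exprnD _ _ _) => //.
    by rewrite lerXn2r ?nnegrE ?addr_ge0// (le_trans (ler_normB _ _)).
rewrite ge0_integralZl//; last 2 first.
- exact: emeasurable_funD.
- by move=> w _; rewrite -EFinD lee_fin addr_ge0// exprn_ge0.
rewrite ge0_integralD//.
rewrite [2 ^+ q.+2]exprSr EFinM -muleA lee_wpmul2l ?lee_fin//.
apply: le_trans (leeD hA hB) _.
by rewrite -mule2n -mule_natl.
Qed.

Lemma rad_measurable (F : E -> R) (U : Omega -> E) xi (s : seq I) :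
  measurable_fun setT (F : borel E -> R) ->
  measurable_fun setT (U : Omega -> borel E) ->
  (forall i, D i -> measurable_fun setT (xi i : Omega -> borel E)) ->
  [set` s] `<=` D ->
  measurable_fun setT (fun w => rad F [seq xi i w | i <- s] (U w)).
Proof.
move=> mF mU mxi; elim: s U mU => [|i s IH] U mU sD.
  exact: (measurableT_comp mF mU).
have mi := mxi _ (sD i (mem_head i s)).
have sD' : [set` s] `<=` D by move=> j js; apply: sD; rewrite /= inE js orbT.
apply: measurable_funM; last exact: measurable_cst.
apply: measurable_funD; apply: IH => //; first exact: borel_measurableD.
exact: borel_measurableB.
Qed.

(** A lower bound valid for every deterministic sign vector passes to the mean over sign vectors,
    one coordinate at a time. *)
Lemma rad_integral_ge xi q (c : \bar R) (s : seq I) (U : Omega -> E) :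
  indep_centered xi -> uniq s -> [set` s] `<=` D ->
  measurable_fun setT (U : Omega -> borel E) ->
  (forall e : I -> R, (forall i, e i = 1 \/ e i = -1) ->
    (c <= \int[P]_w (`|U w + \sum_(i <- s) (e i *: xi i w)%R| ^+ q)%:E)%E) ->
  (c <= \int[P]_w (rad (fun x => `|x| ^+ q) [seq xi i w | i <- s] (U w))%:E)%E.
Proof.
move=> fam; have [mxi _ _] := fam; elim: s U => [|i s IH] U us sD mU H.
  have := H (fun=> 1) (fun=> or_introl erefl).
  by under eq_integral do rewrite big_nil addr0.
move: us => /= /andP[is_ us].
have mi := mxi _ (sD i (mem_head i s)).
have sD' : [set` s] `<=` D by move=> j js; apply: sD; rewrite /= inE js orbT.
have mFq : measurable_fun setT ((fun x => `|x| ^+ q) : borel E -> R).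
  apply: measurable_funX; apply: continuous_borel_measurable_real.
  exact: norm_continuous.
have half (sg : R) : sg = 1 \/ sg = -1 ->
   (c <= \int[P]_w (rad (fun x => `|x| ^+ q) [seq xi i w | i <- s]
      (U w + sg *: xi i w))%:E)%E.
  move=> sg1; apply: IH => //.
    by apply: borel_measurableD => //; exact: borel_measurableZ.
  (* The signs of the tail are extended by the sign already chosen at i; i does not occur in s. *)
  move=> e e1; pose e' j := if j == i then sg else e j.
  apply: le_trans (H e' _) _; first by move=> j; rewrite /e'; case: eqP.
  rewrite le_eqVlt; apply/orP; left; apply/eqP; apply: eq_integral => w _.
  rewrite big_cons /e' eqxx addrA; congr ((`|_ + _| ^+ _)%:E).
  apply: eq_big_seq => j js; case: eqP => // ji.
  by move: is_; rewrite -ji js.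
have hp := half 1 (or_introl erefl); have hm := half (-1) (or_intror erefl).
have r0 V w : 0 <= rad (fun x => `|x| ^+ q) [seq xi i w | i <- s] (V w).
  by apply: rad_ge0 => x; exact: exprn_ge0.
have e2 : (\int[P]_w (rad (fun x => `|x| ^+ q) [seq xi i w | i <- i :: s] (U w))%:E =
   (2^-1)%:E * (\int[P]_w (rad (fun x => `|x| ^+ q) [seq xi i w | i <- s]
      (U w + 1 *: xi i w))%:E + \int[P]_w (rad (fun x => `|x| ^+ q)
      [seq xi i w | i <- s] (U w + (-1) *: xi i w))%:E))%E.
  rewrite -ge0_integralD//; last 4 first.
  - by move=> w _; rewrite lee_fin; exact: (r0 (fun w => U w + 1 *: xi i w)).
  - apply/measurable_EFinP; apply: rad_measurable => //.
    by apply: borel_measurableD => //; exact: borel_measurableZ.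
  - by move=> w _; rewrite lee_fin; exact: (r0 (fun w => U w + (-1) *: xi i w)).
  - apply/measurable_EFinP; apply: rad_measurable => //.
    by apply: borel_measurableD => //; exact: borel_measurableZ.
  rewrite -ge0_integralZl//; last 2 first.
  - apply/measurable_EFinP; apply: measurable_funD; apply: rad_measurable => //;
      by apply: borel_measurableD => //; exact: borel_measurableZ.
  - move=> w _; rewrite -EFinD lee_fin addr_ge0//.
      exact: (r0 (fun w => U w + 1 *: xi i w)).
    exact: (r0 (fun w => U w + (-1) *: xi i w)).
  apply: eq_integral => w _; rewrite -EFinD -EFinM; congr EFin.
  by rewrite /= scale1r scaleN1r mulrC.
have -> : c = ((2^-1)%:E * (c + c))%E.
  by rewrite -mule2n -mule_natl muleA -EFinM mulVf// mul1e.
by rewrite e2 lee_wpmul2l ?lee_fin// leeD.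
Qed.

End symmetrization.

Lemma sum_exprn_le (R : realType) (I : Type) (s : seq I) (b : I -> R) m :
  (forall i, 0 <= b i) ->
  (\sum_(i <- s) b i) ^+ m.+1 <= (size s)%:R ^+ m * \sum_(i <- s) b i ^+ m.+1.
Proof.
move=> b0; have [s0|sn0] := posnP (size s).
  by rewrite (size0nil s0) !big_nil expr0n mulr0.
have n0 : 0 < (size s)%:R :> R by rewrite ltr0n.
have w0 (i : I) : 0 <= (size s)%:R^-1 :> R by rewrite invr_ge0.
have w1 : \sum_(i <- s) (size s)%:R^-1 <= 1 :> R.
  by rewrite big_const_seq count_predT iter_addr_0 -(mulr_natr (_^-1)) mulVf ?gt_eqF.
have := exprn_jensen m w0 b0 w1; rewrite -!big_distrr/= exprMn => H.
have := ler_wpM2l (exprn_ge0 m.+1 (ltW n0)) H.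
rewrite mulrA -exprMn mulfV ?gt_eqF// expr1n mul1r => /le_trans; apply.
by rewrite mulrA exprSr mulfK ?gt_eqF.
Qed.

(** Symmetrization, then the Rademacher moment bound for fixed values of the summands. The power
    (m+1) of the quadratic sum costs n^m, and the n summands bring the last factor n. The constant
    precedes the spaces and families, so it serves all levels at once. *)
Lemma type2_sum_moment (R : realType) (E : normedModType R) m :
  separable E -> has_type E 2 ->
  exists2 C : R, 0 <= C & forall (d : measure_display) (Omega : measurableType d)
    (P : probability Omega R) (I : choiceType) (D : set I)
    (xi : I -> Omega -> E) (s : seq I) (A : R),
    indep_centered P D xi -> uniq s -> [set` s] `<=` D ->
    (forall i, i \in s -> (\int[P]_w (`|xi i w| ^+ (m.+1 * 2))%:E <= A%:E)%E) ->
    (\int[P]_w (`|\sum_(i <- s) xi i w| ^+ (m.+1 * 2))%:E <=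
      (C * (size s)%:R ^+ m.+1 * A)%:E)%E.
Proof.
move=> sepE /type2_rad[K K0 HK]; have [C C0 HC] := rad_moment m HK.
pose q := (m * 2).+1; have qE : (m.+1 * 2)%N = q.+1 by [].
have p0 : 0 < 2 ^+ q.+2 :> R by rewrite exprn_gt0.
exists (2 ^+ q.+2 * C); first by rewrite mulr_ge0// ltW.
move=> d Omega P I D xi s A fam us sD hA; have [mxi _ _] := fam.
set c := (\int[P]_w _)%E; set n := (size s)%:R.
have mxiq i : i \in s -> measurable_fun setT (fun w => `|xi i w| ^+ (m.+1 * 2)).
  by move=> si; apply: measurable_funX; apply: borel_measurable_norm; exact/mxi/sD.
have H1 : ((2 ^+ q.+2)^-1%:E * c <=
    \int[P]_w (rad (fun x => `|x| ^+ (m.+1 * 2)) [seq xi i w | i <- s] 0)%:E)%E.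
  apply: (rad_integral_ge sepE fam us sD) => [|e e1]; first exact: measurable_cst.
  under eq_integral do rewrite add0r.
  rewrite lee_pdivrMl//; exact: (@sum_sign _ _ _ _ _ sepE _ _ _ _ q _ e1 fam us sD).
have [mS HS] : measurable_fun setT (fun w => \sum_(i <- s) `|xi i w| ^+ (m.+1 * 2)) /\
    (\int[P]_w (\sum_(i <- s) `|xi i w| ^+ (m.+1 * 2))%:E <= (n * A)%:E)%E.
  rewrite /n; elim: (s) mxiq hA => [|i t IH] mt ht.
    split; first by under eq_fun do rewrite big_nil; exact: measurable_cst.
    by under eq_integral do rewrite big_nil; rewrite integral0 mul0r.
  have [|k kt|mt' ht'] := IH; first by move=> k kt; apply: mt; rewrite inE kt orbT.
    by apply: ht; rewrite inE kt orbT.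
  have mi := mt i (mem_head i t); split.
    by under eq_fun do rewrite big_cons; exact: measurable_funD.
  under eq_integral do rewrite big_cons EFinD.
  rewrite ge0_integralD//.
  - rewrite /= -natr1 mulrDl mul1r addrC EFinD leeD//; exact: ht (mem_head i t).
  - exact/measurable_EFinP.
  - by move=> w _; rewrite lee_fin sumr_ge0// => k _; rewrite exprn_ge0.
  - exact/measurable_EFinP.
have Cn0 : 0 <= C * n ^+ m by rewrite mulr_ge0// exprn_ge0.
have H2 : (\int[P]_w (rad (fun x => `|x| ^+ (m.+1 * 2)) [seq xi i w | i <- s] 0)%:E
    <= \int[P]_w ((C * n ^+ m)%:E * (\sum_(i <- s) `|xi i w| ^+ (m.+1 * 2))%:E))%E.
  apply: ge0_le_integral => //.
  - by move=> w _; rewrite lee_fin; apply: rad_ge0 => x; exact: exprn_ge0.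
  - apply/measurable_EFinP; apply: (rad_measurable sepE) mxi sD => //.
    apply: measurable_funX; apply: continuous_borel_measurable_real.
    exact: norm_continuous.
  - by apply: measurable_funeM; exact/measurable_EFinP.
  - move=> w _; rewrite -EFinM lee_fin (le_trans (HC _))// -mulrA ler_wpM2l//.
    rewrite big_map (le_trans (sum_exprn_le _ _ _))//.
    rewrite le_eqVlt; apply/orP; left; apply/eqP; congr (_ * _).
    by apply: eq_bigr => i _; rewrite -exprM mulnC.
have sum0 w : 0 <= \sum_(i <- s) `|xi i w| ^+ (m.+1 * 2).
  by apply: sumr_ge0 => i _; exact: exprn_ge0.
have eZ : (\int[P]_w ((C * n ^+ m)%:E * (\sum_(i <- s) `|xi i w| ^+ (m.+1 * 2))%:E) =
    (C * n ^+ m)%:E * \int[P]_w (\sum_(i <- s) `|xi i w| ^+ (m.+1 * 2))%:E)%E.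
  by rewrite ge0_integralZl//; do ?[exact/measurable_EFinP |
    by move=> w _; rewrite lee_fin | by rewrite lee_fin].
rewrite eZ in H2.
have H3 := le_trans (le_trans H1 H2) (lee_wpmul2l _ HS).
rewrite lee_pdivrMl// in H3; apply: le_trans (H3 _) _; first by rewrite lee_fin.
rewrite -!EFinM lee_fin le_eqVlt; apply/orP; left; apply/eqP.
by rewrite [n ^+ m.+1]exprS; ring.
Qed.

(** * Bochner integral *)

Lemma finite_set_uniqP (S : choiceType) (A : set S) : finite_set A ->
  exists2 s : seq S, uniq s & A = [set` s].
Proof.
move=> /finite_seqP[s ->]; exists (undup s); first exact: undup_uniq.
by apply/seteqP; split => x /=; rewrite mem_undup.
Qed.

Section finite_range.
Context d (Omega : measurableType d) (R : realType) (P : probability Omega R).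
Context (S : choiceType) (sg : Omega -> S).
Hypothesis msg : forall x, measurable (sg @^-1` [set x]).
Variable X : seq S.
Hypotheses (uX : uniq X) (sgX : forall w, sg w \in X).

Let p x : R := fine (P (sg @^-1` [set x])).

Let pE x : P (sg @^-1` [set x]) = (p x)%:E.
Proof. by rewrite fineK// fin_num_measure. Qed.

Let p0 x : 0 <= p x. Proof. exact: fine_ge0. Qed.

Lemma integral_finite_range (G : S -> R) : (forall x, 0 <= G x) ->
  (\int[P]_w (G (sg w))%:E = (\sum_(x <- X) p x * G x)%:E)%E.
Proof.
move=> G0.
transitivity (\int[P]_w \sum_(x <- X) ((G x)%:E * (\1_(sg @^-1` [set x]) w)%:E))%E.
  apply: eq_integral => w _; rewrite (bigD1_seq (sg w))//=.
  rewrite indicE mem_set// mule1 big1 ?adde0// => x xw.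
  rewrite indicE memNset ?mule0//= => wx; by move: xw; rewrite wx eqxx.
rewrite ge0_integral_sum//; last 2 first.
- move=> x; apply: measurable_funeM; apply/measurable_EFinP.
  exact: measurable_indic.
- by move=> x w _; rewrite -EFinM lee_fin mulr_ge0.
rewrite -sumEFin; apply: eq_bigr => x _.
rewrite ge0_integralZl//; do ?[by rewrite lee_fin | by move=> w _; rewrite lee_fin
  | by apply/measurable_EFinP; exact: measurable_indic].
by rewrite integral_indic// setIT [X in (_ * X)%E](pE x) -EFinM mulrC.
Qed.

(** Summation runs over the values of [sg] instead of those of the composite, by regrouping the
    fibres of [phi]. Two simple maps can thus be integrated over their joint partition. *)
Lemma simple_integral_finite_range (V : normedModType R) (phi : S -> V) :
  simple_integral P (phi \o sg) = \sum_(x <- X) p x *: phi x.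
Proof.
have fsg : finite_set (range sg).
  apply: sub_finite_set (finite_seq X) => _ [w _ <-]; exact: sgX.
have fphi : finite_set (range (phi \o sg)).
  by rewrite -(image_comp sg phi); exact: finite_image.
have [W uW rW] := finite_set_uniqP fphi.
have Wphi w : phi (sg w) \in W.
  by have : range (phi \o sg) (phi (sg w)) by [exists w]; rewrite rW.
rewrite /simple_integral rW -fsbig_seq//=.
have Pv v : fine (P ((phi \o sg) @^-1` [set v])) = \sum_(x <- X | phi x == v) p x.
  have := @integral_finite_range (fun x => (phi x == v)%:R) (fun x => ler0n _ _).
  have -> : (\int[P]_w ((phi (sg w) == v)%:R)%:E = P ((phi \o sg) @^-1` [set v]))%E.
    have mv : measurable ((phi \o sg) @^-1` [set v]).
      exact: (@simple_map_preimage _ _ _ sg (phi @^-1` [set v]) fsg msg).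
    transitivity (\int[P]_w (\1_((phi \o sg) @^-1` [set v]) w)%:E)%E; last first.
      by rewrite integral_indic// setIT.
    apply: eq_integral => w _; rewrite indicE; congr ((nat_of_bool _)%:R%:E).
    by apply/idP/idP => [/eqP vE|/set_mem /= ->//]; rewrite mem_set.
  by move=> ->; rewrite /= [RHS]big_mkcond/=; apply: eq_bigr => x _; case: eqP;
    rewrite ?mulr1 ?mulr0.
under eq_bigr do rewrite Pv scaler_suml.
under eq_bigr do rewrite big_mkcond/=.
rewrite exchange_big/=; apply: eq_big_seq => x xX.
have [xW|xW] := boolP (phi x \in W).
  rewrite (bigD1_seq (phi x))//= eqxx big1 ?addr0// => v vx.
  by rewrite eq_sym (negbTE vx).
rewrite -big_mkcond/= big1_seq; last first.
  by move=> v /andP[/eqP <- vW]; move: xW; rewrite vW.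
(* Elements of X that are not attained have probability 0. *)
rewrite /p (_ : sg @^-1` [set x] = set0) ?measure0 ?scale0r//.
by apply/seteqP; split => // w /= wx; move: xW; rewrite -wx Wphi.
Qed.

Lemma sum_prob_finite_range : \sum_(x <- X) p x = 1.
Proof.
have := @integral_finite_range (fun=> 1) (fun=> ler01).
rewrite integral_cst// [X in (_ * X)%E](@probability_setT _ _ _ P) mule1 => -[->].
by apply: eq_bigr => x _; rewrite mulr1.
Qed.

Lemma simple_jensen_finite_range (V W : normedModType R) (phi phi' : S -> V)
    (L : {linear V -> W}) (u : W) :
  (`|u + L (simple_integral P (phi \o sg) - simple_integral P (phi' \o sg))|%:E <=
   \int[P]_w (`|u + L (phi (sg w) - phi' (sg w))|)%:E)%E.
Proof.
rewrite (@integral_finite_range (fun x => `|u + L (phi x - phi' x)|))//.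
rewrite lee_fin !simple_integral_finite_range -sumrB linear_sum/=.
have {1}-> : u = \sum_(x <- X) p x *: u.
  by rewrite -scaler_suml sum_prob_finite_range scale1r.
rewrite -big_split/= (le_trans (ler_norm_sum _ _ _))//.
apply: ler_sum => x _; rewrite -scalerBr linearZ/= -scalerDr normrZ.
by rewrite ger0_norm.
Qed.

End finite_range.

Section bochner.
Context d (Omega : measurableType d) (R : realType) (P : probability Omega R).

Lemma simple_jensen (V W : normedModType R) (s s' : Omega -> V)
    (L : {linear V -> W}) (u : W) : simple_map s -> simple_map s' ->
  (`|u + L (simple_integral P s - simple_integral P s')|%:E <=
   \int[P]_w (`|u + L (s w - s' w)|)%:E)%E.
Proof.
move=> [fs ms] [fs' ms']; have [f m] := simple_map_pair fs ms fs' ms'.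
have [X uX rX] := finite_set_uniqP f.
have sX w : (s w, s' w) \in X.
  by have : range (fun w => (s w, s' w)) (s w, s' w) by [exists w]; rewrite rX.
exact: (@simple_jensen_finite_range _ _ _ P _ _ m X uX sX V W fst snd L u).
Qed.

Lemma strongly_measurableN (V : normedModType R) (g : Omega -> V) :
  strongly_measurable g -> strongly_measurable (fun w => - g w).
Proof.
move=> [s sP sg]; exists (fun n w => - s n w) => [n|w]; first exact: simple_mapN.
exact: cvgN.
Qed.

Lemma simple_strongly_measurable (V : normedModType R) (s : Omega -> V) :
  simple_map s -> strongly_measurable s.
Proof. by move=> sP; exists (fun=> s) => // w; exact: cvg_cst. Qed.

Lemma enorm_measurable (V : normedModType R) (g : Omega -> V) :
  measurable_fun setT (g : Omega -> borel V) ->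
  measurable_fun setT (fun w => enorm (g w)).
Proof. by move=> mg; apply/measurable_EFinP; exact: borel_measurable_norm. Qed.

Lemma bounded_linear_continuous (V W : normedModType R) (L : {linear V -> W})
    (K : R) : 0 <= K -> (forall x, `|L x| <= K * `|x|) -> continuous L.
Proof.
move=> K0 LK x; apply/cvgrPdist_le => e e0.
have K1 : 0 < K + 1 by rewrite ltr_wpDl.
have de : 0 < e / (K + 1) by rewrite divr_gt0.
have /cvgrPdist_le/(_ _ de) Hx : y @[y --> x] --> x by exact: cvg_id.
near=> y; rewrite -linearB (le_trans (LK _))//.
have : `|x - y| <= e / (K + 1).
  by near: y; exact: Hx.
rewrite ler_pdivlMr// mulrC => /(le_trans _); apply.
by rewrite ler_wpM2r// lerDl.
Unshelve. all: by end_near. Qed.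

(** The form with a difference serves the level corrections and the bias directly; L is a Hoelder
    functional, and u makes the result an instance of [centered]. It passes from simple maps to
    their limits. *)
Lemma bochner_jensen (V W : normedModType R) (g g' : Omega -> V) (v v' : V)
    (L : {linear V -> W}) (K : R) (u : W) : 0 <= K ->
  (forall x, `|L x| <= K * `|x|) ->
  is_bochner_integral P g v -> is_bochner_integral P g' v' ->
  (`|u + L (v - v')|%:E <= \int[P]_w (`|u + L (g w - g' w)|)%:E)%E.
Proof.
move=> K0 LK [mg [s [sP sg sv]]] [mg' [s' [sP' sg' sv']]].
have cL : continuous (fun x => `|u + L x|).
  move=> x; apply: cvg_norm; apply: cvgD; first exact: cvg_cst.
  exact: (bounded_linear_continuous K0 LK).
have msub (h h' : Omega -> V) : strongly_measurable h -> strongly_measurable h' ->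
    measurable_fun setT ((fun w => h w - h' w) : Omega -> borel V).
  move=> mh mh'; apply: strongly_measurable_borel; apply: strongly_measurableD => //.
  exact: strongly_measurableN.
have mL (h h' : Omega -> V) : strongly_measurable h -> strongly_measurable h' ->
    measurable_fun setT (fun w => (`|u + L (h w - h' w)|)%:E).
  move=> mh mh'; apply/measurable_EFinP.
  exact: (measurableT_comp (continuous_borel_measurable_real cL) (msub _ _ mh mh')).
apply/lee_addgt0Pr => e e0.
have K4 : 0 < 4 * (K + 1) by rewrite mulr_gt0// ltr_wpDl.
(* Four errors of size K a arise: two from the simple integrals and two from the integrands. *)
pose a := e / (4 * (K + 1)); have a0 : 0 < a by rewrite divr_gt0.
have Ka : K * a * 4 <= e.
  have : a * (4 * (K + 1)) = e by rewrite /a divfK// gt_eqF.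
  by nra.
near \oo => n.
have h1 : `|v - simple_integral P (s n)| <= a.
  by near: n; move/cvgrPdist_le : sv; apply.
have h2 : `|v' - simple_integral P (s' n)| <= a.
  by near: n; move/cvgrPdist_le : sv'; apply.
have h3 : (\int[P]_w (enorm (g w - s n w)%R) <= a%:E)%E.
  apply/ltW; near: n; apply: (sg [set x | (x < a%:E)%E]).
  by apply: open_nbhs_nbhs; split; [exact: open_ereal_lt_ereal|rewrite /= lte_fin].
have h4 : (\int[P]_w (enorm (g' w - s' n w)%R) <= a%:E)%E.
  apply/ltW; near: n; apply: (sg' [set x | (x < a%:E)%E]).
  by apply: open_nbhs_nbhs; split; [exact: open_ereal_lt_ereal|rewrite /= lte_fin].
have ms := simple_strongly_measurable (sP n).
have ms' := simple_strongly_measurable (sP' n).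
have tri (x x' y y' : V) : `|u + L (x - x')| <=
    `|u + L (y - y')| + (K * `|x - y| + K * `|x' - y'|).
  have -> : u + L (x - x') = u + L (y - y') + (L (x - y) - L (x' - y')).
    rewrite -linearB -addrA -linearD; congr (_ + L _).
    by rewrite opprB addrA [y - y' + _]addrC !addrA !subrK.
  rewrite (le_trans (ler_normD _ _))// lerD2l (le_trans (ler_normB _ _))//.
  by rewrite lerD.
have step : (\int[P]_w (`|u + L (s n w - s' n w)|)%:E <=
   \int[P]_w (`|u + L (g w - g' w)|)%:E + (K%:E * a%:E + K%:E * a%:E))%E.
  apply: (@le_trans _ _ (\int[P]_w (`|u + L (g w - g' w)|%:E +
     (K%:E * enorm (g w - s n w)%R + K%:E * enorm (g' w - s' n w)%R)))%E).
    apply: ge0_le_integral => //.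
    - exact: mL.
    - apply: emeasurable_funD; first exact: mL.
      by apply: emeasurable_funD; apply: measurable_funeM; apply: enorm_measurable;
        exact: msub.
    - move=> w _; rewrite /enorm -!EFinM -!EFinD lee_fin.
      rewrite [ `|g w - _|]distrC [ `|g' w - _|]distrC; exact: tri.
  have mm (h h' : Omega -> V) : strongly_measurable h -> strongly_measurable h' ->
      measurable_fun setT (fun w => (K%:E * enorm (h w - h' w)%R)%E).
    move=> mh mh'; apply: measurable_funeM.
    exact: (enorm_measurable (msub _ _ mh mh')).
  have z0 (x : V) : (0 <= K%:E * enorm x)%E by rewrite mule_ge0// lee_fin.
  rewrite ge0_integralD//; do ?[exact: mL | by move=> w _; rewrite adde_ge0 |
    by apply: emeasurable_funD; exact: mm].
  rewrite leeD2l// ge0_integralD//; do ?[exact: mm].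
  rewrite !ge0_integralZl//; do ?[by rewrite lee_fin |
    by apply: enorm_measurable; exact: msub | by move=> w _; rewrite lee_fin].
  by rewrite leeD// lee_wpmul2l// lee_fin.
apply: (@le_trans _ _ ((`|u + L (simple_integral P (s n) - simple_integral P (s' n))| +
    (K * a + K * a))%:E)).
  rewrite lee_fin.
  apply: le_trans (tri v v' (simple_integral P (s n)) (simple_integral P (s' n))) _.
  by rewrite lerD2l lerD// ler_wpM2l.
rewrite EFinD; apply: le_trans (leeD (simple_jensen L u (sP n) (sP' n)) (lexx _)) _.
apply: le_trans (leeD step (lexx _)) _.
rewrite -addeA leeD2l// -!EFinM -!EFinD lee_fin; lra.
Unshelve. all: by end_near. Qed.

End bochner.

Section bochner_existence.
Context d (Omega : measurableType d) (R : realType) (P : probability Omega R).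

Lemma simple_map_cst (V : normedModType R) (v : V) :
  simple_map ((fun=> v) : Omega -> V).
Proof.
split; first by apply: sub_finite_set (finite_set1 v) => _ [w _ <-].
move=> x; have [<-|vx] := eqVneq v x.
  rewrite (_ : _ @^-1` _ = setT); first exact: measurableT.
  by apply/seteqP; split.
rewrite (_ : _ @^-1` _ = set0); first exact: measurable0.
by apply/seteqP; split => // w /= e; move: vx; rewrite e eqxx.
Qed.

Lemma is_bochner_integral0 (V : normedModType R) :
  is_bochner_integral P ((fun=> 0) : Omega -> V) 0.
Proof.
have s0 := simple_map_cst (0 : V).
split; first exact: simple_strongly_measurable.
exists (fun=> (fun=> 0)); split => //.
  under eq_fun do under eq_integral do rewrite subrr /enorm normr0.
  under eq_fun do rewrite integral0; exact: cvg_cst.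
suff -> : simple_integral P ((fun=> 0) : Omega -> V) = 0 by exact: cvg_cst.
rewrite /simple_integral fsbig1// => v [w _ <-].
by rewrite scaler0.
Qed.

(** The approximants satisfy |g - s_n| <= |g|, so dominated convergence applies with |g| itself; the
    simple integrals are then Cauchy. *)
Lemma is_bochner_integral_exists (V : completeNormedModType R) (g : Omega -> V) :
  separable V -> measurable_fun setT (g : Omega -> borel V) ->
  (\int[P]_w enorm (g w) < +oo)%E -> exists v, is_bochner_integral P g v.
Proof.
move=> sepV mg ig; have [s [sP sg sb]] := borel_simple_approx sepV mg.
have mgs n : measurable_fun setT (fun w => enorm (g w - s n w)).
  apply: enorm_measurable; apply: borel_measurableB => //.
  exact: simple_map_measurable.
have lim0 : (\int[P]_w (enorm (g w - s n w)%R))%E @[n --> \oo] --> 0%E.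
  have := @dominated_cvg _ _ _ P setT measurableT (fun n w => enorm (g w - s n w))
    (fun=> 0%E) (fun w => enorm (g w)) mgs.
  rewrite integral0; apply.
  - move=> w _; apply/fine_cvgP; split; first by apply: nearW.
    have := sg w => /cvgrPdist_le sgw; apply/cvgrPdist_le => e /sgw.
    by apply: filterS => n /= h; rewrite sub0r normrN normr_id.
  - by [].
  - apply/integrableP; split; first exact: enorm_measurable.
    by under eq_integral do rewrite gee0_abs ?lee_fin//.
  - by move=> n w _; rewrite gee0_abs lee_fin.
have small (e : R) : 0 < e -> \forall n \near \oo,
    (\int[P]_w (enorm (g w - s n w)%R) <= e%:E)%E.
  move=> e0; have : \forall n \near \oo, (\int[P]_w (enorm (g w - s n w)%R) < e%:E)%E.
    apply: (lim0 [set x | (x < e%:E)%E]).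
    by apply: open_nbhs_nbhs; split; [exact: open_ereal_lt_ereal|rewrite /= lte_fin].
  by apply: filterS => n /ltW.
have dist n m : (`|simple_integral P (s n) - simple_integral P (s m)|%:E <=
    \int[P]_w (enorm (g w - s n w)%R) + \int[P]_w (enorm (g w - s m w)%R))%E.
  have := simple_jensen P (idfun : {linear V -> V}) 0 (sP n) (sP m).
  rewrite add0r /= => /le_trans; apply.
  rewrite -ge0_integralD//; do ?[by move=> w _; rewrite lee_fin].
  apply: ge0_le_integral => //.
  - apply/measurable_EFinP.
    under eq_fun do rewrite add0r; apply: borel_measurable_norm.
    by apply: borel_measurableB => //; exact: simple_map_measurable.
  - exact: emeasurable_funD.
  - move=> w _; rewrite add0r -EFinD lee_fin.
    have -> : s n w - s m w = (g w - s m w) - (g w - s n w).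
      by rewrite opprB [RHS]addrC addrA subrK.
    by rewrite (le_trans (ler_normB _ _))// addrC.
have : cvg (simple_integral P (s n) @[n --> \oo]).
  apply: cauchy_cvg; apply: cauchy_exP => e e0.
  have e2 : 0 < e / 3 by rewrite divr_gt0.
  have [n0 _ n0P] := small _ e2.
  exists (simple_integral P (s n0)); exists n0 => // k /= n0k.
  rewrite -ball_normE /=.
  have h1 := n0P _ (leqnn n0); have h2 := n0P _ n0k.
  have := le_trans (dist n0 k) (leeD h1 h2); rewrite -EFinD lee_fin.
  by move=> /le_lt_trans; apply; rewrite -mulrDl ltr_pdivrMr//; lra.
move=> /cvg_ex[v sv]; exists v; split; last by exists s.
by exists s.
Qed.

Lemma bochner_integralP (V : normedModType R) (g : Omega -> V) v :
  is_bochner_integral P g v -> is_bochner_integral P g (bochner_integral P g).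
Proof. by move=> gv; rewrite /bochner_integral; case: xgetP => [y ->//|/(_ v)]. Qed.

End bochner_existence.

(** * Approximation error *)

Lemma powR_le (R : realType) (x y r : R) : 0 <= r -> 0 <= x -> x <= y ->
  x `^ r <= y `^ r.
Proof.
by move=> r0 x0 xy; apply: ge0_ler_powR; rewrite ?nnegrE// (le_trans x0).
Qed.

Lemma powR_inv (R : realType) (x r : R) : 0 <= x -> x^-1 `^ r = x `^ (- r).
Proof. by move=> x0; rewrite -powR_inv1// -powRrM mulN1r. Qed.

Section interpolation_error.
Context {R : realType} {T : R} (T0 : 0 < T) (E : normedModType R).
Variable n : nat.
Notation N := (n.+1%:R : R).

Definition gridpt (k : nat) : timeI T := grid T0 (inord k : 'I_n.+2).

Definition in_cell (k : nat) (t : timeI T) : Prop :=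
  (k <= n)%N /\ time_val (gridpt k) <= time_val t <= time_val (gridpt k.+1).

Lemma gridptE k : (k <= n.+1)%N -> time_val (gridpt k) = k%:R * T / N.
Proof.
move=> kn; have -> : time_val (gridpt k) = (inord k : 'I_n.+2)%:R * T / N by [].
by rewrite inordK.
Qed.

Lemma gridptS k : (k <= n)%N ->
  time_val (gridpt k.+1) = time_val (gridpt k) + T / N.
Proof.
move=> kn; rewrite !gridptE// ?(leq_trans kn)// -[k.+1]addn1 natrD.
by field; rewrite gt_eqF.
Qed.

Lemma exists_cell (t : timeI T) : exists k, in_cell k t.
Proof.
have [k tk] := grid_cell T0 t (ltn0Sn n); exists k; split; first by rewrite -ltnS.
by rewrite !gridptE// ltnW// ltnS.
Qed.

Lemma in_cell_dist k (s t : timeI T) : in_cell k s -> in_cell k t ->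
  `|time_val t - time_val s| <= T / N.
Proof.
move=> [kn /andP[s1 s2]] [_ /andP[t1 t2]]; rewrite gridptS// in s2 t2.
move: s1 s2 t1 t2; set c := T / N => s1 s2 t1 t2.
by rewrite ler_norml; apply/andP; split; lra.
Qed.

Lemma gridpt_in_cell k : (k <= n)%N -> in_cell k (gridpt k).
Proof.
move=> kn; split=> //; rewrite lexx gridptS//= lerDl divr_ge0// ltW//.
Qed.

Lemma gridptS_in_cell k : (k <= n)%N -> in_cell k (gridpt k.+1).
Proof.
move=> kn; split=> //; rewrite lexx andbT gridptS//= lerDl divr_ge0// ltW//.
Qed.

Variables (x y : timeI T -> E) (hx : timeI T -> timeI T -> R) (hy : nat -> R).
Variables (a rho : R).
Hypotheses (a0 : 0 < a) (a1 : a <= 1) (rho0 : 0 <= rho).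
Hypotheses (hx0 : forall s t, 0 <= hx s t) (hy0 : forall k, 0 <= hy k).
Hypothesis xhx : forall s t,
  `|x s - x t| <= hx s t * `|time_val s - time_val t| `^ (a + rho).
Hypothesis xyhy : forall k, (k <= n.+1)%N ->
  `|x (gridpt k) - y (gridpt k)| <= hy k * N `^ (- (a + rho)).
Hypothesis yinterp : forall k t, in_cell k t ->
  y t = (k%:R + 1 - time_val t * N / T) *: y (gridpt k) +
        (time_val t * N / T - k%:R) *: y (gridpt k.+1).

(** N^(a+rho) times a bound for |x - y| at t: the variation of x towards both ends of the cell, plus
    the errors there. *)
Definition cell_error (k : nat) (t : timeI T) : R :=
  T `^ (a + rho) * (hx t (gridpt k) + hx t (gridpt k.+1)) + (hy k + hy k.+1).

(** N^(a+rho) times a bound for the increment of y across the cell. *)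
Definition cell_slope (k : nat) : R :=
  T `^ (a + rho) * hx (gridpt k.+1) (gridpt k) + (hy k + hy k.+1).

Let N0 : 0 < N. Proof. by rewrite ltr0n. Qed.
Let ND (u v : R) : N `^ (u + v) = N `^ u * N `^ v.
Proof. by rewrite powRD// (gt_eqF N0) implybT. Qed.
Let ar0 : 0 <= a + rho. Proof. by rewrite addr_ge0// ltW. Qed.

Let x_cell k s t : in_cell k s -> in_cell k t ->
  `|x s - x t| <= N `^ (- (a + rho)) * (T `^ (a + rho) * hx s t).
Proof.
move=> ks kt; apply: le_trans (xhx s t) _.
have -> : N `^ (- (a + rho)) * (T `^ (a + rho) * hx s t) =
    hx s t * (T / N) `^ (a + rho).
  by rewrite powRM ?(ltW T0) ?invr_ge0 ?(ltW N0)// powR_inv ?(ltW N0)//; ring.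
rewrite ler_wpM2l// ge0_ler_powR ?nnegrE//; last exact: in_cell_dist kt ks.
by rewrite divr_ge0// ltW.
Qed.

Lemma cell_errorP k t : in_cell k t ->
  `|x t - y t| <= N `^ (- (a + rho)) * cell_error k t.
Proof.
move=> kt; have [kn /andP[t1 t2]] := kt.
rewrite (yinterp kt); set l := _ + 1 - _; set m := _ - k%:R.
have lm : l + m = 1 by rewrite /l /m; ring.
have l0 : 0 <= l.
  rewrite /l (_ : _ - _ = (time_val (gridpt k.+1) - time_val t) * (N / T)).
    by rewrite mulr_ge0 ?subr_ge0// divr_ge0// ltW.
  by rewrite gridptE// -[k.+1]addn1 natrD; field; rewrite !gt_eqF.
have m0 : 0 <= m.
  rewrite /m (_ : _ - _ = (time_val t - time_val (gridpt k)) * (N / T)).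
    by rewrite mulr_ge0 ?subr_ge0// divr_ge0// ltW.
  by rewrite gridptE ?(leq_trans kn)//; field; rewrite !gt_eqF.
have B j : in_cell k (gridpt j) -> (j <= n.+1)%N ->
    `|x t - y (gridpt j)| <= N `^ (- (a + rho)) *
      (T `^ (a + rho) * hx t (gridpt j) + hy j).
  move=> kj jn.
  have -> : x t - y (gridpt j) = (x t - x (gridpt j)) + (x (gridpt j) - y (gridpt j)).
    by rewrite addrA subrK.
  rewrite (le_trans (ler_normD _ _))// mulrDr lerD//; first exact: x_cell kt kj.
  by rewrite mulrC xyhy.
have -> : x t - (l *: y (gridpt k) + m *: y (gridpt k.+1)) =
    l *: (x t - y (gridpt k)) + m *: (x t - y (gridpt k.+1)).
  by rewrite -{1}(scale1r (x t)) -lm scalerDl !scalerBr opprD addrACA.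
have l1 : l <= 1 by rewrite -lm lerDl.
have m1 : m <= 1 by rewrite -lm lerDr.
rewrite (le_trans (ler_normD _ _))// !normrZ (ger0_norm l0) (ger0_norm m0).
have B1 := B k (gridpt_in_cell kn) (leq_trans kn (leqnSn n)).
have B2 := B k.+1 (gridptS_in_cell kn) kn.
apply: (@le_trans _ _ (`|x t - y (gridpt k)| + `|x t - y (gridpt k.+1)|)).
  by rewrite lerD// ler_piMl.
apply: le_trans (lerD B1 B2) _; rewrite -mulrDr ler_wpM2l ?powR_ge0// /cell_error.
by rewrite mulrDr addrACA.
Qed.

(** Inside a cell the relative distance z is at most 1, so z <= z^a because a <= 1: linear growth
    becomes Hoelder growth of order a, with a factor N^(-rho) to spare. *)
Lemma cell_slopeP k s t : in_cell k s -> in_cell k t ->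
  `|y t - y s| <= N `^ (- rho) * `|time_val t - time_val s| `^ a *
    (T `^ (- a) * cell_slope k).
Proof.
move=> ks kt; have [kn _] := ks.
have -> : y t - y s = ((time_val t - time_val s) * N / T) *:
    (y (gridpt k.+1) - y (gridpt k)).
  rewrite (yinterp kt) (yinterp ks) opprD addrACA -!scalerBl scalerBr addrC.
  rewrite -scaleNr; congr (_ *: _ + _ *: _); field; rewrite !gt_eqF//.
pose z := `|time_val t - time_val s| * N / T.
have z0 : 0 <= z by rewrite /z divr_ge0 ?(ltW T0)// mulr_ge0// ltW.
have z1 : z <= 1.
  rewrite /z ler_pdivrMr// mul1r -ler_pdivlMr//; exact: in_cell_dist ks kt.
rewrite normrZ; have -> : `|(time_val t - time_val s) * N / T| = z.
  by rewrite /z !normrM normfV (gtr0_norm N0) (gtr0_norm T0).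
have yB : `|y (gridpt k.+1) - y (gridpt k)| <= N `^ (- (a + rho)) * cell_slope k.
  have -> : y (gridpt k.+1) - y (gridpt k) = (x (gridpt k.+1) - x (gridpt k)) +
     ((x (gridpt k) - y (gridpt k)) - (x (gridpt k.+1) - y (gridpt k.+1))).
    by rewrite opprB [RHS]addrA [X in _ = X + _]addrA subrK [RHS]addrC addrA subrK.
  rewrite (le_trans (ler_normD _ _))// /cell_slope mulrDr lerD//.
    exact: x_cell (gridptS_in_cell kn) (gridpt_in_cell kn).
  rewrite (le_trans (ler_normB _ _))// mulrDr lerD// mulrC xyhy//.
  exact: leq_trans kn _.
have za : z <= z `^ a.
  have [->|zn] := eqVneq z 0; first exact: powR_ge0.
  by apply: ger1_powR => //; rewrite lt0r zn z0.
have -> : N `^ (- rho) * `|time_val t - time_val s| `^ a *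
    (T `^ (- a) * cell_slope k) = z `^ a * (N `^ (- (a + rho)) * cell_slope k).
  rewrite /z !powRM ?mulr_ge0 ?invr_ge0 ?(ltW T0) ?(ltW N0)//.
  rewrite [N `^ (- rho)](_ : _ = N `^ a * N `^ (- (a + rho))); last first.
    by rewrite -ND; congr (_ `^ _); ring.
  by rewrite -[T `^ (- a)]powR_inv ?(ltW T0)//; ring.
apply: ler_pM => //.
Qed.

(** Distant times use the error at both times, close times the separate variations of x and y. In
    both cases the order a + rho is split into |t-s|^a and N^(-rho). *)
Lemma error_increment (s t : timeI T) ks kt :
  time_val s <= time_val t -> in_cell ks s -> in_cell kt t ->
  `|(x t - y t) - (x s - y s)| <= N `^ (- rho) * `|time_val t - time_val s| `^ a *
   (T `^ (- a) * (cell_error kt t + cell_error ks s) + T `^ rho * hx t s +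
    T `^ (- a) * (cell_slope kt + cell_slope kt.-1)).
Proof.
move=> st kss ktt.
have N0' : 0 < N `^ (- rho) by exact: powR_gt0.
have Ta0 : 0 < T `^ (- a) by exact: powR_gt0.
have ce0 k t' : 0 <= cell_error k t' by rewrite addr_ge0// ?mulr_ge0 ?addr_ge0 ?powR_ge0.
have cs0 k : 0 <= cell_slope k by rewrite addr_ge0// ?mulr_ge0 ?addr_ge0 ?powR_ge0.
set D := `|time_val t - time_val s|.
have D00 : 0 <= D by exact: normr_ge0.
have D0 : 0 <= D `^ a by exact: powR_ge0.
have dts : D = time_val t - time_val s by rewrite /D ger0_norm// subr_ge0.
(* If D >= T/N then N^(-a) <= T^(-a) D^a; if D < T/N then D^rho <= T^rho N^(-rho). *)
have [far|near] := leP (T / N) D.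
  have : `|x t - y t - (x s - y s)| <=
      N `^ (- (a + rho)) * (cell_error kt t + cell_error ks s).
    by rewrite mulrDr (le_trans (ler_normB _ _))// lerD// cell_errorP.
  move=> /le_trans; apply.
  apply: (@le_trans _ _ (N `^ (- rho) * D `^ a *
      (T `^ (- a) * (cell_error kt t + cell_error ks s)))); last first.
    apply: ler_wpM2l; first by rewrite mulr_ge0// ltW.
    rewrite -[leRHS]addrA lerDl.
    by apply: addr_ge0; apply: mulr_ge0;
      [exact: powR_ge0|exact: hx0|exact: powR_ge0|exact: addr_ge0].
  rewrite mulrA; apply: ler_wpM2r; first exact: addr_ge0.
  rewrite [N `^ (- (a + rho))](_ : _ = N `^ (- rho) * N `^ (- a)); last first.
    by rewrite -ND; congr (_ `^ _); ring.
  rewrite -mulrA ler_wpM2l ?(ltW N0')//.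
  have : (T / N) `^ a <= D `^ a.
    by apply: powR_le => //; rewrite ?divr_ge0// ltW.
  rewrite powRM ?invr_ge0 ?(ltW T0) ?(ltW N0)// powR_inv ?(ltW N0)//.
  by rewrite [T `^ (- a)]powRN ler_pdivlMr ?powR_gt0// [in X in _ -> X]mulrC.
have xpart : `|x t - x s| <= N `^ (- rho) * D `^ a * (T `^ rho * hx t s).
  apply: le_trans (xhx t s) _; rewrite -/D.
  have [Dz|Dn] := eqVneq D 0.
    by rewrite Dz !powR0 ?gt_eqF// ?ltr_wpDr// !(mulr0, mul0r).
  rewrite powRD ?Dn ?implybT//.
  have : D `^ rho <= (T / N) `^ rho.
    by apply: powR_le => //; rewrite ltW.
  rewrite powRM ?invr_ge0 ?(ltW T0) ?(ltW N0)// powR_inv ?(ltW N0)// => H.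
  rewrite (_ : _ * (T `^ rho * _) = hx t s * (D `^ a * (T `^ rho * N `^ (- rho))));
    last by ring.
  by rewrite ler_wpM2l// ler_wpM2l.
have ypart : `|y t - y s| <= N `^ (- rho) * D `^ a *
    (T `^ (- a) * (cell_slope kt + cell_slope kt.-1)).
  have [ktn /andP[t1 t2]] := ktt.
  (* As D < T/N, s lies in the cell of t or in the preceding one; the latter case is joined through
     the common grid point. *)
  have [gs|sg] := leP (time_val (gridpt kt)) (time_val s).
    have sin : in_cell kt s by split=> //; rewrite gs (le_trans st).
    apply: le_trans (cell_slopeP sin ktt) _; rewrite -/D.
    rewrite ler_wpM2l ?mulr_ge0 ?(ltW N0')// ler_wpM2l ?(ltW Ta0)//.
    by rewrite lerDl.
  have kt0 : (0 < kt)%N.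
    rewrite lt0n; apply: contraTneq sg => ->; rewrite -leNgt gridptE// mul0r mul0r.
    by have /andP[] := time_valP s.
  have kt1 : (kt.-1 <= n)%N by exact: leq_trans (leq_pred _) ktn.
  have gkt : time_val (gridpt kt) = time_val (gridpt kt.-1) + T / N.
    by rewrite -gridptS// prednK.
  have sin : in_cell kt.-1 s.
    split=> //; rewrite prednK// (ltW sg) andbT.
    move: near gkt t1; rewrite dts; set cc := T / N => *; lra.
  have gin := gridptS_in_cell kt1; rewrite prednK// in gin.
  have S1 := cell_slopeP (gridpt_in_cell ktn) ktt.
  have S2 := cell_slopeP sin gin.
  have -> : y t - y s = (y t - y (gridpt kt)) + (y (gridpt kt) - y s).
    by rewrite addrA subrK.
  rewrite (le_trans (ler_normD _ _))// [X in _ * X]mulrDr mulrDr lerD//.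
    apply: le_trans S1 _; rewrite ler_wpM2r ?mulr_ge0 ?(ltW Ta0)//.
    rewrite ler_wpM2l ?(ltW N0')//; apply: powR_le => //; first exact: ltW.
    by rewrite dts ger0_norm ?subr_ge0// lerB// ltW.
  apply: le_trans S2 _; rewrite ler_wpM2r ?mulr_ge0 ?(ltW Ta0)//.
  rewrite ler_wpM2l ?(ltW N0')//; apply: powR_le => //; first exact: ltW.
  by rewrite dts ger0_norm ?subr_ge0 ?(ltW sg)// lerB.
have -> : x t - y t - (x s - y s) = (x t - x s) - (y t - y s).
  by rewrite !opprB [LHS]addrACA [- y t + _]addrC [RHS]addrACA.
rewrite (le_trans (ler_normB _ _))// (le_trans (lerD xpart ypart))//.
rewrite -mulrDr; apply: ler_wpM2l; first by rewrite mulr_ge0// ltW.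
rewrite -[leRHS]addrA lerDr.
by apply: mulr_ge0; [exact: ltW|exact: addr_ge0].
Qed.

End interpolation_error.

Lemma ereal_sup_lty_bound (R : realType) (A : set (\bar R)) :
  (ereal_sup A < +oo)%E -> exists C : R, forall x, A x -> (x <= C%:E)%E.
Proof.
case: (ereal_sup A) (@ereal_sup_ubound R A) => [C|//|] H _.
  by exists C => x /H.
by exists 0 => x /H; rewrite leeNy_eq => /eqP ->; exact: leNye.
Qed.

(** * Moments of the Hoelder norm of the scaled error *)

Section approximation_error.
Context {R : realType} {T : R} (T0 : 0 < T).
Context d (Omega : measurableType d) (P : probability Omega R).
Context (E : completeNormedModType R) (sepE : separable E).
Variable beta : R.
Hypothesis beta1 : beta <= 1.
Variables (X : timeI T -> Omega -> E).
Hypothesis mX : stochastic_process X.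
Hypothesis cX : forall w, continuous (fun t => X t w).
Hypothesis X_holder : forall p gamma : R, 1 <= p -> 0 <= gamma -> gamma < beta ->
  holder_space (Lp_norm P p) gamma X.

Lemma X_increment_moments (del : R) : 0 < del -> del < beta ->
  all_moments P (fun (x : timeI T * timeI T) w =>
    (`|time_val x.1 - time_val x.2| `^ del)^-1 * `|X x.1 w - X x.2 w|).
Proof.
move=> del0 delb; apply: all_moments_Lnorm.
- move=> x; apply: (@borel_measurable_norm _ _ _ E (fun w => X x.1 w - X x.2 w)).
  by apply: borel_measurableB => //; exact: mX.
- by move=> x w; exact: normr_ge0.
- by move=> x; rewrite invr_ge0 powR_ge0.
- move=> q; have q1 : 1 <= q.+1%:R :> R by rewrite ler1n.
  have [_ hfin] := X_holder q1 (ltW del0) delb.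
  move: hfin; rewrite /holder_norm; set S1 := ereal_sup _; set A2 := [set _ | _ in _].
  move=> hfin.
  have L0 (Z : Omega -> E) : (0 <= Lp_norm P q.+1%:R Z)%E by exact: Lnorm_ge0.
  have S10 : (0 <= S1)%E.
    apply: le_trans (L0 (X (dyadic T0 0 0))) _.
    by apply: ereal_sup_ubound; exists (dyadic T0 0 0).
  have [|C CP] := @ereal_sup_lty_bound R A2.
    by apply: le_lt_trans hfin; rewrite leeDr.
  (* Equal times are outside the supremum; there the quotient is 0 since the inverse of 0 is 0. *)
  exists `|C| => -[s t]; have [->|st] := eqVneq s t.
    by rewrite /= subrr normr0 powR0 ?gt_eqF// invr0 mul0e lee_fin.
  apply: (@le_trans _ _ C%:E); last by rewrite lee_fin ler_norm.
  by apply: CP; exists (s, t) => //; rewrite muleC.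
Qed.

Lemma X_moments : 0 < beta -> all_moments P (fun t w => `|X t w|).
Proof.
move=> beta0.
have : all_moments P (fun t w => 1 * `|X t w|).
  apply: (@all_moments_Lnorm _ _ _ P _ (fun t w => `|X t w|) (fun=> 1)) => //.
  - by move=> t; apply: (@borel_measurable_norm _ _ _ E (X t)); exact: mX.
  - move=> q; have q1 : 1 <= q.+1%:R :> R by rewrite ler1n.
    have [_ hfin] := X_holder q1 (lexx 0) beta0.
    have L0 (Z : Omega -> E) : (0 <= Lp_norm P q.+1%:R Z)%E by exact: Lnorm_ge0.
    have hge := le_holder_norm T0 0 X _ L0.
    have hfn : holder_norm (Lp_norm P q.+1%:R) 0 X \is a fin_num.
      by rewrite ge0_fin_numE// (le_trans (L0 _) (hge (dyadic T0 0 0))).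
    exists (fine (holder_norm (Lp_norm P q.+1%:R) 0 X)) => t.
    by rewrite mul1e fineK//; exact: hge.
have -> // : (fun t w => 1 * `|X t w|) = (fun t w => `|X t w|).
by apply/funext => t; apply/funext => w; rewrite mul1r.
Qed.

Variable Y : nat -> timeI T -> Omega -> E.
Hypothesis mY : forall N, (0 < N)%N -> stochastic_process (Y N).
Hypothesis Y_interpolation : forall N, (0 < N)%N ->
  forall (n : 'I_N) (t : timeI T) (omega : Omega),
    n%:R * T / N%:R <= time_val t <= n.+1%:R * T / N%:R ->
    Y N t omega =
      (n%:R + 1 - time_val t * N%:R / T) *:
        Y N (grid T0 (widen_ord (leqnSn N) n)) omega +
      (time_val t * N%:R / T - n%:R) *: Y N (grid T0 (lift ord0 n)) omega.
Hypothesis Y_rate : forall p rho : R, 1 <= p -> 0 <= rho -> rho < beta ->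
  (ereal_sup [set ereal_sup [set (M%:R `^ rho)%:E *
     Lp_norm P p (fun omega =>
       (X (grid T0 m) omega - Y M (grid T0 m) omega)%R) |
     m in [set: 'I_M.+1]] | M in [set M : nat | (0 < M)%N]] < +oo)%E.

Lemma Y_grid_moments (del : R) : 0 <= del -> del < beta ->
  all_moments P (fun (x : nat * nat) w => x.1.+1%:R `^ del *
    `|X (gridpt T0 x.1 x.2) w - Y x.1.+1 (gridpt T0 x.1 x.2) w|).
Proof.
move=> del0 delb; apply: all_moments_Lnorm.
- move=> x; apply: (@borel_measurable_norm _ _ _ E (fun w =>
    X (gridpt T0 x.1 x.2) w - Y x.1.+1 (gridpt T0 x.1 x.2) w)).
  by apply: borel_measurableB => //; do ?[exact: mX | exact: mY].
- by move=> x w; exact: normr_ge0.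
- by move=> x; rewrite powR_ge0.
move=> q; have q1 : 1 <= q.+1%:R :> R by rewrite ler1n.
have [C CP] := ereal_sup_lty_bound (Y_rate q1 del0 delb).
exists C => -[n m]; apply: le_trans (CP _ _); last by exists n.+1.
by apply: ereal_sup_ubound; exists (inord m).
Qed.

Lemma Y_path N w : (0 < N)%N ->
  (fun t => Y N t w) = interp_path (fun i : 'I_N.+1 => Y N (grid T0 i) w).
Proof.
move=> N0; apply/funext => t; have [k kt] := grid_cell T0 t N0.
by rewrite (Y_interpolation N0 w kt) interp_pathE (interp_cell T0 _ kt).
Qed.

Lemma Y_continuous N w : (0 < N)%N -> continuous (fun t => Y N t w).
Proof. by move=> N0; rewrite Y_path//; exact: contfun_continuous. Qed.

Lemma Y_cell n w k t : in_cell T0 n k t ->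
  Y n.+1 t w = (k%:R + 1 - time_val t * n.+1%:R / T) *: Y n.+1 (gridpt T0 n k) w +
   (time_val t * n.+1%:R / T - k%:R) *: Y n.+1 (gridpt T0 n k.+1) w.
Proof.
move=> [kn]; rewrite !gridptE// ?(leq_trans kn)// => kt.
have kn' : (k < n.+1)%N by rewrite ltnS.
rewrite (Y_interpolation (ltn0Sn n) w (n := Ordinal kn') kt).
have -> : gridpt T0 n k = grid T0 (widen_ord (leqnSn n.+1) (Ordinal kn')).
  by congr grid; apply: val_inj; rewrite /= inordK// ltnS ltnW.
by have -> : gridpt T0 n k.+1 = grid T0 (lift ord0 (Ordinal kn'));
  first by congr grid; apply: val_inj; rewrite /= inordK.
Qed.

Definition scaled_error (rho : R) (n : nat) (w : Omega) : contfun (timeI T) E :=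
  n.+1%:R `^ rho *: (cpath (fun t => X t w) - cpath (fun t => Y n.+1 t w)).

Lemma scaled_errorE rho n w t : scaled_error rho n w t =
  n.+1%:R `^ rho *: (X t w - Y n.+1 t w).
Proof.
have eX : cpath (fun t => X t w) t = X t w by rewrite cpathE//; exact: cX.
have eY : cpath (fun t => Y n.+1 t w) t = Y n.+1 t w.
  by rewrite cpathE//; exact: Y_continuous.
by rewrite -[in RHS]eX -[in RHS]eY.
Qed.

(** The pathwise bound [error_increment] holds with random coefficients whose moments are uniform in
    N and in the times; the Kolmogorov estimate turns this into a bound on the Hoelder norm. *)
Lemma scaled_error_moments (rho al : R) : 0 <= al -> 0 <= rho ->
  al + rho < beta ->
  all_moments P (fun n w => fine (holder_norm (@enorm R E) al (scaled_error rho n w))) /\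
  forall n, {ae P, forall w,
    (holder_norm (@enorm R E) al (scaled_error rho n w) < +oo)%E}.
Proof.
move=> al0 rho0 alb.
(* Midpoint of al and beta - rho: al < a is lost in the chaining, and a + rho < beta is the order of
   the assumed rates. *)
pose a := (al + (beta - rho)) / 2.
have ala : al < a by rewrite /a; lra.
have ab : a + rho < beta by rewrite /a; lra.
have a0 : 0 < a by exact: le_lt_trans ala.
have a1 : a <= 1 by move: beta1; lra.
have del0 : 0 < a + rho by rewrite ltr_pwDl.
pose hx (s t : timeI T) (w : Omega) : R :=
  (`|time_val s - time_val t| `^ (a + rho))^-1 * `|X s w - X t w|.
pose hy (n k : nat) (w : Omega) : R := n.+1%:R `^ (a + rho) *
    `|X (gridpt T0 n k) w - Y n.+1 (gridpt T0 n k) w|.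
have hxB : all_moments P (fun (x : timeI T * timeI T) w => hx x.1 x.2 w).
  exact: X_increment_moments.
have hyB : all_moments P (fun (x : nat * nat) w => hy x.1 x.2 w).
  by apply: Y_grid_moments => //; exact: ltW.
(* A cell is fixed for every time; at grid points either neighbour will do. *)
have /choice[kap kapP] : forall x : nat * timeI T, exists k, in_cell T0 x.1 k x.2.
  by move=> [n t]; exact: exists_cell.
pose CE (x : nat * timeI T) (k : nat) w :=
  cell_error T0 x.1 (fun s t => hx s t w) (fun k => hy x.1 k w) a rho k x.2.
pose CS (x : nat * nat) w :=
  cell_slope T0 x.1 (fun s t => hx s t w) (fun k => hy x.1 k w) a rho x.2.
have CEB : all_moments P (fun x w => CE x (kap x) w).
  apply: all_momentsD; first apply: all_momentsZ; rewrite ?powR_ge0//.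
    apply: all_momentsD.
      exact: (all_moments_comp (fun x => (x.2, gridpt T0 x.1 (kap x))) hxB).
    exact: (all_moments_comp (fun x => (x.2, gridpt T0 x.1 (kap x).+1)) hxB).
  apply: all_momentsD; first exact: (all_moments_comp (fun x => (x.1, kap x)) hyB).
  exact: (all_moments_comp (fun x => (x.1, (kap x).+1)) hyB).
have CSB : all_moments P CS.
  apply: all_momentsD; first apply: all_momentsZ; rewrite ?powR_ge0//.
    exact: (all_moments_comp (fun x : nat * nat =>
      (gridpt T0 x.1 x.2.+1, gridpt T0 x.1 x.2)) hxB).
  apply: all_momentsD; first exact: hyB.
  exact: (all_moments_comp (fun x : nat * nat => (x.1, x.2.+1)) hyB).
pose F (x : nat * timeI T) w := T `^ (- a) * CE x (kap x) w +
  T `^ (- a) * (CS (x.1, kap x) w + CS (x.1, (kap x).-1) w).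
have FB : all_moments P F.
  apply: all_momentsD; apply: all_momentsZ; rewrite ?powR_ge0//.
  apply: all_momentsD; first exact: (all_moments_comp (fun x => (x.1, kap x)) CSB).
  exact: (all_moments_comp (fun x => (x.1, (kap x).-1)) CSB).
(* Symmetric in the two times, because the increment estimate is available only for ordered
   times. *)
pose G (x : nat * (timeI T * timeI T)) w := F (x.1, x.2.1) w + F (x.1, x.2.2) w +
  T `^ rho * (hx x.2.1 x.2.2 w + hx x.2.2 x.2.1 w).
have GB : all_moments P G.
  apply: all_momentsD.
    apply: all_momentsD; first exact: (all_moments_comp (fun x => (x.1, x.2.1)) FB).
    exact: (all_moments_comp (fun x => (x.1, x.2.2)) FB).
  apply: all_momentsZ; rewrite ?powR_ge0//; apply: all_momentsD.
    exact: (all_moments_comp (fun x : nat * (timeI T * timeI T) => x.2) hxB).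
  exact: (all_moments_comp (fun x : nat * (timeI T * timeI T) => (x.2.2, x.2.1)) hxB).
have := @kolmogorov R T T0 E _ Omega P nat (scaled_error rho) al a al0 ala; apply.
- apply: (@all_moments_le _ _ _ P _ _ (fun n w => hy n 0%N w)) => [n w|n w|].
  + exact: normr_ge0.
  + have -> : dyadic T0 0 0 = gridpt T0 n 0.
      by apply: timeI_eq; rewrite dyadicE// gridptE// !mul0r.
    rewrite scaled_errorE normrZ ger0_norm ?powR_ge0//.
    by rewrite ler_wpM2r// ler_powR ?ler1n// lerDr ltW.
  + exact: (all_moments_comp (fun n => (n, 0%N)) hyB).
- apply: (@all_moments_le _ _ _ P _ _ G) => [x w|[n [t s]] w|//].
    by rewrite divr_ge0// powR_ge0.
  rewrite !scaled_errorE /=.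
  have hx0 s' t' : 0 <= hx s' t' w by rewrite mulr_ge0// invr_ge0 powR_ge0.
  have hy0 k : 0 <= hy n k w by rewrite mulr_ge0// powR_ge0.
  have G0 x w' : 0 <= G x w' by case: GB => + _; exact.
  have xhx s' t' : `|X s' w - X t' w| <=
      hx s' t' w * `|time_val s' - time_val t'| `^ (a + rho).
    have [->|st] := eqVneq s' t'; first by rewrite subrr normr0 mulr_ge0// powR_ge0.
    rewrite /hx mulrAC mulVf ?mul1r// gt_eqF// powR_gt0// normr_gt0 subr_eq0.
    by apply: contra st => /eqP/timeI_eq ->.
  have N0 : 0 < n.+1%:R :> R by rewrite ltr0n.
  have xyhy k : (k <= n.+1)%N -> `|X (gridpt T0 n k) w - Y n.+1 (gridpt T0 n k) w| <=
      hy n k w * n.+1%:R `^ (- (a + rho)).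
    by move=> _; rewrite /hy mulrAC powRN mulfV ?mul1r// gt_eqF// powR_gt0.
  have core s' t' : time_val s' <= time_val t' ->
      `|(X t' w - Y n.+1 t' w) - (X s' w - Y n.+1 s' w)| <=
      n.+1%:R `^ (- rho) * `|time_val t' - time_val s'| `^ a * G (n, (t', s')) w.
    move=> st; have := @error_increment R T T0 E n (X^~ w) (Y n.+1^~ w)
      (fun s t => hx s t w) (fun k => hy n k w) a rho a0 a1 rho0 hx0 hy0 xhx xyhy
      (@Y_cell n w) s' t' _ _ st (kapP (n, s')) (kapP (n, t')).
    move=> /le_trans; apply.
    apply: ler_wpM2l; first by rewrite mulr_ge0// powR_ge0.
    have Ta0 := powR_ge0 T (- a); have Tr0 := powR_ge0 T rho.
    have CS0 k : 0 <= CS (n, k) w by case: CSB => + _; exact.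
    have := mulr_ge0 Tr0 (hx0 s' t').
    have := mulr_ge0 Ta0 (CS0 (kap (n, s'))); have := mulr_ge0 Ta0 (CS0 (kap (n, s')).-1).
    rewrite /G /F /= -/(CE (n, t') (kap (n, t')) w) -/(CE (n, s') (kap (n, s')) w).
    rewrite -/(CS (n, kap (n, t')) w) -/(CS (n, (kap (n, t')).-1) w) !mulrDr.
    lra.
  have Gsym : G (n, (t, s)) w = G (n, (s, t)) w.
    by rewrite /G /= [F (n, t) w + _]addrC [hx t s w + _]addrC.
  have [->|dn] := eqVneq `|time_val t - time_val s| 0.
    by rewrite powR0 ?gt_eqF// invr0 mulr0.
  rewrite ler_pdivrMr; last by rewrite powR_gt0// lt0r dn normr_ge0.
  rewrite -scalerBr normrZ ger0_norm ?powR_ge0//.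
  rewrite -ler_pdivlMl ?powR_gt0// -powRN mulrA mulrAC.
  have [st|/ltW ts] := leP (time_val s) (time_val t); first exact: core.
  by rewrite distrC [X in X `^ a]distrC Gsym; exact: core.
Qed.

End approximation_error.

(** * Seminorm properties and local Lipschitz estimates *)

Section holder_norm_seminorm.
Context {R : realType} {T : R} (T0 : 0 < T) (E : normedModType R) (s : R).
Implicit Types v w : contfun (timeI T) E.
Notation hn := (holder_norm (@enorm R E) s).

Lemma holder_norm_le v (A B : \bar R) :
  (forall t, (enorm (v t) <= A)%E) ->
  (forall t u, t != u -> (enorm (v t - v u)%R *
     ((`|time_val t - time_val u| `^ s)^-1)%R%:E <= B)%E) ->
  (hn v <= A + B)%E.
Proof.
move=> hA hB; apply: leeD; apply: ge_ereal_sup; first by move=> _ [t _ <-]; exact: hA.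
by move=> _ [[t u] /= tu <-]; exact: hB.
Qed.

Lemma holder_normD v w : (hn (v + w)%R <= hn v + hn w)%E.
Proof.
rewrite [X in (_ <= X + _)%E]/holder_norm [X in (_ <= _ + X)%E]/holder_norm addeACA.
apply: holder_norm_le => [t|t u tu].
  apply: (@le_trans _ _ (enorm (v t) + enorm (w t))%E).
    by rewrite -EFinD lee_fin ler_normD.
  by apply: leeD; apply: ereal_sup_ubound; exists t.
apply: (@le_trans _ _ (enorm (v t - v u)%R * (`|time_val t - time_val u| `^ s)^-1%R%:E +
    enorm (w t - w u)%R * (`|time_val t - time_val u| `^ s)^-1%R%:E)%E).
  rewrite -!EFinM -EFinD lee_fin -mulrDl ler_wpM2r ?invr_ge0 ?powR_ge0//.
  rewrite [X in `|X|](_ : _ = (v t - v u) + (w t - w u)) ?ler_normD//.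
  by rewrite [RHS]addrACA -opprD.
by apply: leeD; apply: ereal_sup_ubound; [exists (t, u)|exists (t, u)].
Qed.

Lemma holder_norm_ge_incr v t u : t != u ->
  (enorm (v t - v u)%R * ((`|time_val t - time_val u| `^ s)^-1)%R%:E <= hn v)%E.
Proof.
move=> tu; rewrite /holder_norm.
have e0 (x : E) : (0 <= enorm x)%E by rewrite lee_fin.
apply: (@le_trans _ _ (ereal_sup [set enorm (v tu.1 - v tu.2)%R *
                 ((`|time_val tu.1 - time_val tu.2| `^ s)^-1)%R%:E |
             tu in [set tu : timeI T * timeI T | tu.1 != tu.2]])%E).
  by apply: ereal_sup_ubound; exists (t, u).
by rewrite leeDr// (le_trans (e0 (v t)))//; apply: ereal_sup_ubound; exists t.
Qed.

Lemma holder_normZ_le (k : R) v : (hn (k *: v)%R <= `|k|%:E * hn v)%E.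
Proof.
have k0 : (0 <= `|k|%:E)%E by rewrite lee_fin.
have e0 (x : E) : (0 <= enorm x)%E by rewrite lee_fin.
rewrite [X in (_ <= _ * X)%E]/holder_norm ge0_muleDr; last 2 first.
- by rewrite (le_trans (e0 (v (dyadic T0 0 0))))//; apply: ereal_sup_ubound; exists (dyadic T0 0 0).
- exact: (holder_seminorm_ge0 T0 s v e0).
apply: holder_norm_le => [t|t u tu].
  rewrite [X in enorm X](_ : _ = k *: v t)// /enorm normrZ EFinM.
  by rewrite lee_wpmul2l//; apply: ereal_sup_ubound; exists t.
rewrite [X in enorm X](_ : _ = k *: (v t - v u)); last by rewrite scalerBr.
rewrite /enorm normrZ EFinM -muleA lee_wpmul2l//.
by apply: ereal_sup_ubound; exists (t, u).
Qed.

Lemma holder_normZ_ge (k : R) v : 0 < k -> (k%:E * hn v <= hn (k *: v)%R)%E.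
Proof.
move=> k0; have := holder_normZ_le k^-1 (k *: v).
rewrite scalerA mulVf ?gt_eqF// scale1r gtr0_norm ?invr_gt0//.
by rewrite -lee_pdivrMl ?invr_gt0// invrK.
Qed.

Lemma holder_normB v w : (hn (v - w)%R <= hn v + hn w)%E.
Proof.
apply: le_trans (holder_normD _ _) _; rewrite leeD2l// -scaleN1r.
by apply: le_trans (holder_normZ_le _ _) _; rewrite normrN normr1 mul1e.
Qed.

Lemma contfun_norm_holder v : (`|v|%:E <= hn v)%E.
Proof.
have e0 (x : E) : (0 <= enorm x)%E by rewrite lee_fin.
have [->|] := eqVneq (hn v) +oo%E; first exact: leey.
rewrite -ltey => hfin; have hf : hn v \is a fin_num.
  by rewrite ge0_fin_numE// holder_norm_ge0.
rewrite -(fineK hf) lee_fin contfun_normE; apply: contfun_norm_le => [|t].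
  by rewrite fine_ge0// holder_norm_ge0.
by rewrite -lee_fin fineK//; exact: le_holder_norm.
Qed.

Lemma holder_norm_fin_num v : (hn v < +oo)%E -> hn v \is a fin_num.
Proof. by move=> vf; rewrite ge0_fin_numE// holder_norm_ge0. Qed.

Lemma holder_spaceP v : (hn v < +oo)%E -> holder_space (@enorm R E) s v.
Proof.
move=> hfin; split => // t.
have FF : Filter (nbhs t) by exact: nbhs_filter.
have h := @contfun_continuous _ _ _ v t.
have cn : `|v u - v t| @[u --> t] --> (0 : R).
  have := @cvg_norm _ _ _ (nbhs t) FF _ _ (cvgB h (@cvg_cst _ (v t) _ (nbhs t) FF)).
  by rewrite subrr normr0; exact.
apply/fine_cvgP; split; first exact: (@filterE _ (nbhs t) FF _ (fun=> isT)).
exact: cn.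
Qed.

Lemma holder_norm0 : hn (0 : contfun (timeI T) E) = 0%E.
Proof.
apply/eqP; rewrite eq_le holder_norm_ge0// andbT.
have := holder_normZ_le 0 0; rewrite scale0r normr0 => /le_trans; apply.
by rewrite mul0e.
Qed.

End holder_norm_seminorm.

Section holder_lipschitz.
Context {R : realType} {T : R} (T0 : 0 < T) (E : normedModType R).
Variables al c r : R.
Variable f : contfun (timeI T) E -> contfun (timeI T) E.
Notation hn := (holder_norm (@enorm R E) al).
Hypothesis f_lipschitz : forall v w : contfun (timeI T) E,
  holder_space (@enorm R E) al v -> holder_space (@enorm R E) al w ->
  [/\ holder_space (@enorm R E) al (f v), holder_space (@enorm R E) al (f w) &
      (hn (f v - f w)%R <= c%:E * (1 + hn v `^ r + hn w `^ r) * hn (v - w)%R)%E].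

Lemma holder_lipschitz_fine (v w : contfun (timeI T) E) : (hn v < +oo)%E -> (hn w < +oo)%E ->
  (hn (f v - f w)%R <= (c * (1 + fine (hn v) `^ r + fine (hn w) `^ r))%:E *
    hn (v - w)%R)%E.
Proof.
move=> vf wf; have [_ _] := f_lipschitz (holder_spaceP vf) (holder_spaceP wf).
have vfin : hn v \is a fin_num by rewrite ge0_fin_numE// holder_norm_ge0.
have wfin : hn w \is a fin_num by rewrite ge0_fin_numE// holder_norm_ge0.
by rewrite -{1}(fineK vfin) -{1}(fineK wfin) !poweR_EFin EFinM !EFinD.
Qed.

Lemma holder_f0_lty : (hn (f (0 : contfun (timeI T) E)%R) < +oo)%E.
Proof.
have h0 : (hn (0 : contfun (timeI T) E)%R < +oo)%E by rewrite holder_norm0// ltry.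
by have [[]] := f_lipschitz (holder_spaceP h0) (holder_spaceP h0).
Qed.

End holder_lipschitz.

(** * Error bounds after composition with f *)

Section composition_error.
Context {R : realType} {T : R} (T0 : 0 < T).
Context d (Omega : measurableType d) (P : probability Omega R).
Context (E : completeNormedModType R) (sepE : separable E).
Variables beta al c r : R.
Hypotheses (beta1 : beta <= 1) (al0 : 0 < al) (alb : al < beta).
Hypotheses (c0 : 0 <= c) (r0 : 0 <= r).
Variables (X : timeI T -> Omega -> E).
Hypothesis mX : stochastic_process X.
Hypothesis cX : forall w, continuous (fun t => X t w).
Hypothesis X_holder : forall p gamma : R, 1 <= p -> 0 <= gamma -> gamma < beta ->
  holder_space (Lp_norm P p) gamma X.
Variable Y : nat -> timeI T -> Omega -> E.
Hypothesis mY : forall N, (0 < N)%N -> stochastic_process (Y N).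
Hypothesis Y_interpolation : forall N, (0 < N)%N ->
  forall (n : 'I_N) (t : timeI T) (omega : Omega),
    n%:R * T / N%:R <= time_val t <= n.+1%:R * T / N%:R ->
    Y N t omega =
      (n%:R + 1 - time_val t * N%:R / T) *:
        Y N (grid T0 (widen_ord (leqnSn N) n)) omega +
      (time_val t * N%:R / T - n%:R) *: Y N (grid T0 (lift ord0 n)) omega.
Hypothesis Y_rate : forall p rho : R, 1 <= p -> 0 <= rho -> rho < beta ->
  (ereal_sup [set ereal_sup [set (M%:R `^ rho)%:E *
     Lp_norm P p (fun omega =>
       (X (grid T0 m) omega - Y M (grid T0 m) omega)%R) |
     m in [set: 'I_M.+1]] | M in [set M : nat | (0 < M)%N]] < +oo)%E.
Variable f : contfun (timeI T) E -> contfun (timeI T) E.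
Notation hn := (holder_norm (@enorm R E) al).
Hypothesis f_lipschitz : forall v w : contfun (timeI T) E,
  holder_space (@enorm R E) al v -> holder_space (@enorm R E) al w ->
  [/\ holder_space (@enorm R E) al (f v), holder_space (@enorm R E) al (f w) &
      (hn (f v - f w)%R <= c%:E * (1 + hn v `^ r + hn w `^ r) * hn (v - w)%R)%E].

Let cpX w := cpath (fun t => X t w).
Let cpY n w := cpath (fun t => Y n.+1 t w).

Lemma X_path_moments :
  all_moments P (fun (_ : unit) w => fine (hn (cpX w))) /\
  {ae P, forall w, (hn (cpX w) < +oo)%E}.
Proof.
pose a := (al + beta) / 2.
have ala : al < a by move: alb; rewrite /a; lra.
have ab : a < beta by move: alb; rewrite /a; lra.
have [||h1 h2] := @kolmogorov R T T0 E _ Omega P unit (fun=> cpX) al a (ltW al0) ala.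
- have h := all_moments_comp (fun _ : unit => dyadic T0 0 0)
    (X_moments T0 mX X_holder (lt_trans al0 alb)).
  apply: all_moments_le h => [*|_ w]; first exact: normr_ge0.
  by rewrite /cpX cpathE.
- have h := all_moments_comp (fun x : unit * (timeI T * timeI T) => x.2)
    (X_increment_moments T0 sepE mX X_holder (lt_trans al0 ala) ab).
  apply: all_moments_le h => [x w|x w]; first by rewrite divr_ge0// powR_ge0.
  by rewrite /cpX cpathE// mulrC.
by split=> //; exact: (h2 tt).
Qed.

Lemma composition_error_bound (rho : R) : 0 <= rho -> al + rho < beta ->
  exists2 B : nat -> Omega -> R, all_moments P B &
    forall n, {ae P, forall w, ((n.+1%:R `^ rho)%:E *
      hn (f (cpX w) - f (cpY n w))%R <= (B n w)%:E)%E}.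
Proof.
move=> rho0 arb.
have [hXm hXf] := X_path_moments.
have [Zm Zf] := scaled_error_moments sepE beta1 mX cX X_holder mY
  Y_interpolation Y_rate (ltW al0) rho0 arb.
have [|Zm0 Zf0] := scaled_error_moments sepE beta1 mX cX X_holder mY
  Y_interpolation Y_rate (ltW al0) (lexx 0); first by rewrite addr0.
pose hX w := fine (hn (cpX w)).
pose Z0 n w := fine (hn (scaled_error X Y 0 n w)).
pose Z n w := fine (hn (scaled_error X Y rho n w)).
(* The norm of Y is at most that of X plus that of X - Y, and the latter is the scaled error with
   exponent 0. *)
exists (fun n w => c * (1 + hX w `^ r + (hX w + Z0 n w) `^ r) * Z n w).
  apply: all_momentsM; last exact: Zm.
  apply: all_momentsZ; first exact: c0.
  have hXm' : all_moments P (fun (_ : nat) w => hX w).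
    exact: (all_moments_comp (fun _ : nat => tt) hXm).
  apply: all_momentsD; last first.
    by apply: all_moments_powR; [exact: r0|exact: all_momentsD hXm' Zm0].
  apply: all_momentsD; last exact: all_moments_powR r0 hXm'.
  by apply: (all_moments_cst P (C := 1)) => _; rewrite lexx ler01.
move=> n; apply: filterS3 hXf (Zf0 n) (Zf n) => w hXw hZ0 hZ.
have fX := holder_norm_fin_num T0 hXw.
have fZ0 := holder_norm_fin_num T0 hZ0.
have fZ := holder_norm_fin_num T0 hZ.
have hYw : (hn (cpY n w) <= (hX w + Z0 n w)%:E)%E.
  rewrite /hX /Z0 EFinD (fineK fX) (fineK fZ0).
  have {1}-> : cpY n w = cpX w - scaled_error X Y 0 n w.
    by rewrite /scaled_error powRr0 scale1r subKr.
  exact: (holder_normB T0).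
have hYf : (hn (cpY n w) < +oo)%E by rewrite (le_lt_trans hYw)// ltry.
have fY := holder_norm_fin_num T0 hYf.
have k0 : 0 < n.+1%:R `^ rho :> R by rewrite powR_gt0// ltr0n.
have hX0 : 0 <= hX w by apply: fine_ge0; exact: (holder_norm_ge0 T0).
have Z00 : 0 <= Z0 n w by apply: fine_ge0; exact: (holder_norm_ge0 T0).
have hY0 : 0 <= fine (hn (cpY n w)) by apply: fine_ge0; exact: (holder_norm_ge0 T0).
have hlip := holder_lipschitz_fine T0 f_lipschitz hXw hYf.
apply: (@le_trans _ _ ((c * (1 + fine (hn (cpX w)) `^ r + fine (hn (cpY n w)) `^ r))%:E *
    ((n.+1%:R `^ rho)%:E * hn (cpX w - cpY n w)%R))%E).
  rewrite muleCA; apply: lee_wpmul2l; last exact: hlip.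
  by rewrite lee_fin ltW.
rewrite [leRHS]EFinM; apply: lee_pmul.
- by rewrite lee_fin mulr_ge0// !addr_ge0 ?powR_ge0.
- apply: mule_ge0; last exact: (holder_norm_ge0 T0).
  by rewrite lee_fin ltW.
- rewrite lee_fin; apply: ler_wpM2l; first exact: c0.
  rewrite lerD2l; apply: ge0_ler_powR; rewrite ?nnegrE//.
    exact: addr_ge0.
  by rewrite -lee_fin (fineK fY).
- by rewrite /Z (fineK fZ); exact: (holder_normZ_ge T0).
Qed.

Lemma composition_bound :
  exists2 B : Omega -> R, all_moments P (fun _ : unit => B) &
    {ae P, forall w, (hn (f (cpX w)) <= (B w)%:E)%E}.
Proof.
have [hXm hXf] := X_path_moments.
pose hX w := fine (hn (cpX w)); pose k := fine (hn (f (0 : contfun (timeI T) E)%R)).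
have k0 : 0 <= k by rewrite fine_ge0// holder_norm_ge0.
exists (fun w => c * (1 + hX w `^ r + 0 `^ r) * hX w + k).
  apply: all_momentsD; last first.
    by apply: (all_moments_cst P (C := k)) => _; rewrite k0/=.
  apply: all_momentsM; last exact: hXm.
  apply: all_momentsZ; first exact: c0.
  apply: all_momentsD; first apply: all_momentsD.
  - by apply: (all_moments_cst P (C := 1)) => _; rewrite lexx ler01.
  - exact: all_moments_powR r0 hXm.
  - by apply: (all_moments_cst P (C := 0 `^ r)) => _; rewrite powR_ge0/=.
apply: filterS hXf => w hXw.
have h0 : (hn (0 : contfun (timeI T) E)%R < +oo)%E by rewrite holder_norm0// ltry.
have fX := holder_norm_fin_num T0 hXw.
have f0 : hn (f (0 : contfun (timeI T) E)%R) \is a fin_num.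
  by rewrite ge0_fin_numE ?holder_norm_ge0// (holder_f0_lty T0 f_lipschitz).
have := holder_lipschitz_fine T0 f_lipschitz hXw h0.
rewrite (holder_norm0 T0) subr0 => hlip.
have {1}-> : f (cpX w) = (f (cpX w) - f (0 : contfun (timeI T) E)%R) + f (0 : contfun (timeI T) E)%R.
  by rewrite subrK.
apply: le_trans (holder_normD _ _ _) _; rewrite EFinD; apply: leeD.
  by apply: le_trans hlip _; rewrite [leRHS]EFinM /hX (fineK fX).
by rewrite /k (fineK f0).
Qed.

Lemma composition_approximation_bound :
  exists2 B : nat -> Omega -> R, all_moments P B &
    forall n, {ae P, forall w, (hn (f (cpY n w)) <= (B n w)%:E)%E}.
Proof.
have [|B Bm Bf] := composition_error_bound (lexx 0); first by rewrite addr0.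
have [B' Bm' Bf'] := composition_bound.
exists (fun n w => B' w + B n w).
  by apply: all_momentsD => //; exact: (all_moments_comp (fun _ : nat => tt) Bm').
move=> n; have := Bf n; apply: filterS2 Bf' => w h1; rewrite powRr0 mul1e => h2.
rewrite EFinD.
have {1}-> : f (cpY n w) = f (cpX w) - (f (cpX w) - f (cpY n w)) by rewrite subKr.
apply: le_trans (holder_normB T0 _ _ _) _.
by rewrite leeD.
Qed.

End composition_error.

(** * Multilevel estimator *)

Section identical_laws.
Context d (Omega : measurableType d) (R : realType) (P : probability Omega R).
Context d' (S : measurableType d') (I : choiceType) (D : set I).
Variable theta : I -> Omega -> S.
Hypothesis mtheta : forall i, D i -> measurable_fun setT (theta i).

Lemma identically_distributed_integral i j (phi : S -> \bar R) :
  identically_distributed_on P D theta -> D i -> D j ->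
  measurable_fun setT phi -> (forall s, (0 <= phi s)%E) ->
  (\int[P]_w phi (theta i w) = \int[P]_w phi (theta j w))%E.
Proof.
move=> idP Di Dj mphi phi0.
have mi := mtheta Di; have mj := mtheta Dj.
have hi := @ge0_integral_pushforward _ _ _ _ _ _ mi P setT phi measurableT mphi
  (fun s _ => phi0 s).
have hj := @ge0_integral_pushforward _ _ _ _ _ _ mj P setT phi measurableT mphi
  (fun s _ => phi0 s).
rewrite !preimage_setT in hi hj; rewrite -[LHS]hi -[RHS]hj.
by apply: eq_measure_integral => A mA _; exact: idP.
Qed.

Lemma independent_on_comp d'' (U : measurableType d'') (G : S -> U) :
  measurable_fun setT G -> independent_on P D theta ->
  independent_on P D (fun i => G \o theta i).
Proof.
move=> mG ind J B uJ JD mB; apply: (ind J (fun i => G @^-1` B i) uJ JD) => i.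
by rewrite -[X in measurable X]setTI; exact: mG.
Qed.

(** [centered] depends only on the law, so it needs checking at a single index. *)
Lemma indep_centered_comp (E : normedModType R) (G : S -> E) j :
  independent_on P D theta -> identically_distributed_on P D theta ->
  separable E -> measurable_fun setT (G : S -> borel E) -> D j ->
  centered P (fun w => G (theta j w)) ->
  indep_centered P D (fun i w => G (theta i w)).
Proof.
move=> ind idP sepE mG Dj cj; split.
- by move=> i Di; apply: (@measurableT_comp _ _ _ _ _ _ (G : S -> borel E)) => //; exact: mtheta.
- exact: (@independent_on_comp _ (borel E) (G : S -> borel E)).
- move=> i Di u; apply: le_trans (cj u) _.
  rewrite (@identically_distributed_integral j i (fun s => `|u + G s|%:E))//.
  apply: (@enorm_measurable _ _ _ _ (fun s => u + G s)).
  by apply: borel_measurableD => //; exact: borel_measurable_cst.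
Qed.

End identical_laws.

(** * Functionals of the product path space *)

Section path_functionals.
Context {R : realType} {T : R} (T0 : 0 < T) (E : normedModType R).
Hypothesis sepE : separable E.
Variable f : contfun (timeI T) E -> contfun (timeI T) E.
Hypothesis f_measurable : measurable_fun setT
  (f : borel (contfun (timeI T) E) -> borel (contfun (timeI T) E)).

(** Only the N+1 grid values are read, so this is measurable for the product sigma-algebra, in which
    independence and equality of laws are assumed. *)
Definition path_functional N (y : pathspace (timeI T) E) : contfun (timeI T) E :=
  f (interp_path (fun i : 'I_N.+1 => y (grid T0 i))).

Lemma path_eval_measurable (t : timeI T) :
  measurable_fun setT ((fun y : pathspace (timeI T) E => y t) : _ -> borel E).
Proof.
move=> _ B mB; rewrite setTI; apply: sub_sigma_algebra; by exists t, B.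
Qed.

Lemma path_functional_measurable N : measurable_fun setT
  (path_functional N : pathspace (timeI T) E -> borel (contfun (timeI T) E)).
Proof.
apply: (@measurableT_comp _ _ _ _ _ _
  (f : borel (contfun (timeI T) E) -> borel (contfun (timeI T) E))) => //.
apply: (@interp_path_measurable _ _ T0 _ sepE _ (pathspace (timeI T) E)) => i.
exact: path_eval_measurable.
Qed.

Lemma process_measurable d (Omega : measurableType d) (Z : timeI T -> Omega -> E) :
  stochastic_process Z ->
  measurable_fun setT ((fun w => Z ^~ w) : Omega -> pathspace (timeI T) E).
Proof.
move=> mZ.
apply: (@measurability _ _ _ (pathspace (timeI T) E) _ _ (@cylinder (timeI T) E)) => //.
move=> _ [_ [t [B [mB ->]]] <-]; rewrite setTI.
by have := mZ t measurableT _ mB; rewrite setTI.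
Qed.

Lemma path_pair_measurable d (Omega : measurableType d) (Z1 Z2 : timeI T -> Omega -> E) :
  stochastic_process Z1 -> stochastic_process Z2 ->
  measurable_fun setT (path_pair Z1 Z2).
Proof.
move=> m1 m2.
exact: (@measurable_fun_pair _ _ _ Omega (pathspace (timeI T) E) (pathspace (timeI T) E)
  _ _ (process_measurable m1) (process_measurable m2)).
Qed.

End path_functionals.

(** * Normalized sums of independent copies *)

Section iid_average.
Context d (Omega : measurableType d) (R : realType) (P : probability Omega R).
Context d' (S : measurableType d') (E : normedModType R).
Hypotheses (sepE : separable E) (type2E : has_type E 2).
Notation D := [set lk : nat * nat | (0 < lk.2)%N].

(** [type2_sum_moment] at order 2(q+1) gives n^(q+1), which the normalization cancels exactly. The
    index K carries the level and the functional, over which the bound is uniform. *)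
Lemma iid_average_moments (K : Type) (theta : K -> nat * nat -> Omega -> S)
    (G : K -> S -> E) (row : K -> nat) :
  (forall x i, D i -> measurable_fun setT (theta x i)) ->
  (forall x, independent_on P D (theta x)) ->
  (forall x, identically_distributed_on P D (theta x)) ->
  (forall x, measurable_fun setT (G x : S -> borel E)) ->
  (forall x, centered P (fun w => G x (theta x (0, 1)%N w))) ->
  all_moments P (fun x w => `|G x (theta x (0, 1)%N w)|) ->
  all_moments P (fun (x : nat * K) w => (Num.sqrt x.1.+1%:R)^-1 *
    `|\sum_(1 <= k < x.1.+2) G x.2 (theta x.2 (row x.2, k) w)|).
Proof.
move=> mtheta ind idP mG cG [_ hG].
have D01 : D (0, 1)%N by [].
apply: (@all_moments_eventually _ _ _ _ _ _ 0) => [x w|q _].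
  by rewrite mulr_ge0// invr_ge0 sqrtr_ge0.
have [C C0 CP] := type2_sum_moment q sepE type2E.
have [A AP] := hG (q.+1 * 2)%N.
exists (1 + C * A) => -[n x] /=.
have mxi k : (0 < k)%N ->
    measurable_fun setT ((fun w => G x (theta x (row x, k) w)) : Omega -> borel E).
  move=> k0; apply: (@measurableT_comp _ _ _ _ _ _ (G x : S -> borel E)) => //.
  exact: mtheta.
pose s := [seq (row x, k) | k <- index_iota 1 n.+2].
have sums w : \sum_(1 <= k < n.+2) G x (theta x (row x, k) w) =
    \sum_(i <- s) G x (theta x i w) by rewrite big_map.
have us : uniq s by rewrite map_inj_uniq ?iota_uniq// => i j [].
have sD : [set` s] `<=` D.
  by move=> _ /= /mapP[k + ->]; rewrite mem_index_iota => /andP[].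
have ss : size s = n.+1 by rewrite size_map size_iota subn1.
have ic := indep_centered_comp (mtheta x) (ind x) (idP x) sepE (mG x) D01 (cG x).
have moment i : i \in s ->
    (\int[P]_w (`|G x (theta x i w)| ^+ (q.+1 * 2))%:E <= A%:E)%E.
  move=> /sD Di; rewrite (identically_distributed_integral (mtheta x)
    (phi := fun s => (`|G x s| ^+ (q.+1 * 2))%:E) (idP x) Di D01).
  - by apply: integral_le_ub_mean => // w; rewrite lee_fin exprn_ge0.
  - apply/measurable_EFinP; apply: measurable_funX.
    exact: (@borel_measurable_norm _ _ _ E (G x)).
  - by move=> s'; rewrite lee_fin exprn_ge0.
have := CP _ _ P _ D _ s A ic us sD moment; rewrite ss => hsum.
pose a : R := (Num.sqrt n.+1%:R)^-1.
have aE : a ^+ (q.+1 * 2) = (n.+1%:R ^+ q.+1)^-1.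
  by rewrite /a exprVn mulnC exprM sqr_sqrtr ?ler0n.
have a0 : 0 <= a by rewrite invr_ge0 sqrtr_ge0.
apply: (@ub_mean_le _ _ _ P _ (fun w => (1 + a ^+ (q.+1 * 2) *
   `|\sum_(i <- s) G x (theta x i w)| ^+ (q.+1 * 2))%:E)
   _ (1 + a ^+ (q.+1 * 2) * (C * n.+1%:R ^+ q.+1 * A))).
- move=> w; rewrite lee_fin sums -exprMn.
  by apply: ler_exprn1D; rewrite ?mulr_ge0//; exact: leq_trans (leqnSn q) (leq_pmulr _ _).
- by rewrite aE [C * _]mulrC -(mulrA _ C) mulKf// expf_neq0// pnatr_eq0.
- under eq_fun do rewrite EFinD EFinM.
  apply: ub_meanD; first by apply: ub_mean_cst.
  apply: ub_meanZ; first by rewrite exprn_ge0.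
  apply: ub_mean_integral => //.
  apply/measurable_EFinP; apply: measurable_funX.
  apply: (@borel_measurable_norm _ _ _ E (fun w => \sum_(i <- s) G x (theta x i w))).
  (* Measurability is known only for k > 0; the guard extends the summands to all natural k. *)
  have -> : (fun w => \sum_(i <- s) G x (theta x i w)) =
      (fun w => \sum_(k <- index_iota 1 n.+2)
        (if (0 < k)%N then G x (theta x (row x, k) w) else 0)).
    apply/funext => w; rewrite big_map big_seq [RHS]big_seq.
    by apply: eq_bigr => k; rewrite mem_index_iota => /andP[-> _].
  apply: (@borel_measurable_sum _ E _ _ sepE nat _
    (fun k w => if (0 < k)%N then G x (theta x (row x, k) w) else 0)) => -[|k].
    exact: borel_measurable_cst.
  exact: mxi.
Qed.

End iid_average.

(** * Convergence rate and summation over levels *)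

Section level_weights.
Context {R : realType}.

Lemma geometric_mix_le (a b : R) L : 0 < a -> 0 < b -> b < a ->
  \sum_(0 <= l < L.+1) a ^+ (L - l) * b ^+ l <= (1 - b / a)^-1 * a ^+ L.
Proof.
move=> a0 b0 ba.
have ba1 : b / a < 1 by rewrite ltr_pdivrMr// mul1r.
have h : \sum_(0 <= l < L.+1) a ^+ (L - l) * b ^+ l =
    (\sum_(0 <= l < L.+1) (b / a) ^+ l) * a ^+ L.
  rewrite mulr_suml; apply: eq_big_nat => l /andP[_ lL].
  have {2}-> : L = (L - l + l)%N by rewrite subnK.
  by rewrite exprD expr_div_n [a ^+ _ * a ^+ l]mulrC mulrA divfK ?expf_neq0 ?gt_eqF// mulrC.
rewrite h; apply: ler_wpM2r; first by rewrite exprn_ge0// ltW.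
by apply: geometric_sum_le; rewrite ?divr_ge0 ?ltW.
Qed.

End level_weights.

Section convergence_rate.
Context {R : realType}.
Variable rho : R.

Definition rate (L : nat) : R :=
  2 `^ (L%:R * Num.min rho 2^-1) * L%:R `^ (- (rho == 2^-1)%:R).

Lemma rate_gt0 L : (0 < L)%N -> 0 < rate L.
Proof. by move=> L0; rewrite mulr_gt0// powR_gt0// ltr0n. Qed.

Lemma powR2_natmul (x : R) n : 2 `^ (n%:R * x) = (2 `^ x) ^+ n.
Proof. by rewrite mulrC powRrM powR_mulrn// powR_ge0. Qed.

Lemma powR_expn2 (x : R) n : (2 ^ n)%N%:R `^ x = (2 `^ x) ^+ n.
Proof. by rewrite natrX -powR_mulrn// -powRrM powR2_natmul. Qed.

(** The bias decays like 2^(-L rho), so the rate must not exceed 2^(L rho). *)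
Lemma rate_le L : (0 < L)%N -> rate L <= (2 ^ L)%N%:R `^ rho.
Proof.
move=> L0; rewrite powR_expn2 -powR2_natmul -[leRHS]mulr1.
apply: ler_pM; rewrite ?powR_ge0//.
  by rewrite ler_powR ?ler1n// ler_wpM2l// ge_min lexx.
by rewrite -[leRHS](powRr0 L%:R) ler_powR ?ler1n// oppr_le0 ler0n.
Qed.

(** The rate times the standard deviation factor of an average of 2^(L-l) terms times the size 2^(-l
    rho) of one term. *)
Definition level_weight (L l : nat) : R :=
  rate L * ((Num.sqrt (2 ^ (L - l))%N%:R)^-1 * ((2 ^ l)%N%:R `^ rho)^-1).

Lemma level_weight_ge0 L l : 0 <= level_weight L l.
Proof. by rewrite !mulr_ge0 ?powR_ge0// invr_ge0 ?sqrtr_ge0 ?powR_ge0. Qed.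

(** The sum of a^(L-l) b^l, with a = 2^(-1/2) and b = 2^(-rho), is dominated by the finest level if
    rho < 1/2 and by the coarsest if rho > 1/2. At rho = 1/2 all L+1 terms agree, and (L+1)/L <=
    2. *)
Lemma level_weight_sum_le : exists2 W : R, 0 < W &
  forall L, (0 < L)%N -> \sum_(0 <= l < L.+1) level_weight L l <= W.
Proof.
pose a : R := (2 `^ 2^-1)^-1; pose b : R := (2 `^ rho)^-1.
have a0 : 0 < a by rewrite invr_gt0 powR_gt0.
have b0 : 0 < b by rewrite invr_gt0 powR_gt0.
have sumE L : \sum_(0 <= l < L.+1) level_weight L l =
    rate L * \sum_(0 <= l < L.+1) a ^+ (L - l) * b ^+ l.
  rewrite mulr_sumr; apply: eq_bigr => l _; congr (_ * (_ * _)).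
    by rewrite -powR12_sqrt// powR_expn2 -exprVn.
  by rewrite powR_expn2 -exprVn.
have powlt (x y : R) : x < y -> 2 `^ x < 2 `^ y by move=> xy; rewrite /powR pnatr_eq0/= ltr_expR ltr_pM2r// ln_gt0// ltr1n.
have [rhalf|rhalf|rhalf] := ltrgtP rho 2^-1.
- have ab : a < b by rewrite ltf_pV2 ?posrE ?powR_gt0// powlt.
  have d0 : 0 < (1 - a / b)^-1 by rewrite invr_gt0 subr_gt0 ltr_pdivrMr// mul1r.
  exists (1 - a / b)^-1 => // L L0; rewrite sumE /rate lt_eqF// oppr0 powRr0 mulr1.
  rewrite min_l; last exact: ltW.
  rewrite powR2_natmul -ler_pdivlMl ?exprn_gt0 ?powR_gt0//.
  rewrite -exprVn -/b mulrC big_nat_rev /=.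
  rewrite (_ : \sum_(_ <= _ < _) _ = \sum_(0 <= l < L.+1) b ^+ (L - l) * a ^+ l).
    exact: geometric_mix_le.
  by apply: eq_big_nat => l /andP[_ lL]; rewrite add0n subSS subKn// mulrC.
- have ba : b < a by rewrite ltf_pV2 ?posrE ?powR_gt0// powlt.
  have d0 : 0 < (1 - b / a)^-1 by rewrite invr_gt0 subr_gt0 ltr_pdivrMr// mul1r.
  exists (1 - b / a)^-1 => // L L0; rewrite sumE /rate gt_eqF// oppr0 powRr0 mulr1.
  rewrite min_r; last exact: ltW.
  rewrite powR2_natmul -ler_pdivlMl ?exprn_gt0 ?powR_gt0//.
  by rewrite -exprVn -/a mulrC; exact: geometric_mix_le.
- exists 2 => // L L0; rewrite sumE /rate rhalf eqxx minxx powR2_natmul powR_inv1//.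
  rewrite /b rhalf -/a (_ : \sum_(_ <= _ < _) _ = L.+1%:R * a ^+ L).
    have aV : (2 `^ 2^-1) ^+ L * a ^+ L = 1 :> R.
      by rewrite -exprMn mulfV ?expr1n// gt_eqF// powR_gt0.
    rewrite [_ * a ^+ L]mulrC mulrACA aV mul1r ler_pdivrMl ?ltr0n//.
    rewrite -natrM ler_nat muln2.
    by rewrite -addnn -addn1 leq_add2l.
  rewrite (@eq_big_nat _ _ _ _ _ _ (fun=> a ^+ L)) => [|l /andP[_ lL]].
    by rewrite sumr_const_nat subn0 mulr_natl.
  by rewrite -exprD subnK.
Qed.

End convergence_rate.

(** * Linear functionals detecting Hoelder norms *)

Section holder_functional.
Context {R : realType} {T : R} (T0 : 0 < T) (E : normedModType R).
Variable al : R.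
Implicit Types v : contfun (timeI T) E.

(** These functionals reduce Hoelder estimates for random paths to moment bounds in
    [E], where type 2 is available. *)
Definition holder_functional (j : option (timeI T * timeI T)) v : E :=
  if j is Some tu then (`|time_val tu.1 - time_val tu.2| `^ al)^-1 *: (v tu.1 - v tu.2)
  else v (dyadic T0 0 0).

Lemma holder_functional_linear j : linear (holder_functional j).
Proof.
case: j => [[t u]|] k v w //=.
rewrite scalerA mulrC -scalerA -scalerDr; congr (_ *: _).
by rewrite scalerBr addrACA -opprD.
Qed.

HB.instance Definition _ j := GRing.isLinear.Build R (contfun (timeI T) E) E _
  (holder_functional j) (holder_functional_linear j).

Lemma holder_functionalZ j (k : R) v :
  holder_functional j (k *: v) = k *: holder_functional j v.
Proof. exact: linearZ. Qed.

Lemma holder_functionalB j v w :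
  holder_functional j (v - w) = holder_functional j v - holder_functional j w.
Proof. exact: linearB. Qed.

Lemma holder_functional_sum j (I : Type) (s : seq I) (v : I -> contfun (timeI T) E) :
  holder_functional j (\sum_(i <- s) v i) = \sum_(i <- s) holder_functional j (v i).
Proof. exact: linear_sum. Qed.

Lemma holder_functional_le j v :
  (`|holder_functional j v|%:E <= holder_norm (@enorm R E) al v)%E.
Proof.
case: j => [[t u]|] /=; last first.
  by apply: (@le_holder_norm _ _ T0 _ (@enorm R E) al v (dyadic T0 0 0)) => x; rewrite lee_fin.
have [->|tu] := eqVneq t u.
  by rewrite [v u - v u]subrr scaler0 normr0 (holder_norm_ge0 T0).
apply: le_trans (holder_norm_ge_incr al v tu).
by rewrite normrZ ger0_norm ?invr_ge0 ?powR_ge0// mulrC.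
Qed.

Lemma holder_functional_bounded j : exists2 K : R, 0 <= K &
  forall v, `|holder_functional j v| <= K * `|v|.
Proof.
case: j => [[t u]|] /=; last first.
  by exists 1 => // v; rewrite mul1r; exact: contfun_norm_ub.
exists ((`|time_val t - time_val u| `^ al)^-1 * 2).
  by rewrite mulr_ge0// invr_ge0 powR_ge0.
move=> v; rewrite normrZ ger0_norm ?invr_ge0 ?powR_ge0// -mulrA.
rewrite ler_wpM2l ?invr_ge0 ?powR_ge0// mulr2n mulrDl mul1r.
by rewrite (le_trans (ler_normB _ _))// lerD// contfun_normE contfun_norm_ub.
Qed.

End holder_functional.

(** * Bias and fluctuations of the multilevel estimator *)

Section multilevel.
Context {R : realType} {T : R} (T0 : 0 < T).
Context d (Omega : measurableType d) (P : probability Omega R).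
Context (E : completeNormedModType R) (sepE : separable E) (type2E : has_type E 2).
Variables al rho : R.
Notation V := (contfun (timeI T) E).
Notation hn := (holder_norm (@enorm R E) al).
Notation D := [set lk : nat * nat | (0 < lk.2)%N].
Variables (fX : Omega -> V) (fY : nat -> Omega -> V).
Hypothesis mfX : measurable_fun setT (fX : Omega -> borel V).
Hypothesis mfY : forall n, measurable_fun setT (fY n.+1 : Omega -> borel V).
Variables (B BY : nat -> Omega -> R) (BX : Omega -> R).
Hypotheses (Bm : all_moments P B) (BYm : all_moments P BY)
  (BXm : all_moments P (fun _ : unit => BX)).
Hypothesis hB : forall n, {ae P, forall w,
  ((n.+1%:R `^ rho)%:E * hn (fX w - fY n.+1 w)%R <= (B n w)%:E)%E}.
Hypothesis hBY : forall n, {ae P, forall w, (hn (fY n.+1 w) <= (BY n w)%:E)%E}.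
Hypothesis hBX : {ae P, forall w, (hn (fX w) <= (BX w)%:E)%E}.

Lemma bochner_integral_bound (g : Omega -> V) (b : Omega -> R) :
  measurable_fun setT (g : Omega -> borel V) -> all_moments P (fun _ : unit => b) ->
  {ae P, forall w, (hn (g w) <= (b w)%:E)%E} ->
  is_bochner_integral P g (bochner_integral P g).
Proof.
move=> mg [_ /(_ 1%N)[C /(_ tt) bC]] hg.
have [|||v gv] := @is_bochner_integral_exists _ _ _ P V g.
- exact: contfun_separable.
- exact: mg.
- apply: (@le_lt_trans _ _ C%:E); last exact: ltry.
  apply: integral_le_ub_mean => [w|]; first by rewrite lee_fin.
  apply: ub_mean_ae bC; apply: filterS hg => w; rewrite expr1.
  exact: le_trans (contfun_norm_holder T0 _ _).
- exact: bochner_integralP gv.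
Qed.

Let IX : is_bochner_integral P fX (bochner_integral P fX).
Proof. exact: bochner_integral_bound BXm hBX. Qed.

Let m n := bochner_integral P (fY n).

Let IY n : (0 < n)%N -> is_bochner_integral P (fY n) (m n).
Proof.
case: n => [|n _]; first by move=> n0; exfalso; move: n0; rewrite ltnn.
have BYn : all_moments P (fun _ : unit => BY n).
  exact: (all_moments_comp (fun _ : unit => n) BYm).
exact: (bochner_integral_bound (mfY n) BYn (hBY n)).
Qed.

Variables (d' : measure_display) (S : measurableType d').
Variables (theta : nat -> nat * nat -> Omega -> S) (F : nat -> S -> V).
Hypothesis mtheta : forall l i, D i -> measurable_fun setT (theta l i).
Hypothesis theta_independent : forall l, independent_on P D (theta l).
Hypothesis theta_id : forall l, identically_distributed_on P D (theta l).
Hypothesis mF : forall l, measurable_fun setT (F l : S -> borel V).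
Hypothesis F0E : forall w, F 0 (theta 0 (0, 1)%N w) = fY 1 w.
Hypothesis FSE : forall l w, F l.+1 (theta l.+1 (0, 1)%N w) =
  fY (2 ^ l.+1)%N w - fY (2 ^ l)%N w.

(** Level means are written as differences of Bochner integrals, so that they telescope by
    definition. *)
Let mu l := if l is l'.+1 then m (2 ^ l)%N - m (2 ^ l')%N else m 1.

Let c (l : nat) : R := (2 ^ l)%N%:R `^ rho.

Let c_gt0 l : 0 < c l.
Proof. by rewrite powR_gt0// ltr0n expn_gt0. Qed.

Let c_ge0 l : (0 <= (c l)%:E)%E.
Proof. by rewrite lee_fin ltW. Qed.

Lemma level_jensen l j (u : E) :
  (`|u + c l *: holder_functional T0 al j (mu l)|%:E <=
   \int[P]_w `|u + c l *: holder_functional T0 al j (F l (theta l (0, 1)%N w))|%:E)%E.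
Proof.
have [K K0 LK] := @holder_functional_bounded R T T0 E al j.
pose L : {linear V -> E} := (c l \*: holder_functional T0 al j)%R.
have cK0 : 0 <= c l * K by rewrite mulr_ge0// ltW.
have LcK v : `|L v| <= c l * K * `|v|.
  by rewrite /L /= normrZ gtr0_norm// -mulrA; apply: ler_wpM2l => //; exact: ltW.
case: l => [|l] in L cK0 LcK *.
  (* At level 0 the zero function serves as the second integrand. *)
  have := bochner_jensen u cK0 LcK (IY (ltn0Sn 0)) (@is_bochner_integral0 _ _ _ P V).
  rewrite subr0; under eq_integral do rewrite subr0 -F0E; exact.
have := bochner_jensen u cK0 LcK (IY (expn_gt0 2 l.+1)) (IY (expn_gt0 2 l)).
by under eq_integral do rewrite -FSE.
Qed.

(** A correction is a difference of two errors against f(X); the coarser one has half the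
    resolution, whence 2^rho. [B] and [BY] are indexed by N-1, which explains the predecessors. *)
Lemma level_bound : exists2 b : nat -> Omega -> R, all_moments P b &
  forall l, {ae P, forall w, ((c l)%:E * hn (F l (theta l (0, 1)%N w)) <= (b l w)%:E)%E}.
Proof.
exists (fun l w => BY 0%N w + (B (2 ^ l).-1 w + 2 `^ rho * B (2 ^ l.-1).-1 w)).
  apply: all_momentsD; first exact: (all_moments_comp (fun _ : nat => 0%N) BYm).
  apply: all_momentsD; first exact: (all_moments_comp (fun l : nat => (2 ^ l).-1) Bm).
  apply: all_momentsZ; first exact: powR_ge0.
  exact: (all_moments_comp (fun l : nat => (2 ^ l.-1).-1) Bm).
have B0 n w : 0 <= B n w by case: Bm.
have BY0 n w : 0 <= BY n w by case: BYm.
case=> [|l].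
  apply: filterS (hBY 0) => w; rewrite F0E /c expn0 powR1 mul1e => /le_trans; apply.
  by rewrite lee_fin lerDl addr_ge0// mulr_ge0// powR_ge0.
apply: filterS2 (hB (2 ^ l.+1).-1) (hB (2 ^ l).-1) => w.
rewrite !prednK ?expn_gt0// FSE => h1 h2.
have -> : fY (2 ^ l.+1)%N w - fY (2 ^ l)%N w =
    (fX w - fY (2 ^ l)%N w) - (fX w - fY (2 ^ l.+1)%N w).
  by rewrite opprB [RHS]addrC subrKA.
apply: (@le_trans _ _ ((c l.+1)%:E * (hn (fX w - fY (2 ^ l)%N w)%R +
    hn (fX w - fY (2 ^ l.+1)%N w)%R))%E).
  by rewrite lee_wpmul2l ?c_ge0//; exact: (holder_normB T0).
rewrite ge0_muleDr ?(holder_norm_ge0 T0)// addeC EFinD.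
rewrite -[leLHS]add0e; apply: leeD; first by rewrite lee_fin.
rewrite EFinD; apply: leeD => //=.
have -> : c l.+1 = 2 `^ rho * c l.
  by rewrite /c expnS natrM powRM.
by rewrite [in leLHS]EFinM -muleA EFinM lee_wpmul2l// lee_fin powR_ge0.
Qed.

(** [c l] compensates the decay of the increments of level [l], so that the family
    [G] has moments bounded uniformly in the level. *)
Let G (x : nat * option (timeI T * timeI T)) (s : S) : E :=
  c x.1 *: holder_functional T0 al x.2 (F x.1 s - mu x.1).

Lemma level_average_moments :
  all_moments P (fun (x : nat * (nat * option (timeI T * timeI T))) w =>
    (Num.sqrt x.1.+1%:R)^-1 *
    `|\sum_(1 <= k < x.1.+2) G x.2 (theta x.2.1 (x.2.1, k) w)|).
Proof.
apply: (@iid_average_moments _ _ _ P _ S E sepE type2E _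
   (fun x => theta x.1) G (fun x => x.1)).
- by move=> x i; exact: mtheta.
- by move=> x; exact: theta_independent.
- by move=> x; exact: theta_id.
- move=> x; have [K K0 LK] := @holder_functional_bounded R T T0 E al x.2.
  apply: borel_measurableZ.
  apply: (@measurableT_comp _ _ _ _ _ _
    ((holder_functional T0 al x.2 : V -> E) : borel V -> borel E) _
    ((fun s => F x.1 s - mu x.1) : S -> borel V)).
    by apply: continuous_borel_measurable; exact: bounded_linear_continuous K0 LK.
  apply: borel_measurableB; first exact: contfun_separable.
    exact: mF.
  exact: borel_measurable_cst.
- move=> x u; rewrite /G.
  have := level_jensen x.1 x.2 (u - c x.1 *: holder_functional T0 al x.2 (mu x.1)).
  rewrite subrK => /le_trans; apply.
  rewrite le_eqVlt; apply/orP; left; apply/eqP/eq_integral => w _.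
  by rewrite holder_functionalB scalerBr addrAC addrA.
- have [b bm hb] := level_bound.
  (* The scaled means are bounded by the moments of the scaled levels, so centring preserves the
     uniform bounds. *)
  have [C CP] : exists C : R, forall x : nat * option (timeI T * timeI T),
      `|c x.1 *: holder_functional T0 al x.2 (mu x.1)| <= C.
    have [_ /(_ 1%N)[C CP]] := bm.
    exists C => x; have := level_jensen x.1 x.2 0; rewrite add0r -lee_fin.
    move/le_trans; apply; apply: integral_le_ub_mean => [w|]; first by rewrite lee_fin.
    apply: ub_mean_ae (CP x.1); apply: filterS (hb x.1) => w; rewrite expr1.
    apply: le_trans; rewrite add0r normrZ gtr0_norm// EFinM lee_wpmul2l ?c_ge0//.
    exact: holder_functional_le.
  apply: (@all_moments_ae _ _ _ P _ _ (fun x w => b x.1 w + C)) => [//|x|].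
    apply: filterS (hb x.1) => w hw; rewrite /G holder_functionalB scalerBr.
    apply: le_trans (ler_normB _ _) _; apply: lerD => //.
    rewrite -lee_fin; apply: le_trans hw.
    rewrite normrZ gtr0_norm// EFinM lee_wpmul2l ?c_ge0//.
    exact: holder_functional_le.
  apply: all_momentsD; first exact: (all_moments_comp fst bm).
  apply: (all_moments_cst P (C := C)) => x; rewrite lexx andbT.
  by apply: le_trans (CP (0%N, None)); exact: normr_ge0.
Qed.

Lemma sum_level_mean L : \sum_(0 <= l < L.+1) mu l = m (2 ^ L)%N.
Proof.
elim: L => [|L IH]; first by rewrite big_nat1.
have -> : \sum_(0 <= l < L.+2) mu l = \sum_(0 <= l < L.+1) mu l + mu L.+1.
  exact: big_nat_recr.
rewrite IH -[mu L.+1]/(m (2 ^ L.+1)%N - m (2 ^ L)%N).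
by move: (m (2 ^ L)%N) (m (2 ^ L.+1)%N) => x y; rewrite addrC subrK.
Qed.

(** The level means add up to the mean on the finest level, so inserting them separates the bias
    from centred averages. *)
Lemma multilevel_decomposition (x : V) (a : nat -> nat -> V) L :
  x - (\sum_(1 <= k < (2 ^ L).+1) (2 ^ L)%N%:R^-1 *: a 0%N k)
    - (\sum_(1 <= l < L.+1) \sum_(1 <= k < (2 ^ (L - l)).+1)
        (2 ^ (L - l))%N%:R^-1 *: a l k) =
  (x - m (2 ^ L)%N) - \sum_(0 <= l < L.+1) (2 ^ (L - l))%N%:R^-1 *:
    \sum_(1 <= k < (2 ^ (L - l)).+1) (a l k - mu l).
Proof.
have levelE l : (2 ^ (L - l))%N%:R^-1 *: (\sum_(1 <= k < (2 ^ (L - l)).+1) (a l k - mu l)) =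
    (\sum_(1 <= k < (2 ^ (L - l)).+1) (2 ^ (L - l))%N%:R^-1 *: a l k) - mu l.
  rewrite sumrB scalerBr scaler_sumr sumr_const_nat subSS subn0.
  by rewrite -[mu l *+ _]scaler_nat scalerA mulVf ?scale1r.
under [in RHS]eq_bigr do rewrite levelE.
rewrite sumrB sum_level_mean opprB addrA subrK.
have -> : \sum_(0 <= l < L.+1) \sum_(1 <= k < (2 ^ (L - l)).+1)
    (2 ^ (L - l))%N%:R^-1 *: a l k =
  \sum_(1 <= k < (2 ^ L).+1) (2 ^ L)%N%:R^-1 *: a 0%N k +
  \sum_(1 <= l < L.+1) \sum_(1 <= k < (2 ^ (L - l)).+1)
    (2 ^ (L - l))%N%:R^-1 *: a l k.
  by rewrite [LHS]big_ltn// subn0.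
by rewrite opprD addrA.
Qed.

Let Z L w : V := bochner_integral P fX
  - (\sum_(1 <= k < (2 ^ L).+1) (2 ^ L)%N%:R^-1 *: F 0 (theta 0 (0, k)%N w))
  - (\sum_(1 <= l < L.+1) \sum_(1 <= k < (2 ^ (L - l)).+1)
       (2 ^ (L - l))%N%:R^-1 *: F l (theta l (l, k)%N w)).

Lemma bias_le : exists C : R, forall L j, (0 < L)%N ->
  `|rate rho L *: holder_functional T0 al j (bochner_integral P fX - m (2 ^ L)%N)| <= C.
Proof.
have [_ /(_ 1%N)[C CP]] := Bm.
exists C => L j L0; have [K K0 LK] := @holder_functional_bounded R T T0 E al j.
pose Lj : {linear V -> E} := (c L \*: holder_functional T0 al j)%R.
have cK0 : 0 <= c L * K by rewrite mulr_ge0// ltW.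
have LcK v : `|Lj v| <= c L * K * `|v|.
  by rewrite /Lj /= normrZ gtr0_norm// -mulrA; apply: ler_wpM2l => //; exact: ltW.
rewrite normrZ gtr0_norm ?rate_gt0//.
apply: (@le_trans _ _ `|Lj (bochner_integral P fX - m (2 ^ L)%N)|).
  by rewrite /Lj /= normrZ gtr0_norm// ler_wpM2r// rate_le.
have := bochner_jensen 0 cK0 LcK IX (IY (expn_gt0 2 L)); rewrite add0r -lee_fin.
move/le_trans; apply; apply: integral_le_ub_mean => [w|]; first by rewrite lee_fin.
apply: ub_mean_ae (CP (2 ^ L).-1); apply: filterS (hB (2 ^ L).-1) => w.
rewrite prednK ?expn_gt0// expr1; apply: le_trans.
rewrite add0r /Lj /= normrZ gtr0_norm// EFinM lee_wpmul2l ?c_ge0//.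
exact: holder_functional_le.
Qed.

(** Each level is a weight times a normalized sum with uniform moments. The bound is proved for one
    functional at a time, uniformly, as type 2 speaks about E and not about the path space. *)
Lemma multilevel_functional_moments :
  all_moments P (fun (x : nat * option (timeI T * timeI T)) w =>
    `|holder_functional T0 al x.2 (rate rho x.1.+1 *: Z x.1.+1 w)|).
Proof.
have [C CP] := bias_le.
have [W W0 WP] := level_weight_sum_le rho.
pose h (x : nat * (nat * option (timeI T * timeI T))) w :=
    (Num.sqrt x.1.+1%:R)^-1 *
    `|\sum_(1 <= k < x.1.+2) G x.2 (theta x.2.1 (x.2.1, k) w)|.
have hm : all_moments P h by exact: level_average_moments.
pose h' (x : (nat * option (timeI T * timeI T)) * nat) w :=
  h ((2 ^ (x.1.1.+1 - x.2)).-1, (x.2, x.1.2)) w.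
have h'm : all_moments P h'.
  exact: (all_moments_comp (fun x : (nat * option (timeI T * timeI T)) * nat =>
    ((2 ^ (x.1.1.+1 - x.2)).-1, (x.2, x.1.2))) hm).
(* Dividing the weights by W gives total weight at most 1, the form required by
   [all_moments_convex]. *)
apply: (@all_moments_le _ _ _ P _ _ (fun x w => C + W *
    \sum_(l <- index_iota 0 x.1.+2) W^-1 * level_weight rho x.1.+1 l * h' (x, l) w)).
- by move=> x w; exact: normr_ge0.
- move=> [n j] w /=; set L := n.+1.
  rewrite /Z (multilevel_decomposition _ (fun l k => F l (theta l (l, k) w))).
  rewrite holder_functionalZ holder_functionalB.
  rewrite [X in `|X|]scalerBr holder_functional_sum.
  apply: le_trans (ler_normB _ _) _; apply: lerD; first exact: CP.
  rewrite mulr_sumr scaler_sumr; apply: le_trans (ler_norm_sum _ _ _) _.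
  apply: ler_sum => l _.
  rewrite -[X in W * X]mulrA (mulVKf (lt0r_neq0 W0)) /h' /h /= prednK ?expn_gt0//.
  rewrite holder_functionalZ holder_functional_sum scalerA normrZ.
  have -> : \sum_(1 <= k < (2 ^ (L - l)).+1) G (l, j) (theta l (l, k) w) =
     c l *: \sum_(1 <= k < (2 ^ (L - l)).+1)
       holder_functional T0 al j (F l (theta l (l, k) w) - mu l).
    by rewrite scaler_sumr.
  rewrite [X in _ <= _ * (_ * X)]normrZ (gtr0_norm (c_gt0 l)) -/L /level_weight -/(c l).
  have := rate_gt0 rho (ltn0Sn n); rewrite -/L; move: (rate rho L) => rL rL0.
  rewrite !mulrA; apply: ler_wpM2r; first exact: normr_ge0.
  rewrite normrM (gtr0_norm rL0) ger0_norm ?invr_ge0//.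
  rewrite -!mulrA; apply: ler_wpM2l; first exact: ltW.
  (* One inverse square root normalizes the sum and the other enters the weight; the factor [c l]
     cancels. *)
  rewrite -[X in X^-1](sqr_sqrtr (ler0n R (2 ^ (L - l)))) expr2 invfM.
  by rewrite [_ * c l]mulrC mulKf// gt_eqF.
- apply: all_momentsD.
    apply: (all_moments_cst P (C := C)) => x; rewrite lexx andbT.
    by apply: le_trans (CP 1%N None _).
  apply: all_momentsZ; first exact: ltW.
  apply: (@all_moments_convex _ _ _ P _ _ (fun x => index_iota 0 x.1.+2)
     (fun x l => W^-1 * level_weight rho x.1.+1 l)) => //.
    by move=> x l; rewrite mulr_ge0 ?level_weight_ge0// invr_ge0 ltW.
  by move=> x; rewrite -mulr_sumr ler_pdivrMl// mulr1; exact: WP.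
Qed.

End multilevel.

Section interpolated_processes.
Context {R : realType} {T : R} (T0 : 0 < T).
Context d (Omega : measurableType d) (E : completeNormedModType R).

Lemma cpath_contfun (v : contfun (timeI T) E) : cpath v = v.
Proof. by apply/val_inj; rewrite /= cpathE//; exact: contfun_continuous. Qed.

Lemma path_functionalE (f : contfun (timeI T) E -> contfun (timeI T) E)
    (Y : nat -> timeI T -> Omega -> E) N w :
  (forall N, (0 < N)%N -> forall (n : 'I_N) (t : timeI T) (omega : Omega),
    n%:R * T / N%:R <= time_val t <= n.+1%:R * T / N%:R ->
    Y N t omega =
      (n%:R + 1 - time_val t * N%:R / T) *:
        Y N (grid T0 (widen_ord (leqnSn N) n)) omega +
      (time_val t * N%:R / T - n%:R) *: Y N (grid T0 (lift ord0 n)) omega) ->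
  (0 < N)%N ->
  f (cpath (fun t => Y N t w)) = path_functional T0 f N (fun t => Y N t w).
Proof.
move=> Yi N0; rewrite /path_functional -[interp_path _]cpath_contfun.
by congr (f (cpath _)); exact: (@Y_path R T T0 d Omega E Y Yi N w N0).
Qed.

End interpolated_processes.
Theorem corollary5p15 (R : realType) (T beta alpha c r : R)
  (T0 : 0 < T) (beta0 : 0 < beta) (beta1 : beta <= 1)
  (alpha0 : 0 < alpha) (alpha_beta : alpha < beta)
  (c0 : 0 <= c) (r0 : 0 <= r)
  (d : measure_display) (Omega : measurableType d) (P : probability Omega R)
  (E : completeNormedModType R)
  (E_separable : separable E) (E_type2 : has_type E 2)
  (X : timeI T -> Omega -> E)
  (X_process : stochastic_process X)
  (X_continuous : forall omega : Omega,
     continuous (fun t : timeI T => X t omega))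
  (X_holder : forall p gamma : R, 1 <= p -> 0 <= gamma -> gamma < beta ->
     holder_space (Lp_norm P p) gamma X)
  (Y : nat -> nat -> nat -> timeI T -> Omega -> E)
  (Y_process : forall N l k : nat, (0 < N)%N -> (0 < k)%N ->
     stochastic_process (Y N l k))
  (Y_interpolation : forall N l k : nat, (0 < N)%N -> (0 < k)%N ->
     forall (n : 'I_N) (t : timeI T) (omega : Omega),
       n%:R * T / N%:R <= time_val t <= n.+1%:R * T / N%:R ->
       Y N l k t omega =
         (n%:R + 1 - time_val t * N%:R / T) *:
           Y N l k (grid T0 (widen_ord (leqnSn N) n)) omega +
         (time_val t * N%:R / T - n%:R) *:
           Y N l k (grid T0 (lift ord0 n)) omega)
  (Y_rate : forall p rho : R, 1 <= p -> 0 <= rho -> rho < beta ->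
     (ereal_sup [set ereal_sup [set (M%:R `^ rho)%:E *
        Lp_norm P p (fun omega =>
          (X (grid T0 m) omega - Y M 0%N 1%N (grid T0 m) omega)%R) |
        m in [set: 'I_M.+1]] | M in [set M : nat | (0 < M)%N]] < +oo)%E)
  (Y_independent : forall N1 N2 : nat, (0 < N1)%N -> (0 < N2)%N ->
     independent_on P [set lk : nat * nat | (0 < lk.2)%N]
       (fun lk => path_pair (Y N1 lk.1 lk.2) (Y N2 lk.1 lk.2)))
  (Y_identically_distributed :
     forall N1 N2 : nat, (0 < N1)%N -> (0 < N2)%N ->
     identically_distributed_on P [set lk : nat * nat | (0 < lk.2)%N]
       (fun lk => path_pair (Y N1 lk.1 lk.2) (Y N2 lk.1 lk.2)))
  (f : contfun (timeI T) E -> contfun (timeI T) E)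
  (f_measurable : measurable_fun setT
     (f : borel (contfun (timeI T) E) -> borel (contfun (timeI T) E)))
  (f_lipschitz : forall v w : contfun (timeI T) E,
     holder_space (@enorm R E) alpha v -> holder_space (@enorm R E) alpha w ->
     [/\ holder_space (@enorm R E) alpha (f v),
         holder_space (@enorm R E) alpha (f w) &
         (holder_norm (@enorm R E) alpha (f v - f w)%R <=
          c%:E * (1 + holder_norm (@enorm R E) alpha v `^ r
                    + holder_norm (@enorm R E) alpha w `^ r)
               * holder_norm (@enorm R E) alpha (v - w)%R)%E]) :
  let fX := fun omega : Omega => f (cpath (fun t => X t omega)) in
  let fY := fun (N l k : nat) (omega : Omega) =>
    f (cpath (fun t => Y N l k t omega)) in
  [/\ (\int[P]_omega holder_norm (@enorm R E) alpha (fX omega) < +oo)%E,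
      (forall p rho : R, 1 <= p -> 0 <= rho -> rho < beta - alpha ->
       (ereal_sup [set (N%:R `^ rho)%:E *
         Lnorm P p%:E (fun omega =>
           holder_norm (@enorm R E) alpha (fX omega - fY N 0%N 1%N omega)%R) |
         N in [set N : nat | (0 < N)%N]] < +oo)%E) &
      (forall p gamma rho : R, 1 <= p -> 0 <= gamma -> gamma < alpha ->
       0 <= rho -> rho < beta - alpha ->
       (ereal_sup [set
         (2 `^ (L%:R * Num.min rho 2^-1) *
          L%:R `^ (- (rho == 2^-1)%:R))%:E *
         Lnorm P p%:E (fun omega =>
           holder_norm (@enorm R E) gamma
             (bochner_integral P fX
              - (\sum_(1 <= k < (2 ^ L).+1)
                   (2 ^ L)%N%:R^-1 *: fY 1%N 0%N k omega)
              - (\sum_(1 <= l < L.+1) \sum_(1 <= k < (2 ^ (L - l)).+1)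
                   (2 ^ (L - l))%N%:R^-1 *:
                     (fY (2 ^ l)%N l k omega - fY (2 ^ l.-1)%N l k omega)))%R) |
         L in [set L : nat | (0 < L)%N]] < +oo)%E)].
Proof.
move=> fX fY.
pose Y1 N := Y N 0%N 1%N.
have mY1 N : (0 < N)%N -> stochastic_process (Y1 N) by move=> N0; exact: Y_process.
have Yi l k : (0 < k)%N -> forall N, (0 < N)%N ->
    forall (n : 'I_N) (t : timeI T) (omega : Omega),
    n%:R * T / N%:R <= time_val t <= n.+1%:R * T / N%:R ->
    Y N l k t omega =
      (n%:R + 1 - time_val t * N%:R / T) *:
        Y N l k (grid T0 (widen_ord (leqnSn N) n)) omega +
      (time_val t * N%:R / T - n%:R) *: Y N l k (grid T0 (lift ord0 n)) omega.
  by move=> k0 N N0; exact: Y_interpolation.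
have error_bound := @composition_error_bound R T T0 d Omega P E E_separable
  beta alpha c r beta1 alpha0 alpha_beta c0 r0 X X_process X_continuous X_holder
  Y1 mY1 (Yi 0%N 1%N isT) Y_rate f f_lipschitz.
have [BX BXm hBX] := @composition_bound R T T0 d Omega P E E_separable
  beta alpha c r alpha0 alpha_beta c0 r0 X X_process X_continuous X_holder
  f f_lipschitz.
split.
(* The first moment of the almost sure majorant bounds the integral. *)
- have [_ /(_ 1%N)[C /(_ tt) CP]] := BXm.
  apply: (@le_lt_trans _ _ C%:E); last exact: ltry.
  apply: integral_le_ub_mean => [w|]; first exact: (holder_norm_ge0 T0).
  by apply: ub_mean_ae CP; apply: filterS hBX => w; rewrite expr1.
- move=> p rho p1 rho0 rhob.
  have [|B Bm hB] := error_bound rho rho0; first by rewrite addrC -ltrBrDr.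
  have [|||||C CP] := @Lnorm_all_moments _ _ _ P nat B (fun n => n.+1%:R `^ rho)
    (fun n w => holder_norm (@enorm R E) alpha (fX w - fY n.+1 0%N 1%N w)%R) p.
  + exact: lt_le_trans p1.
  + by move=> n; rewrite powR_gt0// ltr0n.
  + by move=> n w; exact: (holder_norm_ge0 T0).
  + exact: hB.
  + exact: Bm.
  apply: (@le_lt_trans _ _ C%:E); last exact: ltry.
  by apply: ge_ereal_sup => _ [[//|n] _ <-]; exact: CP.
- move=> p gamma rho p1 gamma0 gammaa rho0 rhob.
  have [|B Bm hB] := error_bound rho rho0; first by rewrite addrC -ltrBrDr.
  have [BY BYm hBY] := @composition_approximation_bound R T T0 d Omega P E E_separable
    beta alpha c r beta1 alpha0 alpha_beta c0 r0 X X_process X_continuous X_holder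
    Y1 mY1 (Yi 0%N 1%N isT) Y_rate f f_lipschitz.
  (* At level 0 the predecessor makes both components equal to the process with N = 1, and [F] reads
     only the first. *)
  pose theta l (lk : nat * nat) :=
    path_pair (Y (2 ^ l)%N lk.1 lk.2) (Y (2 ^ l.-1)%N lk.1 lk.2).
  pose F (l : nat) (s : pathspace (timeI T) E * pathspace (timeI T) E) :
      contfun (timeI T) E :=
    if l is l'.+1 then
      path_functional T0 f (2 ^ l) s.1 - path_functional T0 f (2 ^ l') s.2
    else path_functional T0 f 1 s.1.
  have fYE N l k w : (0 < N)%N -> (0 < k)%N ->
      fY N l k w = path_functional T0 f N (fun t => Y N l k t w).
    by move=> N0 k0; exact: (@path_functionalE R T T0 d Omega E f (fun N => Y N l k) N w (Yi l k k0) N0).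
  have F0E k w : (0 < k)%N -> F 0%N (theta 0%N (0, k)%N w) = fY 1%N 0%N k w.
    by move=> k0; rewrite fYE.
  have FSE l i k w : (0 < k)%N -> F l.+1 (theta l.+1 (i, k) w) =
      fY (2 ^ l.+1)%N i k w - fY (2 ^ l)%N i k w.
    by move=> k0; rewrite !fYE ?expn_gt0.
  have mcp (Z : timeI T -> Omega -> E) : stochastic_process Z ->
      (forall w, continuous (fun t => Z t w)) ->
      measurable_fun setT ((fun w => f (cpath (fun t => Z t w))) :
        Omega -> borel (contfun (timeI T) E)).
    move=> mZ cZ; apply: (@measurableT_comp _ _ _ _ _ _
      (f : borel (contfun (timeI T) E) -> borel (contfun (timeI T) E))) => //.
    exact: process_path_measurable.
  have mfX : measurable_fun setT (fX : Omega -> borel (contfun (timeI T) E)).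
    exact: mcp.
  have mfY n : measurable_fun setT (fY n.+1 0%N 1%N : Omega -> borel (contfun (timeI T) E)).
    apply: mcp; first exact: mY1.
    by move=> w; exact: (@Y_continuous R T T0 d Omega E Y1 (Yi 0%N 1%N isT) n.+1 w isT).
  have mF l : measurable_fun setT (F l :
      (pathspace (timeI T) E * pathspace (timeI T) E)%type -> borel (contfun (timeI T) E)).
    have m1 N : measurable_fun setT ((fun s => path_functional T0 f N s.1) :
        (pathspace (timeI T) E * pathspace (timeI T) E)%type -> borel (contfun (timeI T) E)).
      apply: (@measurableT_comp _ _ _ _ _ _
        (path_functional T0 f N : pathspace (timeI T) E -> borel (contfun (timeI T) E))).
        exact: path_functional_measurable.
      exact: measurable_fst.
    have m2 N : measurable_fun setT ((fun s => path_functional T0 f N s.2) :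
        (pathspace (timeI T) E * pathspace (timeI T) E)%type -> borel (contfun (timeI T) E)).
      apply: (@measurableT_comp _ _ _ _ _ _
        (path_functional T0 f N : pathspace (timeI T) E -> borel (contfun (timeI T) E))).
        exact: path_functional_measurable.
      exact: measurable_snd.
    case: l => [|l]; first exact: m1.
    by apply: borel_measurableB; [exact: contfun_separable|exact: m1|exact: m2].
  have mtheta l i : (0 < i.2)%N -> measurable_fun setT (theta l i).
    by move=> i0; apply: path_pair_measurable; apply: Y_process => //; rewrite expn_gt0.
  have theta_ind l : independent_on P [set lk : nat * nat | (0 < lk.2)%N] (theta l).
    by apply: Y_independent; rewrite expn_gt0.
  have theta_id l : identically_distributed_on P
      [set lk : nat * nat | (0 < lk.2)%N] (theta l).
    by apply: Y_identically_distributed; rewrite expn_gt0.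
  have moments := @multilevel_functional_moments R T T0 d Omega P E E_separable E_type2
    alpha rho fX (fun N => fY N 0%N 1%N) mfX mfY B BY BX Bm BYm BXm hB hBY hBX
    _ _ theta F mtheta theta_ind theta_id mF (fun w => F0E 1%N w isT)
    (fun l w => FSE l 0%N 1%N w isT).
  pose Z L w : contfun (timeI T) E := bochner_integral P fX
    - (\sum_(1 <= k < (2 ^ L).+1) (2 ^ L)%N%:R^-1 *: F 0%N (theta 0%N (0, k)%N w))
    - (\sum_(1 <= l < L.+1) \sum_(1 <= k < (2 ^ (L - l)).+1)
        (2 ^ (L - l))%N%:R^-1 *: F l (theta l (l, k) w)).
  have ZE L w : bochner_integral P fX
      - (\sum_(1 <= k < (2 ^ L).+1) (2 ^ L)%N%:R^-1 *: fY 1%N 0%N k w)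
      - (\sum_(1 <= l < L.+1) \sum_(1 <= k < (2 ^ (L - l)).+1)
          (2 ^ (L - l))%N%:R^-1 *: (fY (2 ^ l)%N l k w - fY (2 ^ l.-1)%N l k w)) = Z L w.
    rewrite /Z; congr (_ - _ - _).
      by apply: eq_big_nat => k /andP[k0 _]; rewrite F0E.
    apply: eq_big_nat => -[//|l] _; apply: eq_big_nat => k /andP[k0 _].
    by rewrite FSE.
  (* The functional [None] supplies the value at time 0 and [Some] the quotients of order alpha; the
     strict inequality gamma < alpha is spent here. *)
  have [||Zm Zf] := @kolmogorov R T T0 E d Omega P nat
    (fun L w => rate rho L.+1 *: Z L.+1 w) gamma alpha gamma0 gammaa.
  + exact: (all_moments_comp (fun L => (L, None)) moments).
  + have hm := all_moments_comp (fun x : nat * (timeI T * timeI T) => (x.1, Some x.2)) moments.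
    apply: all_moments_le hm => [x w|x w]; first by rewrite divr_ge0 ?powR_ge0.
    by rewrite normrZ ger0_norm ?invr_ge0 ?powR_ge0// mulrC.
  have [|||||C CP] := @Lnorm_all_moments _ _ _ P nat
    (fun L w => fine (holder_norm (@enorm R E) gamma (rate rho L.+1 *: Z L.+1 w)))
    (fun L => rate rho L.+1) (fun L w => holder_norm (@enorm R E) gamma (Z L.+1 w)) p.
  + exact: lt_le_trans p1.
  + by move=> L; exact: rate_gt0.
  + by move=> L w; exact: (holder_norm_ge0 T0).
  + move=> L; apply: filterS (Zf L) => w hw.
    rewrite (fineK (holder_norm_fin_num T0 hw)).
    exact: (holder_normZ_ge T0 gamma (Z L.+1 w) (rate_gt0 rho (ltn0Sn L))).
  + exact: Zm.
  apply: (@le_lt_trans _ _ C%:E); last exact: ltry.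
  apply: ge_ereal_sup => _ [[//|L] _ <-].
  under eq_fun do rewrite ZE.
  exact: CP.
Qed.
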